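(* There exist $\zeta\in(\mathbb R\setminus\mathbb Q)^2$, a finite subset $\Lambda\subseteq(\mathbb Z\times\tfrac12\mathbb Z)+\zeta$ and a nonzero $f_*\in\mathcal S(\mathbb R)$ such that the system $\{\pi(\lambda)f_*:\lambda\in\Lambda\cup\{0\}\}$ is linearly dependent over $\mathbb C$.
   Context: For $f\in L^2(\mathbb R)$ and $z=(x,\omega)\in\mathbb R^2$, the time-frequency shift is $\pi(z)f(t)=e^{2\pi i t\omega}f(t-x)$. Complex-valued functions are considered; $\mathcal S(\mathbb R)$ is the Schwartz space. Linear dependence is meant for the family $(\pi(\lambda)f_* )_{\lambda}$ indexed by the distinct points $\lambda\in\Lambda\cup\{0\}$. *)

(* Defs.v *)
From Stdlib Require Import Reals Qreals List.
From Coquelicot Require Import Coquelicot.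

Open Scope R_scope.

Definition irrational (x : R) : Prop := ~ exists q : Q, x = Q2R q.

(* [D n] is the (necessarily unique) n-th derivative of [f], as a complex-valued
   function of a real variable; [C_R_NormedModule] is C as a real normed space. *)
Definition schwartz (f : R -> C) : Prop :=
  exists D : nat -> R -> C,
    (forall t, D 0%nat t = f t) /\
    (forall n t, is_derive (V := C_R_NormedModule) (D n) t (D (S n) t)) /\
    (forall k n, exists M, forall t, Rabs t ^ k * Cmod (D n t) <= M).

(* exp (i * theta) *)
Definition expi (theta : R) : C := (cos theta, sin theta).

Definition tf_shift (z : R * R) (f : R -> C) : R -> C :=
  fun t => Cmult (expi (2 * PI * t * snd z)) (f (t - fst z)).

Definition Csum (l : list C) : C := fold_right Cplus (RtoC 0) l.

Definition finite_pred {I : Type} (A : I -> Prop) : Prop :=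
  exists l : list I, forall i, A i -> In i l.

(* Dependence of the family (v i), i in A, indexed by the points of A: two
   indices carrying the same vector already make the family dependent. *)
Definition linearly_dependent {I : Type} (A : I -> Prop) (v : I -> R -> C)
  : Prop :=
  exists (l : list I) (c : I -> C),
    NoDup l /\ (forall i, In i l -> A i) /\
    (exists i, In i l /\ c i <> RtoC 0) /\
    (forall t, Csum (map (fun i => Cmult (c i) (v i t)) l) = RtoC 0).

(* The translated lattice (Z x (1/2)Z) + zeta. *)
Definition shifted_lattice (zeta z : R * R) : Prop :=
  exists m n : Z, z = (IZR m + fst zeta, IZR n / 2 + snd zeta).

(* Main.v *)
Require Import Defs.
From Stdlib Require Import Reals ZArith Qreals List FinFun Lra Lia ClassicalEpsilon FunctionalExtensionality ProofIrrelevance.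
From Coquelicot Require Import Coquelicot.
Open Scope R_scope.

(* Let g be a Gaussian and S' the time-frequency shift by -zeta. The algebra A of
   l^1 combinations of shifts by Z x (1/2)Z is noncommutative; fibrewise over the
   torus it consists of 2 x 2 matrices, with the commutative algebra B of shifts
   by 2Z x Z as scalars. Applied to functions F = H g with H in A, a relation
   P F = S' F says that the cocycle P over an irrational rotation of the torus
   preserves the line spanned by F.

   There is an element E of A (the frame operator |g><g|, with Gaussian
   coefficients) such that E H g = theta(H) g for every H in A, where theta(H) is in B.
   It has rank one, so its invariant line attracts: if P is a finite truncation of
   a B-multiple of E, a fixed point argument in a weighted l^1 algebra produces
   H with P (H g) = phi S' (H g), where phi is in B and close to 1. Nothing forces
   phi to be constant, but for zeta = (sqrt 2 / N, sqrt 3 / N) the small divisors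
   are bounded below by a power (the norm of a + b sqrt 2 + c sqrt 3 is a nonzero
   integer), so psi phi = c (S' psi S'^-1) can be solved for an invertible psi in B.
   Then f = psi H g satisfies P f = c S' f, and f is a Schwartz function since its
   coefficients decay exponentially. *)

(** Without truncation the invariant line is explicit: [E] sends everything considered here to
    B-multiples of g, so [E F = phi S' F] with phi invertible makes [F] a B-multiple of [S'^-1 g].
    The obstacle is that this function must be [H g] with [H] in A, although zeta is outside the
    lattice. An operator [K] in A with [K S' g = g] supplies it, as [H0 = S'^-1 K S'], and with
    [y = theta(H0)^-1] one has [y E H0 g = g = S' H0 g]. For a finite [P = y E + d] put [H = H0 + k]
    and [phi = 1 + y theta(k)]. Then [P H g = phi g + d H g], so that [P H g = phi S' H g] becomes
    [S' H g = g + phi^-1 d H g]. Replacing g by [K S' g] lifts this to an equation between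
    coefficients, [S' k S'^-1 = phi^-1 d H K], whose right side contracts for small [d]. Two demands
    bear on zeta: it must be small, for [K] to be close enough to 1 that [theta(H0)] is invertible,
    and the rotation must be Diophantine. Dividing sqrt 2 and sqrt 3 by one large integer meets
    both. The weights 1/4 on A and 1/2 on B come from an explicit numerical bound on [theta(1) - 1];
    an index of B doubles when read in A, hence the factor 2 between them. *)

Definition eqdec {I : Type} (x y : I) : {x = y} + {x <> y} :=
  excluded_middle_informative (x = y).

(** * Unordered sums *)

(* Unordered summation: finite subsets of [I] are represented by duplicate-free lists. *)
Definition rsum {I : Type} (m : I -> R) (l : list I) : R :=
  fold_right (fun i s => m i + s) 0 l.

Definition lsum {I : Type} (a : I -> C) (l : list I) : C :=
  fold_right (fun i s => Cplus (a i) s) (RtoC 0) l.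

(** Convergence of the net of finite partial sums. No enumeration of the index set enters, so
    reindexing and Fubini need no rearrangement argument. *)
Definition is_usum {I : Type} (a : I -> C) (s : C) : Prop :=
  forall eps, 0 < eps -> exists l0, forall l, NoDup l -> incl l0 l ->
    Cmod (lsum a l - s)%C < eps.

(** The value is arbitrary when the family is not summable, so every computation with [usum] carries
    a summability proof. *)
Definition usum {I : Type} (a : I -> C) : C :=
  epsilon (inhabits (RtoC 0)) (is_usum a).

(** Norms are handled through upper bounds: a pair (family, bound) is propagated, and constants
    combine by plain arithmetic. *)
Definition bsum {I : Type} (m : I -> R) (M : R) : Prop :=
  forall l, NoDup l -> rsum m l <= M.

Definition abs_bsum {I : Type} (a : I -> C) (M : R) : Prop :=
  bsum (fun i => Cmod (a i)) M.

Section FiniteSums.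
Context {I : Type}.
Implicit Types (m : I -> R) (a : I -> C) (l : list I).

Lemma rsum_app m l l' : rsum m (l ++ l') = rsum m l + rsum m l'.
Proof. induction l as [|x l IH]; simpl; [|rewrite IH]; lra. Qed.

Lemma lsum_app a l l' : lsum a (l ++ l') = (lsum a l + lsum a l')%C.
Proof. induction l as [|x l IH]; simpl; [|rewrite IH]; ring. Qed.

Lemma rsum_ge0 m l : (forall i, 0 <= m i) -> 0 <= rsum m l.
Proof.
intros Hm; induction l as [|x l IH]; simpl; [lra|]. specialize (Hm x); lra.
Qed.

Lemma rsum_le m m' l : (forall i, m i <= m' i) -> rsum m l <= rsum m' l.
Proof.
intros Hm; induction l as [|x l IH]; simpl; [lra|]. specialize (Hm x); lra.
Qed.

Lemma rsum_scal c m l : rsum (fun i => c * m i) l = c * rsum m l.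
Proof. induction l as [|x l IH]; simpl; [|rewrite IH]; ring. Qed.

Lemma rsum_plus m m' l : rsum (fun i => m i + m' i) l = rsum m l + rsum m' l.
Proof. induction l as [|x l IH]; simpl; [|rewrite IH]; ring. Qed.

Lemma rsum_incl m l l' :
  (forall i, 0 <= m i) -> NoDup l -> incl l l' -> rsum m l <= rsum m l'.
Proof.
intros Hm; revert l'; induction l as [|x l IH]; intros l' Hl Hi; simpl.
- apply rsum_ge0; auto.
- destruct (in_split x l') as (l1 & l2 & ->); [apply Hi; left; auto|].
  rewrite rsum_app; simpl.
  assert (H : rsum m l <= rsum m (l1 ++ l2)).
  { inversion Hl; subst. apply IH; auto. intros y Hy.
    assert (Hy' : In y (l1 ++ x :: l2)) by (apply Hi; right; auto).
    apply in_app_or in Hy'. apply in_or_app.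
    destruct Hy' as [Hy'|[Hy'|Hy']]; auto. subst; contradiction. }
  rewrite rsum_app in H; lra.
Qed.

Lemma lsum_Cmod a l : Cmod (lsum a l) <= rsum (fun i => Cmod (a i)) l.
Proof.
induction l as [|x l IH]; simpl.
- rewrite Cmod_0; lra.
- eapply Rle_trans; [apply Cmod_triangle|]; lra.
Qed.

Lemma lsum_ext a a' l : (forall i, In i l -> a i = a' i) -> lsum a l = lsum a' l.
Proof.
induction l as [|x l IH]; simpl; intros H; auto.
rewrite IH, (H x); auto.
Qed.

Lemma lsum_plus a a' l : lsum (fun i => a i + a' i)%C l = (lsum a l + lsum a' l)%C.
Proof. induction l as [|x l IH]; simpl; [|rewrite IH]; ring. Qed.

Lemma lsum_scal c a l : lsum (fun i => c * a i)%C l = (c * lsum a l)%C.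
Proof. induction l as [|x l IH]; simpl; [|rewrite IH]; ring. Qed.

Lemma rsum_map {J : Type} (f : I -> J) (m : J -> R) l :
  rsum m (map f l) = rsum (fun i => m (f i)) l.
Proof. induction l as [|x l IH]; simpl; [|rewrite IH]; auto. Qed.

Lemma lsum_map {J : Type} (f : I -> J) (a : J -> C) l :
  lsum a (map f l) = lsum (fun i => a (f i)) l.
Proof. induction l as [|x l IH]; simpl; [|rewrite IH]; auto. Qed.

Lemma union_ex l l' : exists l'', NoDup l'' /\ incl l l'' /\ incl l' l''.
Proof.
exists (nodup eqdec (l ++ l')); split; [apply NoDup_nodup|].
split; intros y Hy; apply nodup_In; apply in_or_app; auto.
Qed.

Lemma lsum_support a l l' : NoDup l -> NoDup l' -> incl l l' ->
  (forall i, In i l' -> ~ In i l -> a i = RtoC 0) -> lsum a l' = lsum a l.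
Proof.
revert a l'; induction l as [|x l IH]; intros a l' Hl Hl' Hi H0; simpl.
- induction l' as [|y l' IH']; simpl; auto.
  rewrite (H0 y) by (simpl; auto). rewrite IH'. ring. inversion Hl'; auto.
  intros z Hz; destruct Hz. intros i Hin; apply H0; right; auto.
- destruct (in_split x l') as (l1 & l2 & ->); [apply Hi; left; auto|].
  rewrite lsum_app; simpl.
  inversion Hl; subst.
  assert (Nx := NoDup_remove_2 _ _ _ Hl').
  assert (E : lsum a (l1 ++ l2) = lsum a l).
  { apply IH; auto.
    - eapply NoDup_remove_1; eauto.
    - intros y Hy.
      assert (Hy' : In y (l1 ++ x :: l2)) by (apply Hi; right; auto).
      apply in_app_or in Hy'. apply in_or_app.
      destruct Hy' as [Hy'|[Hy'|Hy']]; auto. subst; contradiction.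
    - intros i Hin Hn. apply H0.
      + apply in_or_app. apply in_app_or in Hin. simpl. tauto.
      + intros [<-|?]; auto. }
  rewrite <- E, lsum_app. ring.
Qed.

End FiniteSums.

Section Bounds.
Context {I : Type}.
Implicit Types (m : I -> R) (a : I -> C) (l : list I).

Lemma bsum_ge0 m M : bsum m M -> 0 <= M.
Proof. intros H; specialize (H nil (NoDup_nil _)); simpl in H; auto. Qed.

Lemma bsum_mono m m' M M' : (forall i, m i <= m' i) -> M' <= M -> bsum m' M' -> bsum m M.
Proof.
intros Hm HM H l Hl. specialize (H l Hl). assert (K := rsum_le m m' l Hm). lra.
Qed.

Lemma bsum_term m M i : bsum m M -> m i <= M.
Proof.
intros H. specialize (H (i :: nil)). simpl in H.
assert (NoDup (i :: nil)) by (constructor; [intros []|constructor]).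
specialize (H H0); lra.
Qed.

Lemma bsum_scal c m M : 0 <= c -> bsum m M -> bsum (fun i => c * m i) (c * M).
Proof.
intros Hc H l Hl. rewrite rsum_scal. apply Rmult_le_compat_l; auto.
Qed.

Lemma bsum_plus m m' M M' : bsum m M -> bsum m' M' -> bsum (fun i => m i + m' i) (M + M').
Proof.
intros H H' l Hl. rewrite rsum_plus. specialize (H l Hl); specialize (H' l Hl); lra.
Qed.

Lemma bsum_inj {J : Type} (f : J -> I) m M :
  (forall x y, f x = f y -> x = y) -> bsum m M -> bsum (fun j => m (f j)) M.
Proof.
intros Hf H l Hl. rewrite <- rsum_map. apply H.
apply Injective_map_NoDup; auto.
Qed.

Lemma bsum_surj {J : Type} (f : J -> I) m M : (forall i, 0 <= m i) ->
  (forall i, m i <> 0 -> exists j, i = f j) -> bsum (fun j => m (f j)) M -> bsum m M.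
Proof.
intros Hm Hf H l Hl.
assert (K : exists lj, NoDup lj /\ incl (map f lj) l /\ rsum m l = rsum (fun j => m (f j)) lj).
{ clear H. induction l as [|x l IH].
  - exists nil; simpl; repeat split; auto. constructor. intros y [].
  - inversion Hl; subst. destruct IH as (lj & N & Hin & E); auto.
    destruct (Req_dec (m x) 0) as [Z|Z].
    + exists lj; simpl; repeat split; auto. intros y Hy; right; auto. rewrite Z, E; ring.
    + destruct (Hf x Z) as (j & ->). exists (j :: lj); simpl; repeat split.
      * constructor; auto. intros Hj. apply H1. apply Hin. apply in_map; auto.
      * intros y [Hy|Hy]; [left|right]; auto.
      * rewrite E; auto. }
destruct K as (lj & N & Hin & E). rewrite E; apply H; auto.
Qed.

(** A finite set of pairs is enlarged to a rectangle, on which the row bounds can be added up. *)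
Lemma bsum_pair {J : Type} (m : I -> R) (f : I -> J -> R) (c M : R) :
  (forall i j, 0 <= f i j) -> (forall i, 0 <= m i) ->
  (forall i, bsum (f i) (c * m i)) -> 0 <= c -> bsum m M -> bsum (fun p => f (fst p) (snd p)) (c * M).
Proof.
intros Hf Hm Hr Hc HM l Hl.
destruct (union_ex (map fst l) nil) as (L & NL & iL & _).
destruct (union_ex (map snd l) nil) as (L' & NL' & iL' & _).
apply Rle_trans with (rsum (fun p => f (fst p) (snd p)) (list_prod L L')).
- apply rsum_incl; auto. intros [i j] Hij. apply in_prod_iff; split.
  apply iL. apply (in_map fst _ _ Hij). apply iL'. apply (in_map snd _ _ Hij).
- apply Rle_trans with (c * rsum m L); [|apply Rmult_le_compat_l; auto].
  clear iL. induction L as [|i L IH]; simpl; [lra|].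
  rewrite rsum_app, rsum_map. simpl. inversion NL; subst.
  specialize (IH H2). specialize (Hr i L' NL').
  replace (rsum (fun i0 => f i i0) L') with (rsum (f i) L') by reflexivity. lra.
Qed.

Lemma bsum_sup_ex m M : (forall i, 0 <= m i) -> bsum m M ->
  exists S, bsum m S /\ forall eps, 0 < eps -> exists l0, NoDup l0 /\ S - eps < rsum m l0.
Proof.
intros Hm H.
destruct (completeness (fun x => exists l, NoDup l /\ x = rsum m l)) as (S & HS & HL).
- exists M. intros x (l & Hl & ->). apply H; auto.
- exists 0, nil; split; [constructor|auto].
- exists S; split.
  + intros l Hl. apply HS. exists l; auto.
  + intros eps He. apply NNPP. intros K.
    assert (S <= S - eps); [|lra]. apply HL. intros x (l & Hl & ->).
    apply Rnot_lt_le. intros K'. apply K; exists l; auto.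
Qed.

(** Take [l0] nearly attaining the supremum of the finite sums: a list disjoint from [l0] can only
    add [eps] to it. *)
Lemma bsum_tail m M eps : (forall i, 0 <= m i) -> bsum m M -> 0 < eps ->
  exists l0, NoDup l0 /\ bsum (fun i => if in_dec eqdec i l0 then 0 else m i) eps.
Proof.
intros Hm H He. destruct (bsum_sup_ex m M Hm H) as (S & HS & HE).
destruct (HE eps He) as (l0 & N0 & E0). exists l0; split; auto.
intros l Hl.
assert (K : rsum (fun i => if in_dec eqdec i l0 then 0 else m i) l + rsum m l0 =
            rsum m (filter (fun i => if in_dec eqdec i l0 then false else true) l ++ l0)).
{ rewrite rsum_app. f_equal. induction l as [|x l IH]; simpl; auto.
  inversion Hl; subst. rewrite IH; auto. destruct (in_dec eqdec x l0); simpl; lra. }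
assert (K2 := HS (filter (fun i => if in_dec eqdec i l0 then false else true) l ++ l0)).
assert (K3 : NoDup (filter (fun i => if in_dec eqdec i l0 then false else true) l ++ l0)).
{ apply NoDup_app; auto. apply NoDup_filter; auto.
  intros y Hy. apply filter_In in Hy. destruct Hy as [_ Hy].
  destruct (in_dec eqdec y l0); [discriminate|auto]. }
specialize (K2 K3). lra.
Qed.

End Bounds.

Section Usum.
Context {I : Type}.
Implicit Types (m : I -> R) (a : I -> C) (l : list I) (s : C).

Lemma is_usum_unique a s s' : is_usum a s -> is_usum a s' -> s = s'.
Proof.
intros H H'. apply NNPP. intros N.
assert (P : 0 < Cmod (s - s')%C).
{ apply Cmod_gt_0. intros E. apply N.
  replace s with ((s - s') + s')%C by ring. rewrite E. ring. }
destruct (H (Cmod (s - s')%C / 2)) as (l1 & H1); [lra|].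
destruct (H' (Cmod (s - s')%C / 2)) as (l2 & H2); [lra|].
destruct (union_ex l1 l2) as (l & Nl & i1 & i2).
specialize (H1 l Nl i1). specialize (H2 l Nl i2).
assert (K : Cmod (s - s')%C <= Cmod (lsum a l - s)%C + Cmod (lsum a l - s')%C).
{ replace (s - s')%C with (- (lsum a l - s) + (lsum a l - s'))%C by ring.
  eapply Rle_trans; [apply Cmod_triangle|]. rewrite Cmod_opp; lra. }
lra.
Qed.

Lemma usum_correct a s : is_usum a s -> is_usum a (usum a).
Proof. intros H. apply (epsilon_spec (inhabits (RtoC 0)) (is_usum a)). exists s; auto. Qed.

Lemma usum_unique a s : is_usum a s -> usum a = s.
Proof. intros H. eapply is_usum_unique; eauto. eapply usum_correct; eauto. Qed.

Lemma is_usum_plus a a' s s' : is_usum a s -> is_usum a' s' ->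
  is_usum (fun i => a i + a' i)%C (s + s')%C.
Proof.
intros H H' eps He.
destruct (H (eps / 2)) as (l1 & H1); [lra|].
destruct (H' (eps / 2)) as (l2 & H2); [lra|].
exists (l1 ++ l2). intros l Nl Hi. rewrite lsum_plus.
assert (K1 := H1 l Nl (fun x Hx => Hi x (in_or_app _ _ _ (or_introl Hx)))).
assert (K2 := H2 l Nl (fun x Hx => Hi x (in_or_app _ _ _ (or_intror Hx)))).
replace (lsum a l + lsum a' l - (s + s'))%C with ((lsum a l - s) + (lsum a' l - s'))%C by ring.
eapply Rle_lt_trans; [apply Cmod_triangle|]; lra.
Qed.

Lemma is_usum_scal c a s : is_usum a s -> is_usum (fun i => c * a i)%C (c * s)%C.
Proof.
intros H eps He.
assert (Hc := Cmod_ge_0 c).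
destruct (H (eps / (Cmod c + 1))) as (l1 & H1); [apply Rdiv_lt_0_compat; lra|].
exists l1. intros l Nl Hi. rewrite lsum_scal.
replace (c * lsum a l - c * s)%C with (c * (lsum a l - s))%C by ring.
rewrite Cmod_mult. specialize (H1 l Nl Hi).
assert (P := Cmod_ge_0 (lsum a l - s)%C).
apply Rle_lt_trans with ((Cmod c + 1) * Cmod (lsum a l - s)%C); [nra|].
apply Rlt_le_trans with ((Cmod c + 1) * (eps / (Cmod c + 1))).
apply Rmult_lt_compat_l; lra. right; field; lra.
Qed.

Lemma is_usum_nonneg m M : (forall i, 0 <= m i) -> bsum m M ->
  exists S, is_usum (fun i => RtoC (m i)) (RtoC S).
Proof.
intros Hm H. destruct (bsum_sup_ex m M Hm H) as (S & HS & HE). exists S.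
intros eps He. destruct (HE eps He) as (l0 & N0 & E0). exists l0. intros l Nl Hi.
assert (E : lsum (fun i => RtoC (m i)) l = RtoC (rsum m l)).
{ clear. induction l as [|x l IH]; simpl; auto. rewrite IH, RtoC_plus; auto. }
rewrite E, <- RtoC_minus, Cmod_R.
assert (K := rsum_incl m l0 l Hm N0 Hi). assert (K' := HS l Nl).
apply Rabs_def1; lra.
Qed.

Lemma is_usum_ext a a' s : (forall i, a i = a' i) -> is_usum a s -> is_usum a' s.
Proof.
intros He H eps Hp. destruct (H eps Hp) as (l0 & H0). exists l0. intros l Nl Hi.
rewrite <- (lsum_ext a a' l); auto.
Qed.

(** Write [m] as the difference of the nonnegative families [|m| + m] and [|m|]. *)
Lemma is_usum_real m M : bsum (fun i => Rabs (m i)) M -> exists S, is_usum (fun i => RtoC (m i)) (RtoC S).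
Proof.
intros H.
destruct (is_usum_nonneg (fun i => Rabs (m i)) M) as (S1 & H1); auto.
{ intros i; apply Rabs_pos. }
destruct (is_usum_nonneg (fun i => Rabs (m i) + m i) (M + M)) as (S2 & H2).
{ intros i. unfold Rabs; destruct (Rcase_abs (m i)); lra. }
{ eapply bsum_mono; [| |apply (bsum_plus _ _ _ _ H H)]; [|lra].
  intros i. simpl. unfold Rabs; destruct (Rcase_abs (m i)); lra. }
exists (S2 - S1).
eapply is_usum_ext. 2:{ rewrite RtoC_minus. unfold Cminus. 
 apply is_usum_plus. exact H2. replace (- RtoC S1)%C with (RtoC (-1) * RtoC S1)%C.
 apply is_usum_scal. exact H1. rewrite <- RtoC_mult, <- RtoC_opp. f_equal; ring. }
intros i. simpl. rewrite <- RtoC_mult, <- RtoC_plus. f_equal; ring.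
Qed.

Lemma is_usum_ex a M : abs_bsum a M -> exists s, is_usum a s.
Proof.
intros H.
destruct (is_usum_real (fun i => Re (a i)) M) as (S1 & H1).
{ eapply bsum_mono; [| |exact H]; [|lra]. intros i. eapply Rle_trans; [|apply Rmax_Cmod]. apply Rmax_l. }
destruct (is_usum_real (fun i => Im (a i)) M) as (S2 & H2).
{ eapply bsum_mono; [| |exact H]; [|lra]. intros i. eapply Rle_trans; [|apply Rmax_Cmod]. apply Rmax_r. }
exists (RtoC S1 + Ci * RtoC S2)%C.
eapply is_usum_ext. 2:{ apply is_usum_plus. exact H1. apply is_usum_scal. exact H2. }
intros i. simpl. destruct (a i) as [x y]. unfold Cplus, Cmult, RtoC, Ci, Re, Im; simpl. f_equal; ring.
Qed.

Lemma abs_bsum_usum a M : abs_bsum a M -> is_usum a (usum a).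
Proof. intros H. destruct (is_usum_ex a M H) as (s & Hs). eapply usum_correct; eauto. Qed.

Lemma is_usum_Cmod_le a s M : is_usum a s -> (forall l, NoDup l -> Cmod (lsum a l) <= M) -> Cmod s <= M.
Proof.
intros H K. apply Rnot_lt_le. intros N.
destruct (H (Cmod s - M)) as (l0 & H0); [lra|].
destruct (union_ex l0 nil) as (l & Nl & Hi & _).
specialize (H0 l Nl Hi). specialize (K l Nl).
assert (T : Cmod s <= Cmod (lsum a l) + Cmod (lsum a l - s)%C).
{ replace s with (lsum a l + - (lsum a l - s))%C at 1 by ring.
  eapply Rle_trans; [apply Cmod_triangle|]. rewrite Cmod_opp; lra. }
lra.
Qed.

Lemma usum_Cmod a M : abs_bsum a M -> Cmod (usum a) <= M.
Proof.
intros H. eapply is_usum_Cmod_le. eapply abs_bsum_usum; eauto.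
intros l Hl. eapply Rle_trans; [apply lsum_Cmod|]. apply H; auto.
Qed.

Lemma usum_ext a a' : (forall i, a i = a' i) -> usum a = usum a'.
Proof. intros H. f_equal. extensionality i; auto. Qed.

Lemma usum_plus a a' M M' : abs_bsum a M -> abs_bsum a' M' ->
  usum (fun i => a i + a' i)%C = (usum a + usum a')%C.
Proof.
intros H H'. apply usum_unique, is_usum_plus; eapply abs_bsum_usum; eauto.
Qed.

Lemma usum_scal c a M : abs_bsum a M -> usum (fun i => c * a i)%C = (c * usum a)%C.
Proof. intros H. apply usum_unique, is_usum_scal; eapply abs_bsum_usum; eauto. Qed.

Lemma abs_bsum_plus a a' M M' : abs_bsum a M -> abs_bsum a' M' -> abs_bsum (fun i => a i + a' i)%C (M + M').
Proof.
intros H H'. eapply bsum_mono; [| |apply (bsum_plus _ _ _ _ H H')]; [|lra].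
intros i. simpl. apply Cmod_triangle.
Qed.

Lemma abs_bsum_scal c a M : abs_bsum a M -> abs_bsum (fun i => c * a i)%C (Cmod c * M).
Proof.
intros H. eapply bsum_mono; [| |apply (bsum_scal (Cmod c) _ M (Cmod_ge_0 c) H)]; [|lra].
intros i. simpl. rewrite Cmod_mult; lra.
Qed.

Lemma is_usum_support a l : NoDup l -> (forall i, ~ In i l -> a i = RtoC 0) -> is_usum a (lsum a l).
Proof.
intros Nl H0 eps He. exists l. intros l' Nl' Hi.
rewrite (lsum_support a l l'); auto.
replace (lsum a l - lsum a l)%C with (RtoC 0) by ring. rewrite Cmod_0; auto.
Qed.

End Usum.

Section Reindex.
Context {I : Type}.
Implicit Types (m : I -> R) (a : I -> C).

(** Reindexing along an injection whose image contains the support. A finite [l0] is pulled back by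
    choosing preimages of its points in the support; the remaining points contribute zero. *)
Lemma usum_inj {J : Type} (f : J -> I) a M : abs_bsum a M ->
  (forall x y, f x = f y -> x = y) -> (forall i, a i <> RtoC 0 -> exists j, i = f j) ->
  usum a = usum (fun j => a (f j)).
Proof.
intros H Hf Hs. symmetry. apply usum_unique. intros eps He.
destruct (abs_bsum_usum a M H eps He) as (l0 & H0).
assert (K : exists lj, forall i, In i l0 -> a i <> RtoC 0 -> exists j, In j lj /\ i = f j).
{ clear H0. induction l0 as [|x l0 IH].
  - exists nil. intros i [].
  - destruct IH as (lj & Hj). destruct (excluded_middle_informative (a x = RtoC 0)) as [Z|Z].
    + exists lj. intros i [<-|Hi] Hn; auto. contradiction.
    + destruct (Hs x Z) as (j & ->). exists (j :: lj). intros i [<-|Hi] Hn.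
      exists j; simpl; auto. destruct (Hj i Hi Hn) as (j' & ? & ?). exists j'; simpl; auto. }
destruct K as (lj & Hj). exists lj. intros l Nl Hi.
rewrite <- lsum_map.
assert (Nm : NoDup (map f l)) by (apply Injective_map_NoDup; auto).
destruct (union_ex l0 (map f l)) as (L & NL & i1 & i2).
rewrite <- (lsum_support a (map f l) (nodup eqdec (l0 ++ map f l))); auto.
- apply H0. apply NoDup_nodup. intros y Hy. apply nodup_In, in_or_app; auto.
- apply NoDup_nodup.
- intros y Hy. apply nodup_In, in_or_app; auto.
- intros i Hin Hn. apply nodup_In in Hin. apply in_app_or in Hin.
  destruct Hin as [Hin|]; [|contradiction].
  apply NNPP. intros Z. destruct (Hj i Hin Z) as (j & Hjj & ->).
  apply Hn. apply in_map. auto.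
Qed.

Lemma abs_bsum_inj {J : Type} (f : J -> I) a M :
  (forall x y, f x = f y -> x = y) -> abs_bsum a M -> abs_bsum (fun j => a (f j)) M.
Proof. intros Hf H. apply (bsum_inj f _ M Hf H). Qed.

Lemma lsum_usum {J : Type} (f : J -> I -> C) (M : J -> R) (L : list J) :
  (forall j, abs_bsum (f j) (M j)) ->
  is_usum (fun i => lsum (fun j => f j i) L) (lsum (fun j => usum (f j)) L).
Proof.
intros H. induction L as [|j L IH]; simpl.
- intros eps He. exists nil. intros l _ _.
  assert (E : lsum (fun _ : I => RtoC 0) l = RtoC 0).
  { induction l as [|x l IH]; simpl; [|rewrite IH]; ring. }
  rewrite E. replace (0 - 0)%C with (RtoC 0) by ring. rewrite Cmod_0; auto.
- apply is_usum_plus; auto. eapply abs_bsum_usum; apply H.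
Qed.

Lemma usum_real_ge m M i0 : (forall i, 0 <= m i) -> bsum m M ->
  m i0 <= Re (usum (fun i => RtoC (m i))).
Proof.
intros Hm H. destruct (bsum_sup_ex m M Hm H) as (S & HS & HE).
assert (E : usum (fun i => RtoC (m i)) = RtoC S).
{ apply usum_unique. intros eps He. destruct (HE eps He) as (l0 & N0 & E0). exists l0. intros l Nl Hi.
  assert (E : lsum (fun i => RtoC (m i)) l = RtoC (rsum m l)).
  { clear. induction l as [|x l IH]; simpl; auto. rewrite IH, RtoC_plus; auto. }
  rewrite E, <- RtoC_minus, Cmod_R.
  assert (K := rsum_incl m l0 l Hm N0 Hi). assert (K' := HS l Nl).
  apply Rabs_def1; lra. }
rewrite E. simpl. apply (bsum_term m S i0 HS).
Qed.

End Reindex.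

Section Fubini.
Context {I J : Type}.

Lemma abs_bsum_row (f : I * J -> C) M i : abs_bsum f M -> abs_bsum (fun j => f (i, j)) M.
Proof. intros H. apply (abs_bsum_inj (fun j => (i, j))); auto. intros x y E; congruence. Qed.

Lemma abs_bsum_swap (f : I * J -> C) M : abs_bsum f M -> abs_bsum (fun p : J * I => f (snd p, fst p)) M.
Proof.
intros H. apply (abs_bsum_inj (fun p : J * I => (snd p, fst p))); auto.
intros [x y] [x' y'] E; simpl in E; congruence.
Qed.

Lemma usum_swap (f : I * J -> C) M : abs_bsum f M ->
  usum (fun p : J * I => f (snd p, fst p)) = usum f.
Proof.
intros H. symmetry. apply (usum_inj (fun p : J * I => (snd p, fst p)) f M); auto.
intros [x y] [x' y'] E; simpl in E; congruence.
intros [i j] _. exists (j, i); auto.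
Qed.

Lemma lsum_list_prod (f : I * J -> C) L L' :
  lsum f (list_prod L L') = lsum (fun i => lsum (fun j => f (i, j)) L') L.
Proof.
induction L as [|i L IH]; simpl; auto. rewrite lsum_app, lsum_map, IH; auto.
Qed.

Lemma rsum_list_prod (f : I * J -> R) L L' :
  rsum f (list_prod L L') = rsum (fun i => rsum (fun j => f (i, j)) L') L.
Proof.
induction L as [|i L IH]; simpl; auto. rewrite rsum_app, rsum_map, IH; auto.
Qed.

Lemma NoDup_list_prod (L : list I) (L' : list J) : NoDup L -> NoDup L' -> NoDup (list_prod L L').
Proof.
intros H H'. induction L as [|i L IH]; simpl; [constructor|].
inversion H; subst. apply NoDup_app; auto.
- apply Injective_map_NoDup; auto. intros x y E; congruence.
- intros [a b] Hi Hn. apply in_map_iff in Hi. destruct Hi as (y & E & _).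
  inversion E; subst. apply in_prod_iff in Hn. tauto.
Qed.

(** For finitely many rows a single finite [L'] of columns approximates all row sums simultaneously,
    and the partial sum becomes a sum over a rectangle containing [l0]. *)
Lemma is_usum_fubini (f : I * J -> C) M : abs_bsum f M ->
  is_usum (fun i => usum (fun j => f (i, j))) (usum f).
Proof.
intros H eps He.
destruct (abs_bsum_usum f M H (eps / 2)) as (l0 & H0); [lra|].
exists (map fst l0). intros L NL HL.
apply Rle_lt_trans with (eps / 2); [|lra].
assert (K := lsum_usum (fun i j => f (i, j)) (fun _ => M) L (fun i => abs_bsum_row f M i H)).
apply Rnot_lt_le. intros N.
set (X := lsum (fun i => usum (fun j => f (i, j))) L) in *.
destruct (K (Cmod (X - usum f)%C - eps / 2)) as (l1 & H1); [lra|].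
destruct (union_ex l1 (map snd l0)) as (L' & NL' & i1 & i2).
specialize (H1 L' NL' i1).
assert (E : lsum (fun j => lsum (fun i => f (i, j)) L) L' = lsum f (list_prod L L')).
{ rewrite lsum_list_prod. clear. induction L as [|i L IH]; simpl.
  induction L'; simpl; auto. rewrite IHL'; ring. rewrite lsum_plus, IH; auto. }
rewrite E in H1.
assert (H2 : Cmod (lsum f (list_prod L L') - usum f)%C < eps / 2).
{ apply H0. apply NoDup_list_prod; auto. intros [i j] Hij. apply in_prod_iff; split.
  apply HL. apply (in_map fst _ _ Hij). apply i2. apply (in_map snd _ _ Hij). }
set (Y := lsum f (list_prod L L')) in *.
assert (T : Cmod (X - usum f)%C <= Cmod (Y - usum f)%C + Cmod (Y - X)%C).
{ replace (X - usum f)%C with ((Y - usum f) + - (Y - X))%C by ring.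
  eapply Rle_trans; [apply Cmod_triangle|]. rewrite Cmod_opp; lra. }
lra.
Qed.

Lemma usum_fubini (f : I * J -> C) M : abs_bsum f M ->
  usum (fun i => usum (fun j => f (i, j))) = usum f.
Proof. intros H. apply usum_unique. eapply is_usum_fubini; eauto. Qed.

(** The weighted triangle inequality for row sums: finitely many rows are truncated to a common
    finite list with total error below the alleged excess, and the truncated sum is a rectangle
    sum. *)
Lemma bsum_usum (p : I -> R) (f : I * J -> C) M : (forall i, 0 < p i) ->
  bsum (fun q => p (fst q) * Cmod (f q)) M ->
  bsum (fun i => p i * Cmod (usum (fun j => f (i, j)))) M.
Proof.
intros Hp H L NL.
assert (R0 : forall i, abs_bsum (fun j => f (i, j)) (/ p i * M)).
{ intros i. eapply bsum_mono; [| apply Rle_refl |].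
  2:{ apply bsum_scal; [|apply (bsum_inj (fun j => (i, j)) _ _ (fun x y E => f_equal snd E) H)].
      left. apply Rinv_0_lt_compat; auto. }
  intros j. simpl. specialize (Hp i). rewrite <- Rmult_assoc, Rinv_l; lra. }
apply Rnot_lt_le. intros N.
set (X := rsum _ L) in N.
assert (K : forall eps, 0 < eps -> exists l1, forall l, NoDup l -> incl l1 l ->
   X <= rsum (fun i => p i * Cmod (lsum (fun j => f (i, j)) l)) L + eps).
{ unfold X. clear N X NL. induction L as [|i L IH]; intros eps He; simpl.
  - exists nil; intros; lra.
  - destruct (IH (eps / 2)) as (l1 & H1); [lra|].
    destruct (abs_bsum_usum _ _ (R0 i) (eps / 2 / p i)) as (l2 & H2).
    { apply Rdiv_lt_0_compat; auto; lra. }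
    exists (l1 ++ l2). intros l Nl Hi.
    assert (K1 := H1 l Nl (fun x Hx => Hi x (in_or_app _ _ _ (or_introl Hx)))).
    assert (K2 := H2 l Nl (fun x Hx => Hi x (in_or_app _ _ _ (or_intror Hx)))).
    assert (T : Cmod (usum (fun j => f (i, j))) <= Cmod (lsum (fun j => f (i, j)) l) + eps / 2 / p i).
    { eapply Rle_trans; [|apply Rplus_le_compat_l; left; exact K2].
      set (x := usum _). set (y := lsum _ _).
      replace x with (y + - (y - x))%C at 1 by ring.
      eapply Rle_trans; [apply Cmod_triangle|]. rewrite Cmod_opp; lra. }
    apply (Rmult_le_compat_l (p i)) in T; [|specialize (Hp i); lra].
    replace (p i * (Cmod (lsum (fun j => f (i, j)) l) + eps / 2 / p i)) with
     (p i * Cmod (lsum (fun j => f (i, j)) l) + eps / 2) in T by (field; specialize (Hp i); lra).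
    lra. }
destruct (K ((X - M) / 2)) as (l1 & H1); [lra|].
destruct (union_ex l1 nil) as (l & Nl & i1 & _).
specialize (H1 l Nl i1).
assert (H2 : rsum (fun i => p i * Cmod (lsum (fun j => f (i, j)) l)) L <= M); [|lra].
eapply Rle_trans; [|apply (H (list_prod L l)); apply NoDup_list_prod; auto].
rewrite rsum_list_prod. apply rsum_le. intros i. simpl.
rewrite rsum_scal. apply Rmult_le_compat_l; [left; auto|]. apply lsum_Cmod.
Qed.

Lemma bsum_prod (m : I -> R) (m' : J -> R) M M' : (forall i, 0 <= m i) -> (forall j, 0 <= m' j) ->
  bsum m M -> bsum m' M' -> bsum (fun p => m (fst p) * m' (snd p)) (M * M').
Proof.
intros Hm Hm' H H'. rewrite Rmult_comm.
apply (bsum_pair m (fun i j => m i * m' j)); auto.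
- intros i j. apply Rmult_le_pos; auto.
- intros i. rewrite Rmult_comm. apply bsum_scal; auto.
- eapply bsum_ge0; eauto.
Qed.

End Fubini.

(** * Weighted l^1 algebras on Z^2 *)

Notation I2 := (Z * Z)%type.

Definition zadd (p q : I2) : I2 := (fst p + fst q, snd p + snd q)%Z.
Definition zsub (p q : I2) : I2 := (fst p - fst q, snd p - snd q)%Z.

Lemma zadd_sub p q : zadd q (zsub p q) = p.
Proof. destruct p, q; unfold zadd, zsub; simpl; f_equal; lia. Qed.

Lemma zsub_add p q : zsub (zadd p q) p = q.
Proof. destruct p, q; unfold zadd, zsub; simpl; f_equal; lia. Qed.

Lemma zsub_inj (q q' : I2 * I2) :
  (snd q, zsub (fst q) (snd q)) = (snd q', zsub (fst q') (snd q')) -> q = q'.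
Proof.
destruct q as [[a b] [c d]], q' as [[a' b'] [c' d']]; unfold zsub; simpl.
intros E. injection E as -> -> E1 E2. repeat f_equal; lia.
Qed.

Lemma zsub_sub p q : zsub p (zsub p q) = q.
Proof. destruct p, q; unfold zsub; simpl; f_equal; lia. Qed.

(** For [tau >= 0] the weight is submultiplicative, so [wnorm tau] behaves as a Banach algebra norm.
    Read as Fourier coefficients, such families are functions on the torus that extend
    holomorphically to a strip; lowering [tau] narrows the strip. *)
Definition weight (tau : R) (p : I2) : R :=
  exp (tau * (Rabs (IZR (fst p)) + Rabs (IZR (snd p)))).

Definition wnorm (tau : R) (a : I2 -> C) (M : R) : Prop :=
  bsum (fun i => weight tau i * Cmod (a i)) M.

Lemma weight_pos tau p : 0 < weight tau p.
Proof. apply exp_pos. Qed.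

Lemma weight_0 p : weight 0 p = 1.
Proof. unfold weight. rewrite Rmult_0_l. apply exp_0. Qed.

Lemma weight_mono tau tau' p : tau <= tau' -> weight tau p <= weight tau' p.
Proof.
intros H. unfold weight.
assert (0 <= Rabs (IZR (fst p)) + Rabs (IZR (snd p))).
{ assert (K := Rabs_pos (IZR (fst p))). assert (K' := Rabs_pos (IZR (snd p))). lra. }
destruct (Rle_lt_or_eq_dec _ _ H) as [L|E]; [|subst; lra].
destruct (Req_dec (Rabs (IZR (fst p)) + Rabs (IZR (snd p))) 0) as [Z|Z].
rewrite Z, !Rmult_0_r; lra.
left. apply exp_increasing. apply Rmult_lt_compat_r; lra.
Qed.

Lemma weight_add tau p q : 0 <= tau -> weight tau (zadd p q) <= weight tau p * weight tau q.
Proof.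
intros H. unfold weight. rewrite <- exp_plus.
assert (K : tau * (Rabs (IZR (fst (zadd p q))) + Rabs (IZR (snd (zadd p q)))) <=
  tau * (Rabs (IZR (fst p)) + Rabs (IZR (snd p))) + tau * (Rabs (IZR (fst q)) + Rabs (IZR (snd q)))).
{ rewrite <- Rmult_plus_distr_l. apply Rmult_le_compat_l; auto. simpl. rewrite !plus_IZR.
  assert (K := Rabs_triang (IZR (fst p)) (IZR (fst q))).
  assert (K' := Rabs_triang (IZR (snd p)) (IZR (snd q))). lra. }
destruct (Rle_lt_or_eq_dec _ _ K) as [L|E]; [left; apply exp_increasing; auto|rewrite E; lra].
Qed.

Lemma weight_ge1 tau p : 0 <= tau -> 1 <= weight tau p.
Proof. intros H. rewrite <- (weight_0 p). apply weight_mono; auto. Qed.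

Lemma wnorm_mono tau tau' a M M' : tau' <= tau -> M <= M' -> wnorm tau a M -> wnorm tau' a M'.
Proof.
intros H HM. apply bsum_mono; auto. intros i. apply Rmult_le_compat_r.
apply Cmod_ge_0. apply weight_mono; auto.
Qed.

Lemma wnorm_abs_bsum tau a M : 0 <= tau -> wnorm tau a M -> abs_bsum a M.
Proof.
intros H. apply bsum_mono; [|lra]. intros i.
assert (K := weight_ge1 tau i H). assert (K' := Cmod_ge_0 (a i)). nra.
Qed.

Lemma abs_bsum_wnorm a M : abs_bsum a M -> wnorm 0 a M.
Proof. apply bsum_mono; [|lra]. intros i. rewrite weight_0; lra. Qed.

Lemma wnorm_pointwise tau a b M : (forall i, Cmod (a i) <= Cmod (b i)) -> wnorm tau b M -> wnorm tau a M.
Proof.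
intros H. apply bsum_mono; [|lra]. intros i. apply Rmult_le_compat_l; auto. left; apply weight_pos.
Qed.

(** Only unweighted summability is bundled. Weighted bounds remain separate predicates, so one
    element can be measured with several weights. *)
Record l1 := mkl1 { co :> I2 -> C; l1_ok : exists M, abs_bsum co M }.

Lemma l1_eq (a b : l1) : (forall i, a i = b i) -> a = b.
Proof.
destruct a as [a Ha], b as [b Hb]; simpl. intros H.
assert (E : a = b) by (extensionality i; auto). subst. f_equal. apply proof_irrelevance.
Qed.

Lemma l1_bound (a : l1) : exists M, 0 <= M /\ abs_bsum a M /\ forall i, Cmod (a i) <= M.
Proof.
destruct a as [a [M H]]; simpl. exists M. split; [eapply bsum_ge0; eauto|split; auto].
intros i. apply (bsum_term (fun i => Cmod (a i))); auto.
Qed.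

(** Transparent, so that the coefficients of the result reduce to [a]. *)
Definition l1_of (tau : R) (a : I2 -> C) (H : 0 <= tau /\ exists M, wnorm tau a M) : l1.
Proof.
exists a. destruct H as [H0 [M H]]. exists M. eapply wnorm_abs_bsum; eauto.
Defined.

Definition delta (p : I2) (i : I2) : C := if eqdec i p then RtoC 1 else RtoC 0.

Lemma abs_bsum_support {I} (a : I -> C) l : NoDup l -> (forall i, ~ In i l -> a i = RtoC 0) ->
  abs_bsum a (rsum (fun i => Cmod (a i)) l).
Proof.
intros Nl H L NL.
apply Rle_trans with (rsum (fun i => Cmod (a i)) (filter (fun i => if in_dec eqdec i l then true else false) L)).
- clear NL. induction L as [|x L IH]; simpl; [lra|].
  destruct (in_dec eqdec x l) as [i|n]; simpl; [lra|]. rewrite (H x n), Cmod_0; lra.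
- apply rsum_incl. intros; apply Cmod_ge_0. apply NoDup_filter; auto.
  intros i Hi. apply filter_In in Hi. destruct Hi as [_ Hi]. destruct (in_dec eqdec i l); auto; discriminate.
Qed.

Lemma wnorm_support tau a l : NoDup l -> (forall i, ~ In i l -> a i = RtoC 0) ->
  wnorm tau a (rsum (fun i => weight tau i * Cmod (a i)) l).
Proof.
intros Nl H.
assert (K := abs_bsum_support (fun i => RtoC (weight tau i) * a i)%C l Nl).
assert (E : (fun i => Cmod (RtoC (weight tau i) * a i)%C) = (fun i => weight tau i * Cmod (a i))).
{ extensionality i. rewrite Cmod_mult, Cmod_R, Rabs_pos_eq; auto. left; apply weight_pos. }
unfold abs_bsum in K. rewrite E in K. apply K.
intros i Hi; rewrite H; auto; ring.
Qed.

Lemma NoDup1 {I} (x : I) : NoDup (x :: nil).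
Proof. constructor; [intros []|constructor]. Qed.

Lemma wnorm_delta tau p : wnorm tau (delta p) (weight tau p).
Proof.
assert (K := wnorm_support tau (delta p) (p :: nil) (NoDup1 p)).
simpl in K. unfold delta at 3 in K. destruct (eqdec p p); [|congruence].
rewrite Cmod_1, Rmult_1_r, Rplus_0_r in K. apply K.
intros i Hi. unfold delta. destruct (eqdec i p); auto. subst. elim Hi; simpl; auto.
Qed.

Lemma l1_0_ok : exists M, abs_bsum (fun _ : I2 => RtoC 0) M.
Proof. exists 0. intros l _. rewrite Cmod_0. induction l; simpl; lra. Qed.
Definition l1_0 : l1 := mkl1 _ l1_0_ok.

Lemma l1_1_ok : exists M, abs_bsum (delta (0, 0)%Z) M.
Proof. eexists. eapply wnorm_abs_bsum, wnorm_delta. apply Rle_refl. Qed.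
Definition l1_1 : l1 := mkl1 _ l1_1_ok.

Lemma l1_add_ok (a b : l1) : exists M, abs_bsum (fun i => a i + b i)%C M.
Proof.
destruct (l1_ok a) as [M H], (l1_ok b) as [M' H']. eexists. apply abs_bsum_plus; eauto.
Qed.
Definition l1_add (a b : l1) : l1 := mkl1 _ (l1_add_ok a b).

Lemma l1_scal_ok c (a : l1) : exists M, abs_bsum (fun i => c * a i)%C M.
Proof. destruct (l1_ok a) as [M H]. eexists. apply abs_bsum_scal; eauto. Qed.
Definition l1_scal (c : C) (a : l1) : l1 := mkl1 _ (l1_scal_ok c a).

Definition l1_opp (a : l1) : l1 := l1_scal (RtoC (-1)) a.
Definition l1_sub (a b : l1) : l1 := l1_add a (l1_opp b).

(** Convolution twisted by a phase [tw]: one construction for both algebras, with [one_tw] for the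
    commutative B and [twA] for A. *)
Definition conv (tw : I2 -> I2 -> C) (a b : I2 -> C) (nu : I2) : C :=
  usum (fun mu => tw mu (zsub nu mu) * (a mu * b (zsub nu mu)))%C.

Section Conv.
Variable tw : I2 -> I2 -> C.
Hypothesis Htw : forall i j, Cmod (tw i j) = 1.

(** The change of variables [(nu, mu) -> (mu, nu - mu)] turns the terms into those of a product
    family, and submultiplicativity splits the weight. *)
Lemma conv_bsum tau a b A B : 0 <= tau -> wnorm tau a A -> wnorm tau b B ->
  bsum (fun q : I2 * I2 => weight tau (fst q) *
      Cmod (tw (snd q) (zsub (fst q) (snd q)) * (a (snd q) * b (zsub (fst q) (snd q))))%C) (A * B).
Proof.
intros Ht HA HB.
assert (K := bsum_prod (fun i => weight tau i * Cmod (a i)) (fun i => weight tau i * Cmod (b i)) A B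
   (fun i => Rmult_le_pos _ _ (Rlt_le _ _ (weight_pos tau i)) (Cmod_ge_0 (a i)))
   (fun i => Rmult_le_pos _ _ (Rlt_le _ _ (weight_pos tau i)) (Cmod_ge_0 (b i))) HA HB).
apply (bsum_inj (fun q : I2 * I2 => (snd q, zsub (fst q) (snd q)))) in K.
2:{ exact zsub_inj. }
revert K. apply bsum_mono; [|lra]. intros [nu mu]; simpl.
rewrite !Cmod_mult, Htw, Rmult_1_l.
assert (W := weight_add tau mu (zsub nu mu) Ht). rewrite zadd_sub in W.
replace (weight tau mu * Cmod (a mu) * (weight tau (zsub nu mu) * Cmod (b (zsub nu mu)))) with
 (weight tau mu * weight tau (zsub nu mu) * (Cmod (a mu) * Cmod (b (zsub nu mu)))) by ring.
apply Rmult_le_compat_r; auto. apply Rmult_le_pos; apply Cmod_ge_0.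
Qed.

Lemma conv_pairs (a b : l1) : exists M, abs_bsum (fun q : I2 * I2 =>
   (tw (snd q) (zsub (fst q) (snd q)) * (a (snd q) * b (zsub (fst q) (snd q))))%C) M.
Proof.
destruct (l1_ok a) as [M H], (l1_ok b) as [M' H']. exists (M * M').
generalize (conv_bsum 0 a b M M' (Rle_refl 0) (abs_bsum_wnorm _ _ H) (abs_bsum_wnorm _ _ H')).
apply bsum_mono; [|lra]. intros i; rewrite weight_0; lra.
Qed.

Lemma conv_row (a b : l1) nu : exists M, abs_bsum (fun mu => tw mu (zsub nu mu) * (a mu * b (zsub nu mu)))%C M.
Proof.
destruct (conv_pairs a b) as [M H]. exists M. apply (abs_bsum_row _ M nu H).
Qed.

Lemma conv_wnorm tau a b A B : 0 <= tau -> wnorm tau a A -> wnorm tau b B -> wnorm tau (conv tw a b) (A * B).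
Proof.
intros Ht HA HB. assert (K := conv_bsum tau a b A B Ht HA HB).
apply (bsum_usum (weight tau) (fun q => (tw (snd q) (zsub (fst q) (snd q)) * (a (snd q) * b (zsub (fst q) (snd q))))%C)); auto.
apply weight_pos.
Qed.

Lemma conv_ok (a b : l1) : exists M, abs_bsum (conv tw a b) M.
Proof.
destruct (l1_ok a) as [M H], (l1_ok b) as [M' H']. exists (M * M').
eapply wnorm_abs_bsum; [apply Rle_refl|]. apply conv_wnorm; try lra; apply abs_bsum_wnorm; auto.
Qed.

Definition gmul (a b : l1) : l1 := mkl1 _ (conv_ok a b).

Lemma gmul_add_l a b c : gmul (l1_add a b) c = l1_add (gmul a c) (gmul b c).
Proof.
apply l1_eq; intros nu; simpl. unfold conv; simpl.
destruct (conv_row a c nu) as [M H], (conv_row b c nu) as [M' H'].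
rewrite <- (usum_plus _ _ M M' H H'). apply usum_ext. intros mu; ring.
Qed.

Lemma gmul_add_r a b c : gmul a (l1_add b c) = l1_add (gmul a b) (gmul a c).
Proof.
apply l1_eq; intros nu; simpl. unfold conv; simpl.
destruct (conv_row a b nu) as [M H], (conv_row a c nu) as [M' H'].
rewrite <- (usum_plus _ _ M M' H H'). apply usum_ext. intros mu; ring.
Qed.

Lemma gmul_scal_l k a b : gmul (l1_scal k a) b = l1_scal k (gmul a b).
Proof.
apply l1_eq; intros nu; simpl. unfold conv; simpl.
destruct (conv_row a b nu) as [M H].
rewrite <- (usum_scal k _ M H). apply usum_ext. intros mu; ring.
Qed.

Lemma gmul_scal_r k a b : gmul a (l1_scal k b) = l1_scal k (gmul a b).
Proof.
apply l1_eq; intros nu; simpl. unfold conv; simpl.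
destruct (conv_row a b nu) as [M H].
rewrite <- (usum_scal k _ M H). apply usum_ext. intros mu; ring.
Qed.

Lemma gmul_wnorm tau (a b : l1) A B : 0 <= tau -> wnorm tau a A -> wnorm tau b B -> wnorm tau (gmul a b) (A * B).
Proof. apply conv_wnorm. Qed.

End Conv.

Lemma conv_swap tw tw' (a b : l1) nu : (forall i j, Cmod (tw i j) = 1) ->
  (forall i j, tw i j * (a i * b j) = tw' j i * (b j * a i))%C ->
  conv tw a b nu = conv tw' b a nu.
Proof.
intros Htw H. unfold conv.
destruct (conv_row tw Htw a b nu) as [M HM].
rewrite (usum_inj (fun mu => zsub nu mu) _ M HM).
- apply usum_ext. intros mu. rewrite zsub_sub. rewrite H. reflexivity.
- intros x y E. rewrite <- (zsub_sub nu x), E, zsub_sub; auto.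
- intros i _. exists (zsub nu i). rewrite zsub_sub; auto.
Qed.

Definition one_tw (i j : I2) : C := RtoC 1.
Lemma one_tw_mod i j : Cmod (one_tw i j) = 1.
Proof. apply Cmod_1. Qed.

Definition cmul : l1 -> l1 -> l1 := gmul one_tw one_tw_mod.

Lemma cmul_comm a b : cmul a b = cmul b a.
Proof.
apply l1_eq; intros nu; simpl. apply conv_swap. apply one_tw_mod.
intros i j; unfold one_tw; ring.
Qed.

Lemma gmul_1_l tw H a : (forall j, tw (0, 0)%Z j = RtoC 1) -> gmul tw H l1_1 a = a.
Proof.
intros H1. apply l1_eq; intros nu; simpl. unfold conv.
transitivity (lsum (fun mu => tw mu (zsub nu mu) * (l1_1 mu * a (zsub nu mu)))%C ((0,0)%Z :: nil)).
- apply usum_unique. apply is_usum_support. apply NoDup1.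
  intros i Hi. simpl. unfold delta. destruct (eqdec i (0,0)%Z). subst; elim Hi; simpl; auto. ring.
- simpl. rewrite H1. unfold delta. destruct (eqdec (0,0)%Z (0,0)%Z); [|congruence].
  replace (zsub nu (0,0)%Z) with nu. ring. destruct nu; unfold zsub; simpl; f_equal; lia.
Qed.

(** Both sides are sums of [a i * b j * c (nu - i - j)] over pairs; the two bracketings differ by a
    shear of the index pair. *)
Lemma cmul_assoc a b c : cmul a (cmul b c) = cmul (cmul a b) c.
Proof.
apply l1_eq; intros nu; simpl. unfold conv, one_tw.
destruct (l1_bound a) as (Ma & Pa & Ha & _), (l1_bound b) as (Mb & Pb & Hb & _), (l1_bound c) as (Mc & Pc & _ & Hc).
assert (K : abs_bsum (fun q : I2 * I2 => a (fst q) * (b (snd q) * c (zsub (zsub nu (fst q)) (snd q))))%C (Mc * (Ma * Mb))).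
{ generalize (bsum_scal Mc _ _ Pc (bsum_prod _ _ _ _ (fun i => Cmod_ge_0 (a i)) (fun i => Cmod_ge_0 (b i)) Ha Hb)).
  apply bsum_mono; [|lra]. intros [i j]; simpl. rewrite !Cmod_mult.
  specialize (Hc (zsub (zsub nu i) j)).
  assert (X := Cmod_ge_0 (a i)). assert (Y := Cmod_ge_0 (b j)). assert (0 <= Cmod (a i) * Cmod (b j)) by nra.
  nra. }
transitivity (usum (fun q : I2 * I2 => a (fst q) * (b (snd q) * c (zsub (zsub nu (fst q)) (snd q))))%C).
- rewrite <- (usum_fubini _ _ K). apply usum_ext. intros mu. simpl.
  rewrite Cmult_1_l.
  destruct (conv_row _ one_tw_mod b c (zsub nu mu)) as [M H].
  rewrite <- (usum_scal _ _ M H). apply usum_ext. intros k. unfold one_tw; ring.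
- rewrite (usum_inj (fun q : I2 * I2 => (snd q, zsub (fst q) (snd q))) _ _ K).
  + assert (K2 : abs_bsum (fun q : I2 * I2 => a (snd q) * (b (zsub (fst q) (snd q)) * c (zsub nu (fst q))))%C (Mc * (Ma * Mb))).
    { apply (abs_bsum_inj (fun q : I2 * I2 => (snd q, zsub (fst q) (snd q)))) in K.
      - revert K. apply bsum_mono; [|lra]. intros [x y]; simpl.
        replace (zsub (zsub nu y) (zsub x y)) with (zsub nu x). lra.
        unfold zsub; simpl; f_equal; lia.
      - exact zsub_inj. }
    transitivity (usum (fun q : I2 * I2 => a (snd q) * (b (zsub (fst q) (snd q)) * c (zsub nu (fst q))))%C).
    * apply usum_ext. intros [x y]; simpl. replace (zsub (zsub nu y) (zsub x y)) with (zsub nu x). auto.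
      unfold zsub; simpl; f_equal; lia.
    * rewrite <- (usum_fubini _ _ K2). apply usum_ext. intros mu. simpl.
      rewrite Cmult_1_l. rewrite Cmult_comm.
      destruct (conv_row _ one_tw_mod a b mu) as [M H].
      rewrite <- (usum_scal _ _ M H). apply usum_ext. intros k. unfold one_tw; ring.
  + exact zsub_inj.
  + intros [x y] _. exists (zadd x y, x). simpl. rewrite zsub_add; auto.
Qed.

Lemma l1_ring : ring_theory l1_0 l1_1 l1_add cmul l1_sub l1_opp eq.
Proof.
constructor; intros.
- apply l1_eq; intros; simpl; ring.
- apply l1_eq; intros; simpl; ring.
- apply l1_eq; intros; simpl; ring.
- apply gmul_1_l. reflexivity.
- apply cmul_comm.
- apply cmul_assoc.
- apply gmul_add_l.
- reflexivity.
- apply l1_eq; intros; simpl. ring.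
Qed.


Add Ring l1_r : l1_ring.

Lemma cmul_wnorm tau (a b : l1) A B : 0 <= tau -> wnorm tau a A -> wnorm tau b B -> wnorm tau (cmul a b) (A * B).
Proof. apply gmul_wnorm. Qed.

Lemma wnorm_add tau (a b : l1) A B : wnorm tau a A -> wnorm tau b B -> wnorm tau (l1_add a b) (A + B).
Proof.
intros H H'. generalize (bsum_plus _ _ _ _ H H'). apply bsum_mono; [|lra]. intros i. simpl.
rewrite <- Rmult_plus_distr_l. apply Rmult_le_compat_l. left; apply weight_pos. apply Cmod_triangle.
Qed.

Lemma wnorm_scal tau k (a : l1) A : wnorm tau a A -> wnorm tau (l1_scal k a) (Cmod k * A).
Proof.
intros H. generalize (bsum_scal _ _ _ (Cmod_ge_0 k) H). apply bsum_mono; [|lra]. intros i. simpl.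
rewrite Cmod_mult. right; ring.
Qed.

Lemma wnorm_opp tau (a : l1) A : wnorm tau a A -> wnorm tau (l1_opp a) A.
Proof.
intros H. apply (wnorm_scal tau (RtoC (-1))) in H. replace (Cmod (RtoC (-1))) with 1 in H. rewrite Rmult_1_l in H; exact H.
rewrite Cmod_R. unfold Rabs; destruct Rcase_abs; lra.
Qed.

Lemma wnorm_sub tau (a b : l1) A B : wnorm tau a A -> wnorm tau b B -> wnorm tau (l1_sub a b) (A + B).
Proof. intros H H'. apply wnorm_add; auto. apply wnorm_opp; auto. Qed.

Lemma wnorm_1 tau : wnorm tau l1_1 1.
Proof.
assert (K := wnorm_delta tau (0,0)%Z). unfold weight in K at 1. simpl in K.
rewrite Rabs_R0, Rplus_0_r, Rmult_0_r, exp_0 in K. exact K.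
Qed.

Lemma wnorm_0 tau : wnorm tau l1_0 0.
Proof. intros l _. simpl. rewrite Cmod_0. induction l; simpl; lra. Qed.

Lemma wnorm_ge0 tau a M : wnorm tau a M -> 0 <= M.
Proof. apply bsum_ge0. Qed.

Lemma wnorm_term tau a M i : 0 <= tau -> wnorm tau a M -> Cmod (a i) <= M.
Proof. intros Ht H. apply (wnorm_abs_bsum _ _ _ Ht) in H. apply (bsum_term _ _ i H). Qed.

Lemma wnorm_zero tau (a : l1) : 0 <= tau -> (forall eps, 0 < eps -> wnorm tau a eps) -> a = l1_0.
Proof.
intros Ht H. apply l1_eq. intros i. simpl. apply Cmod_eq_0.
apply Rle_antisym; [|apply Cmod_ge_0]. apply le_epsilon. intros eps He.
rewrite Rplus_0_l. eapply wnorm_term; eauto.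
Qed.

(** Completeness in the form used by every iteration below: geometric increments, with the error
    estimate of the limit. *)
Lemma l1_complete tau (u : nat -> l1) c q : 0 <= tau -> 0 <= q < 1 -> 0 <= c ->
  (forall n, wnorm tau (l1_sub (u (S n)) (u n)) (c * q ^ n)) ->
  exists v : l1, forall n, wnorm tau (l1_sub v (u n)) (c * q ^ n / (1 - q)).
Proof.
intros Ht Hq Hc Hu.
(* The factor [1 - q ^ k] is the exact geometric partial sum; it makes the induction on [k]
   close. *)
assert (D : forall n k, wnorm tau (l1_sub (u (n + k)%nat) (u n)) (c * q ^ n * (1 - q ^ k) / (1 - q))).
{ intros n k. induction k as [|k IH].
  - replace (n + 0)%nat with n by lia. replace (l1_sub (u n) (u n)) with l1_0 by ring.
    eapply wnorm_mono; [apply Rle_refl| |apply wnorm_0]. simpl. right; field; lra.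
  - replace (n + S k)%nat with (S (n + k)) by lia.
    replace (l1_sub (u (S (n + k))) (u n)) with
      (l1_add (l1_sub (u (S (n + k))) (u (n + k)%nat)) (l1_sub (u (n + k)%nat) (u n))) by ring.
    eapply wnorm_mono; [apply Rle_refl| |apply wnorm_add; [apply Hu|apply IH]].
    rewrite pow_add. simpl. right; field; lra. }
assert (D' : forall n m, (n <= m)%nat -> wnorm tau (l1_sub (u m) (u n)) (c * q ^ n / (1 - q))).
{ intros n m H. replace m with (n + (m - n))%nat by lia.
  eapply wnorm_mono; [apply Rle_refl| |apply D].
  apply Rmult_le_compat_r. left; apply Rinv_0_lt_compat; lra.
  assert (0 <= c * q ^ n) by (apply Rmult_le_pos; auto; apply pow_le; lra).
  assert (0 <= q ^ (m - n)) by (apply pow_le; lra). nra. }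
assert (Z : forall eps, 0 < eps -> exists N, c * q ^ N / (1 - q) < eps).
{ intros eps He.
  destruct (pow_lt_1_zero q (Rabs_def1 _ _ (proj2 Hq) ltac:(lra)) (eps * (1 - q) / (c + 1))) as (N & HN).
  { apply Rdiv_lt_0_compat; [apply Rmult_lt_0_compat|]; lra. }
  exists N. specialize (HN N (Nat.le_refl N)). rewrite Rabs_pos_eq in HN by (apply pow_le; lra).
  apply Rlt_div_l; [lra|].
  apply Rle_lt_trans with ((c + 1) * q ^ N).
  assert (0 <= q ^ N) by (apply pow_le; lra). nra.
  apply Rlt_le_trans with ((c + 1) * (eps * (1 - q) / (c + 1))).
  apply Rmult_lt_compat_l; lra. right; field; lra. }
assert (P : forall i, exists x : C, forall n, Cmod (x - u n i)%C <= c * q ^ n / (1 - q)).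
{ intros i.
  assert (B : forall n m, (n <= m)%nat -> Cmod (u m i - u n i)%C <= c * q ^ n / (1 - q)).
  { intros n m H. assert (K := wnorm_term _ _ _ i Ht (D' n m H)). simpl in K.
    replace (u m i + -1 * u n i)%C with (u m i - u n i)%C in K by ring. exact K. }
  assert (Cr : forall (p : C -> R), (forall z, Rabs (p z) <= Cmod z) -> (forall z w, p (z - w)%C = p z - p w) ->
     ex_finite_lim_seq (fun n => p (u n i))).
  { intros p Hp Hl. apply ex_lim_seq_cauchy_corr. intros eps. destruct (Z (eps / 2)) as (N & HN).
    { destruct eps; simpl; lra. }
    exists N. intros n m Hn Hm. rewrite <- Hl.
    eapply Rle_lt_trans; [apply Hp|].
    replace (u n i - u m i)%C with ((u n i - u N i) - (u m i - u N i))%C by ring.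
    eapply Rle_lt_trans; [apply Cmod_triangle|]. rewrite Cmod_opp.
    assert (K1 := B N n Hn). assert (K2 := B N m Hm). lra. }
  assert (Hre : forall z, Rabs (fst z) <= Cmod z) by (intros z; eapply Rle_trans; [apply Rmax_l|apply Rmax_Cmod]).
  assert (Him : forall z, Rabs (snd z) <= Cmod z) by (intros z; eapply Rle_trans; [apply Rmax_r|apply Rmax_Cmod]).
  destruct (Cr fst Hre) as (x & Hx). { intros [] []; reflexivity. }
  destruct (Cr snd Him) as (y & Hy). { intros [] []; reflexivity. }
  exists (x, y). intros n. apply le_epsilon. intros eps He.
  apply is_lim_seq_spec in Hx. apply is_lim_seq_spec in Hy.
  assert (Hp : 0 < eps / 2) by lra.
  destruct (Hx (mkposreal _ Hp)) as (N1 & H1). destruct (Hy (mkposreal _ Hp)) as (N2 & H2). simpl in H1, H2.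
  set (m := (n + N1 + N2)%nat). specialize (H1 m ltac:(lia)). specialize (H2 m ltac:(lia)).
  specialize (B n m ltac:(lia)).
  replace (Cminus (x, y) (u n i)) with (Cplus (u m i - u n i) (Cminus (x, y) (u m i)))%C by (change (R * R)%type with C; ring).
  eapply Rle_trans; [apply Cmod_triangle|].
  assert (T : Cmod ((x, y) - u m i)%C <= eps).
  { destruct (u m i) as [a b] eqn:E. simpl in H1, H2.
    replace ((x, y) - (a, b))%C with (RtoC (x - a) + Ci * RtoC (y - b))%C
      by (apply injective_projections; simpl; ring).
    eapply Rle_trans; [apply Cmod_triangle|].
    rewrite Cmod_mult, !Cmod_R. replace (Cmod Ci) with 1.
    rewrite (Rabs_minus_sym x), (Rabs_minus_sym y). lra.
    unfold Cmod, Ci; simpl. replace (0 * (0 * 1) + 1 * (1 * 1)) with 1 by ring. rewrite sqrt_1; auto. }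
  lra. }
destruct (choice _ P) as (v & Hv).
(* The weighted bound is tested on one finite list [l], on which coordinatewise convergence is
   uniform: [m] is taken so large that the error against [u m] costs at most [eps] on [l]. *)
assert (Q : forall n, wnorm tau (fun i => v i - u n i)%C (c * q ^ n / (1 - q))).
{ intros n l Nl. apply le_epsilon. intros eps He.
  assert (Hs : 0 <= rsum (weight tau) l) by (apply rsum_ge0; intros; left; apply weight_pos).
  destruct (Z (eps / (rsum (weight tau) l + 1))) as (N & HN). { apply Rdiv_lt_0_compat; lra. }
  set (m := (n + N)%nat).
  assert (HN' : c * q ^ m / (1 - q) <= eps / (rsum (weight tau) l + 1)).
  { eapply Rle_trans; [|left; exact HN]. apply Rmult_le_compat_r. left; apply Rinv_0_lt_compat; lra.
    apply Rmult_le_compat_l; auto. unfold m. rewrite pow_add.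
    assert (0 <= q ^ N) by (apply pow_le; lra).
    assert (q ^ n <= 1). { rewrite <- (pow1 n). apply pow_incr; lra. } nra. }
  eapply Rle_trans with (rsum (fun i => weight tau i * Cmod (l1_sub (u m) (u n) i) + (c * q ^ m / (1 - q)) * weight tau i) l).
  - apply rsum_le. intros i. specialize (Hv i m). assert (W := weight_pos tau i).
    assert (T : Cmod (v i - u n i)%C <= Cmod (l1_sub (u m) (u n) i) + c * q ^ m / (1 - q)).
    { replace (v i - u n i)%C with ((l1_sub (u m) (u n) i) + (v i - u m i))%C by (simpl; ring).
      eapply Rle_trans; [apply Cmod_triangle|]; lra. }
    nra.
  - rewrite rsum_plus, rsum_scal. apply Rplus_le_compat. apply (D' n m); auto; lia.
    eapply Rle_trans; [apply Rmult_le_compat_r; [auto|exact HN']|].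
    apply Rle_trans with (eps / (rsum (weight tau) l + 1) * (rsum (weight tau) l + 1)).
    apply Rmult_le_compat_l; [|lra]. apply Rdiv_le_0_compat; lra. right; field; lra. }
assert (V : exists M, abs_bsum v M).
{ destruct (l1_ok (u O)) as (M & H). eexists.
  eapply bsum_mono; [|apply Rle_refl|apply (abs_bsum_plus _ _ _ _ (wnorm_abs_bsum _ _ _ Ht (Q O)) H)].
  intros i. simpl. right. f_equal. ring. }
exists (mkl1 v V). intros n. generalize (Q n). apply wnorm_pointwise. intros i. simpl. right; f_equal; ring.
Qed.

(** * Actions on functions *)

Lemma expi_plus a b : expi (a + b) = Cmult (expi a) (expi b).
Proof.
unfold expi, Cmult; simpl. rewrite cos_plus, sin_plus. f_equal; ring.
Qed.

Lemma expi_0 : expi 0 = RtoC 1.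
Proof. unfold expi. rewrite cos_0, sin_0; auto. Qed.

Lemma Cmod_expi a : Cmod (expi a) = 1.
Proof.
unfold Cmod, expi; simpl. assert (K := sin2_cos2 a). unfold Rsqr in K.
replace (cos a * (cos a * 1) + sin a * (sin a * 1)) with 1 by lra. apply sqrt_1.
Qed.

Lemma expi_2PI_nat n : expi (2 * PI * INR n) = RtoC 1.
Proof.
induction n as [|n IH].
- simpl. rewrite Rmult_0_r. apply expi_0.
- rewrite S_INR, Rmult_plus_distr_l, expi_plus, IH, Rmult_1_r.
  unfold expi. rewrite cos_2PI, sin_2PI. unfold RtoC. apply injective_projections; simpl; ring.
Qed.

Lemma expi_opp a : Cmult (expi a) (expi (- a)) = RtoC 1.
Proof. rewrite <- expi_plus, Rplus_opp_r. apply expi_0. Qed.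

Lemma expi_2PI k : expi (2 * PI * IZR k) = RtoC 1.
Proof.
destruct (Z_le_gt_dec 0 k) as [H|H].
- rewrite <- (Z2Nat.id k), <- INR_IZR_INZ by auto. apply expi_2PI_nat.
- assert (K := expi_opp (2 * PI * IZR k)).
  replace (- (2 * PI * IZR k)) with (2 * PI * INR (Z.to_nat (- k))) in K.
  rewrite expi_2PI_nat, Cmult_1_r in K; auto.
  rewrite INR_IZR_INZ, Z2Nat.id by lia. rewrite opp_IZR; ring.
Qed.

(** The operators act on bounded functions and all identities are pointwise; absolute summability of
    the coefficients is then enough for every exchange of sums. *)
Definition bdd (f : R -> C) (M : R) : Prop := 0 <= M /\ forall t, Cmod (f t) <= M.

Section Action.
Variables (e : I2 -> R -> C) (s : I2 -> R).
Hypothesis He : forall i t, Cmod (e i t) = 1.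

(** The generic form of a series of time-frequency shifts: phases [e], translations [s]. It is
    instantiated on the lattice and on its adjoint. *)
Definition act (a : I2 -> C) (f : R -> C) (t : R) : C :=
  usum (fun i => a i * (e i t * f (t - s i)%R))%C.

Lemma act_abs_bsum a f M A t : bdd f M -> abs_bsum a A ->
  abs_bsum (fun i => a i * (e i t * f (t - s i)%R))%C (M * A).
Proof.
intros [P H] HA. apply (bsum_scal M _ _ P) in HA. revert HA. apply bsum_mono; [|lra].
intros i; simpl. rewrite !Cmod_mult, He, Rmult_1_l, Rmult_comm.
apply Rmult_le_compat_r; auto. apply Cmod_ge_0.
Qed.

Lemma act_bdd a f M A : bdd f M -> abs_bsum a A -> bdd (act a f) (M * A).
Proof.
intros H HA. split.
- apply Rmult_le_pos. apply H. eapply bsum_ge0; eauto.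
- intros t. apply usum_Cmod. apply act_abs_bsum; auto.
Qed.

Lemma act_bdd_ex (a : l1) f : (exists M, bdd f M) -> exists M, bdd (act a f) M.
Proof.
intros [M H]. destruct (l1_ok a) as [A HA]. exists (M * A). apply act_bdd; auto.
Qed.

Lemma act_add (a b : l1) f t : (exists M, bdd f M) ->
  act (l1_add a b) f t = (act a f t + act b f t)%C.
Proof.
intros [M H]. destruct (l1_ok a) as [A HA], (l1_ok b) as [B HB].
unfold act. rewrite <- (usum_plus _ _ (M * A) (M * B)); try apply act_abs_bsum; auto.
apply usum_ext; intros i; simpl; ring.
Qed.

Lemma act_scal c (a : l1) f t : (exists M, bdd f M) ->
  act (l1_scal c a) f t = (c * act a f t)%C.
Proof.
intros [M H]. destruct (l1_ok a) as [A HA].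
unfold act. rewrite <- (usum_scal c _ (M * A)); try apply act_abs_bsum; auto.
apply usum_ext; intros i; simpl; ring.
Qed.

Lemma act_sub (a b : l1) f t : (exists M, bdd f M) ->
  act (l1_sub a b) f t = (act a f t - act b f t)%C.
Proof.
intros H. unfold l1_sub, l1_opp. rewrite act_add, act_scal; auto. ring.
Qed.

Lemma act_1 f t : e (0, 0)%Z t = RtoC 1 -> s (0, 0)%Z = 0 -> act l1_1 f t = f t.
Proof.
intros H0 Hs. transitivity (lsum (fun i => l1_1 i * (e i t * f (t - s i)%R))%C ((0,0)%Z :: nil)).
- apply usum_unique, is_usum_support. apply NoDup1. intros i Hi. simpl. unfold delta.
  destruct (eqdec i (0,0)%Z). subst; elim Hi; simpl; auto. ring.
- simpl. rewrite H0, Hs, Rminus_0_r. unfold delta. destruct (eqdec (0,0)%Z (0,0)%Z); [|congruence]. ring.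
Qed.

Variable tw : I2 -> I2 -> C.
Hypothesis Htw : forall i j, Cmod (tw i j) = 1.
Hypothesis Hs : forall i j, s (zadd i j) = s i + s j.
Hypothesis Hcoc : forall i j t, (e i t * e j (t - s i)%R = tw i j * e (zadd i j) t)%C.

(** Composing two shifts yields the shift by the sum up to the phase [tw]. Grouping the double
    series by the total index [nu] gives the twisted convolution. *)
Lemma act_mul (a b : l1) f t : (exists M, bdd f M) ->
  act (gmul tw Htw a b) f t = act a (act b f) t.
Proof.
intros [M HM]. destruct (l1_ok a) as [A HA], (l1_ok b) as [B HB].
set (F := fun q : I2 * I2 => (a (fst q) * (e (fst q) t * (b (snd q) * (e (snd q) (t - s (fst q))%R * f (t - s (fst q) - s (snd q))%R))))%C).
assert (K : abs_bsum F (M * (A * B))).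
{ generalize (bsum_scal M _ _ (proj1 HM) (bsum_prod _ _ _ _ (fun i => Cmod_ge_0 (a i)) (fun i => Cmod_ge_0 (b i)) HA HB)).
  apply bsum_mono; [|lra]. intros [i j]; unfold F; simpl. rewrite !Cmod_mult, !He, !Rmult_1_l.
  assert (X := Cmod_ge_0 (a i)). assert (Y := Cmod_ge_0 (b j)). assert (0 <= Cmod (a i) * Cmod (b j)) by nra.
  assert (W := proj2 HM (t - s i - s j)). nra. }
transitivity (usum F).
- rewrite (usum_inj (fun q : I2 * I2 => (snd q, zsub (fst q) (snd q))) F _ K).
  2: exact zsub_inj.
  2:{ intros [x y] _. exists (zadd x y, x). simpl. rewrite zsub_add; auto. }
  assert (K2 : abs_bsum (fun q : I2 * I2 => F (snd q, zsub (fst q) (snd q))) (M * (A * B))).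
  { apply (abs_bsum_inj (fun q : I2 * I2 => (snd q, zsub (fst q) (snd q)))); auto. exact zsub_inj. }
  rewrite <- (usum_fubini _ _ K2). apply usum_ext. intros nu. simpl. unfold conv.
  destruct (conv_row tw Htw a b nu) as [C0 HC].
  rewrite Cmult_comm, <- (usum_scal _ _ _ HC). apply usum_ext. intros mu. unfold F; simpl.
  replace (t - s mu - s (zsub nu mu)) with (t - s nu)%R
    by (rewrite <- (zadd_sub nu mu) at 1; rewrite Hs; ring).
  assert (E := Hcoc mu (zsub nu mu) t). rewrite zadd_sub in E.
  transitivity (a mu * b (zsub nu mu) * (e mu t * e (zsub nu mu) (t - s mu)%R) * f (t - s nu)%R)%C; [|ring].
  rewrite E. ring.
- rewrite <- (usum_fubini _ _ K). apply usum_ext. intros i. unfold F; simpl.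
  transitivity (a i * e i t * act b f (t - s i)%R)%C; [|ring].
  unfold act. rewrite <- (usum_scal _ _ (M * B)); [|apply act_abs_bsum; auto].
  apply usum_ext. intros j. ring.
Qed.

End Action.

Lemma act_comm e s e' s' (a b : l1) f t :
  (forall i t, Cmod (e i t) = 1) -> (forall i t, Cmod (e' i t) = 1) ->
  (forall i j t, (e i t * e' j (t - s i)%R = e' j t * e i (t - s' j)%R)%C) -> (exists M, bdd f M) ->
  act e s a (act e' s' b f) t = act e' s' b (act e s a f) t.
Proof.
intros He He' Hc [M HM]. destruct (l1_ok a) as [A HA], (l1_ok b) as [B HB].
set (F := fun q : I2 * I2 => (a (fst q) * (e (fst q) t * (b (snd q) * (e' (snd q) (t - s (fst q))%R * f (t - s (fst q) - s' (snd q))%R))))%C).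
assert (K : abs_bsum F (M * (A * B))).
{ generalize (bsum_scal M _ _ (proj1 HM) (bsum_prod _ _ _ _ (fun i => Cmod_ge_0 (a i)) (fun i => Cmod_ge_0 (b i)) HA HB)).
  apply bsum_mono; [|lra]. intros [i j]; unfold F; simpl. rewrite !Cmod_mult, He, He', !Rmult_1_l.
  assert (X := Cmod_ge_0 (a i)). assert (Y := Cmod_ge_0 (b j)). assert (0 <= Cmod (a i) * Cmod (b j)) by nra.
  assert (W := proj2 HM (t - s i - s' j)). nra. }
transitivity (usum F); [|symmetry; rewrite <- (usum_swap _ _ K); apply abs_bsum_swap in K];
  rewrite <- (usum_fubini _ _ K); apply usum_ext; intros i; unfold F; simpl.
- transitivity (a i * e i t * act e' s' b f (t - s i)%R)%C; [ring|].
  unfold act. rewrite <- (usum_scal _ _ (M * B)); [|apply act_abs_bsum; auto].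
  apply usum_ext. intros j. ring.
- transitivity (b i * e' i t * act e s a f (t - s' i)%R)%C; [ring|].
  unfold act. rewrite <- (usum_scal _ _ (M * A)); [|apply act_abs_bsum; auto].
  apply usum_ext. intros j.
  replace (t - s j - s' i) with (t - s' i - s j) by ring.
  transitivity (a j * b i * (e j t * e' i (t - s j)%R) * f (t - s' i - s j)%R)%C; [rewrite Hc; ring|ring].
Qed.

(* [actA] is the action of the lattice [Z x (1/2)Z], [actB] that of its adjoint lattice [2Z x Z]. *)
Definition eA (i : I2) (t : R) : C := expi (PI * IZR (snd i) * t).
Definition sA (i : I2) : R := IZR (fst i).
Definition eB (i : I2) (t : R) : C := expi (2 * PI * IZR (snd i) * t).
Definition sB (i : I2) : R := 2 * IZR (fst i).
(** The phase from moving a translation past a modulation. Its values are 1 and -1: [T_1] and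
    [M_(1/2)] anticommute, so the shifts with both indices even are central. *)
Definition twA (i j : I2) : C := expi (- (PI * IZR (snd j) * IZR (fst i))).

Lemma eA_mod i t : Cmod (eA i t) = 1. Proof. apply Cmod_expi. Qed.
Lemma eB_mod i t : Cmod (eB i t) = 1. Proof. apply Cmod_expi. Qed.
Lemma twA_mod i j : Cmod (twA i j) = 1. Proof. apply Cmod_expi. Qed.

Notation actA := (act eA sA).
Notation actB := (act eB sB).
Definition tmul : l1 -> l1 -> l1 := gmul twA twA_mod.

Lemma actA_tmul (a b : l1) f t : (exists M, bdd f M) ->
  actA (tmul a b) f t = actA a (actA b f) t.
Proof.
intros H. apply (act_mul eA sA eA_mod twA twA_mod); auto.
- intros i j. unfold sA, zadd; simpl. apply plus_IZR.
- intros i j u. unfold eA, sA, twA, zadd. simpl. rewrite <- !expi_plus. f_equal.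
  rewrite plus_IZR. ring.
Qed.

Lemma actB_cmul (a b : l1) f t : (exists M, bdd f M) ->
  actB (cmul a b) f t = actB a (actB b f) t.
Proof.
intros H. apply (act_mul eB sB eB_mod one_tw one_tw_mod); auto.
- intros i j. unfold sB, zadd; simpl. rewrite plus_IZR; ring.
- intros i j u. unfold eB, sB, one_tw, zadd. simpl. rewrite <- !expi_plus, Cmult_1_l.
  rewrite plus_IZR.
  replace (2 * PI * IZR (snd i) * u + 2 * PI * IZR (snd j) * (u - 2 * IZR (fst i))) with
   (2 * PI * (IZR (snd i) + IZR (snd j)) * u + 2 * PI * IZR (- (2 * (snd j * fst i)))).
  rewrite expi_plus, expi_2PI. ring. rewrite opp_IZR, !mult_IZR. ring.
Qed.

(** The two orders of composition differ by phases in [2 PI Z]: this is what makes [2Z x Z] the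
    adjoint lattice of [Z x (1/2)Z]. *)
Lemma actAB_comm (a b : l1) f t : (exists M, bdd f M) ->
  actA a (actB b f) t = actB b (actA a f) t.
Proof.
apply act_comm. apply eA_mod. apply eB_mod.
intros i j u. unfold eA, eB, sA, sB. rewrite <- !expi_plus.
replace (PI * IZR (snd i) * u + 2 * PI * IZR (snd j) * (u - IZR (fst i))) with
  (PI * IZR (snd i) * u + 2 * PI * IZR (snd j) * u + 2 * PI * IZR (- (snd j * fst i)))
  by (rewrite opp_IZR, mult_IZR; ring).
replace (2 * PI * IZR (snd j) * u + PI * IZR (snd i) * (u - 2 * IZR (fst j))) with
  (PI * IZR (snd i) * u + 2 * PI * IZR (snd j) * u + 2 * PI * IZR (- (snd i * fst j)))
  by (rewrite opp_IZR, mult_IZR; ring).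
rewrite (expi_plus _ (2 * PI * IZR (- (snd j * fst i)))), (expi_plus _ (2 * PI * IZR (- (snd i * fst j)))), !expi_2PI. auto.
Qed.

(* The image in the twisted algebra of an element of the central subalgebra generated by [T_2] and [M_1]. *)
Definition iota_co (b : I2 -> C) (i : I2) : C :=
  if Z.even (fst i) then if Z.even (snd i) then b (fst i / 2, snd i / 2)%Z else RtoC 0 else RtoC 0.

Definition zdbl (i : I2) : I2 := (2 * fst i, 2 * snd i)%Z.

Lemma zdbl_inj i j : zdbl i = zdbl j -> i = j.
Proof.
destruct i as [m n], j as [m' n']; unfold zdbl; cbn [fst snd]. intros E.
assert (E1 := f_equal fst E). assert (E2 := f_equal snd E). cbn [fst snd] in E1, E2.
f_equal; lia.
Qed.

Lemma iota_dbl b i : iota_co b (zdbl i) = b i.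
Proof.
unfold iota_co, zdbl. destruct i as [m n]; cbn [fst snd].
rewrite !Z.even_mul. change (Z.even 2) with true. cbn [orb].
rewrite !(Z.mul_comm 2), !Z.div_mul by lia. auto.
Qed.

Lemma iota_supp b i : iota_co b i <> RtoC 0 -> exists j, i = zdbl j.
Proof.
unfold iota_co. destruct i as [m n]; simpl.
destruct (Z.even m) eqn:E; [|congruence]. destruct (Z.even n) eqn:E'; [|congruence].
intros _. apply Z.even_spec in E. apply Z.even_spec in E'. destruct E as [k ->], E' as [l ->].
exists (k, l). reflexivity.
Qed.

(** [zdbl] doubles the size of an index; hence weight [2 * tau] on B matches weight [tau] on A
    everywhere below. *)
Lemma iota_co_wnorm tau b M : wnorm (2 * tau) b M -> wnorm tau (iota_co b) M.
Proof.
intros H. apply (bsum_surj zdbl).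
- intros i. apply Rmult_le_pos. left; apply weight_pos. apply Cmod_ge_0.
- intros i Hi. apply (iota_supp b). intros E. apply Hi. rewrite E, Cmod_0; ring.
- revert H. apply bsum_mono; [|lra]. intros i. rewrite iota_dbl. right. f_equal.
  unfold weight, zdbl. cbn [fst snd]. f_equal.
  assert (T : forall z, Rabs (IZR (2 * z)) = 2 * Rabs (IZR z)).
  { intros z. rewrite mult_IZR, Rabs_mult, (Rabs_pos_eq 2); lra. }
  rewrite !T. ring.
Qed.

Lemma iota_ok (b : l1) : exists M, abs_bsum (iota_co b) M.
Proof.
destruct (l1_ok b) as [M H]. exists M. apply (wnorm_abs_bsum 0); [lra|]. apply iota_co_wnorm.
rewrite Rmult_0_r. apply abs_bsum_wnorm; auto.
Qed.
Definition iota (b : l1) : l1 := mkl1 _ (iota_ok b).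

Lemma iota_wnorm tau (b : l1) M : wnorm (2 * tau) b M -> wnorm tau (iota b) M.
Proof. apply iota_co_wnorm. Qed.

Lemma actA_iota (b : l1) f t : (exists M, bdd f M) -> actA (iota b) f t = actB b f t.
Proof.
intros [M H]. destruct (l1_ok (iota b)) as [A HA]. unfold act.
rewrite (usum_inj zdbl _ (M * A)).
- apply usum_ext. intros i. simpl co. rewrite iota_dbl. unfold eA, eB, sA, sB, zdbl.
  cbn [fst snd]. rewrite !mult_IZR. f_equal. f_equal. f_equal; ring.
- apply act_abs_bsum; auto. apply eA_mod.
- apply zdbl_inj.
- intros i Hi. apply (iota_supp b). intros E. apply Hi. simpl co. rewrite E. ring.
Qed.

Lemma modulate_ok (th : I2 -> R) (a : l1) : exists M, abs_bsum (fun i => a i * expi (th i))%C M.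
Proof.
destruct (l1_ok a) as [M H]. exists M. revert H. apply bsum_mono; [|lra].
intros i. rewrite Cmod_mult, Cmod_expi; lra.
Qed.
(** With [th] a character exponent such as [chA] or [chB], this is conjugation by a time-frequency
    shift seen on coefficients. On the torus it is a rotation, and it preserves every [wnorm]. *)
Definition modulate (th : I2 -> R) (a : l1) : l1 := mkl1 _ (modulate_ok th a).

Lemma modulate_wnorm th tau (a : l1) M : wnorm tau a M -> wnorm tau (modulate th a) M.
Proof. apply wnorm_pointwise. intros i. simpl. rewrite Cmod_mult, Cmod_expi; lra. Qed.

(** The phase produced when [tf_shift (x, w)] is moved past the lattice shift with index [i]; [chB]
    is the same phase at the doubled index. *)
Definition chA (x w : R) (i : I2) : R := 2 * PI * IZR (fst i) * w - PI * IZR (snd i) * x.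
Definition chB (x w : R) (i : I2) : R := 4 * PI * IZR (fst i) * w - 2 * PI * IZR (snd i) * x.

Lemma iota_modulate x w (b : l1) : iota (modulate (chB x w) b) = modulate (chA x w) (iota b).
Proof.
apply l1_eq. intros i. simpl. unfold iota_co.
destruct (Z.even (fst i)) eqn:E; [|ring]. destruct (Z.even (snd i)) eqn:E'; [|ring].
apply Z.even_spec in E. apply Z.even_spec in E'. destruct i as [m n]; cbn [fst snd] in *.
destruct E as [k ->], E' as [l ->].
rewrite !(Z.mul_comm 2), !Z.div_mul by lia. f_equal. f_equal. unfold chA, chB; cbn [fst snd].
rewrite !mult_IZR. ring.
Qed.

Lemma shift_bdd z f M : bdd f M -> bdd (tf_shift z f) M.
Proof.
intros [P H]. split; auto. intros t. unfold tf_shift. rewrite Cmod_mult, Cmod_expi, Rmult_1_l. auto.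
Qed.

Lemma shift_actA x w (a : l1) f t : (exists M, bdd f M) ->
  tf_shift (x, w) (actA a f) t = actA (modulate (chA x w) a) (tf_shift (x, w) f) t.
Proof.
intros [M H]. destruct (l1_ok a) as [A HA]. unfold tf_shift at 1. unfold act.
rewrite <- (usum_scal _ _ (M * A)); [|apply act_abs_bsum; auto; apply eA_mod].
apply usum_ext. intros i. simpl. unfold tf_shift; simpl. unfold eA, sA.
replace (t - x - IZR (fst i)) with (t - IZR (fst i) - x) by ring.
transitivity (a i * f (t - IZR (fst i) - x)%R * (expi (2 * PI * t * w) * expi (PI * IZR (snd i) * (t - x))))%C; [ring|].
transitivity (a i * f (t - IZR (fst i) - x)%R * ((expi (chA x w i) * expi (PI * IZR (snd i) * t)) * expi (2 * PI * (t - IZR (fst i)) * w)))%C; [|ring].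
f_equal. rewrite <- !expi_plus. f_equal. unfold chA. ring.
Qed.

Lemma shift_actB x w (b : l1) f t : (exists M, bdd f M) ->
  tf_shift (x, w) (actB b f) t = actB (modulate (chB x w) b) (tf_shift (x, w) f) t.
Proof.
intros H. rewrite <- actA_iota, iota_modulate, <- shift_actA; auto.
- unfold tf_shift. rewrite actA_iota; auto.
- destruct H as [M H]; exists M; apply shift_bdd; auto.
Qed.

(** * Poisson summation for Gaussians *)

Fixpoint symm_range (n : nat) : list Z :=
  match n with
  | O => (0 :: nil)%Z
  | S n => (Z.of_nat (S n) :: - Z.of_nat (S n) :: symm_range n)%Z
  end.

Lemma symm_range_in n k : (Z.abs k <= Z.of_nat n)%Z -> In k (symm_range n).
Proof.
induction n as [|n IH]; intros H; cbn [symm_range In].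
- left; lia.
- destruct (Z.eq_dec k (Z.of_nat (S n))); [left; lia|].
  destruct (Z.eq_dec k (- Z.of_nat (S n))); [right; left; lia|].
  right; right; apply IH; lia.
Qed.

Lemma bsum_geom rho : 0 <= rho < 1 -> bsum (fun k : Z => rho ^ Z.abs_nat k) ((1 + rho) / (1 - rho)).
Proof.
intros H l Nl.
assert (K : exists n, incl l (symm_range n)).
{ clear Nl. induction l as [|k l [n IH]].
  - exists O. intros x [].
  - exists (n + Z.abs_nat k)%nat. intros x [<-|Hx]; [apply symm_range_in; lia|].
    assert (M : incl (symm_range n) (symm_range (n + Z.abs_nat k))).
    { generalize (Z.abs_nat k) as j. intros j. induction j as [|j IHj].
      rewrite Nat.add_0_r. apply incl_refl.
      rewrite Nat.add_succ_r. cbn [symm_range]. intros y Hy; right; right; auto. }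
    auto. }
destruct K as (n & Hn).
eapply Rle_trans; [apply (rsum_incl _ l (symm_range n)); auto; intros; apply pow_le; lra|].
assert (E : rsum (fun k : Z => rho ^ Z.abs_nat k) (symm_range n) = (1 + rho - 2 * rho ^ (S n)) / (1 - rho)).
{ clear - H. induction n as [|n IH].
  - simpl. field; lra.
  - cbn [symm_range rsum fold_right]. fold (rsum (fun k : Z => rho ^ Z.abs_nat k) (symm_range n)). rewrite IH.
    replace (Z.abs_nat (Z.of_nat (S n))) with (S n) by lia.
    replace (Z.abs_nat (- Z.of_nat (S n))) with (S n) by lia.
    simpl. field; lra. }
rewrite E. apply Rmult_le_compat_r. left; apply Rinv_0_lt_compat; lra.
assert (0 <= rho ^ S n) by (apply pow_le; lra). lra.
Qed.

Lemma exp_le x y : x <= y -> exp x <= exp y.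
Proof. intros [H|H]; [left; apply exp_increasing; auto|subst; lra]. Qed.

Lemma exp_pow x n : exp x ^ n = exp (INR n * x).
Proof.
induction n as [|n IH]. simpl; rewrite Rmult_0_l, exp_0; auto.
cbn [pow]. rewrite IH, <- exp_plus, S_INR. f_equal; ring.
Qed.

Lemma INR_abs_nat k : INR (Z.abs_nat k) = Rabs (IZR k).
Proof. rewrite INR_IZR_INZ, Zabs2Nat.id_abs, abs_IZR. auto. Qed.

Lemma exp_neg_lt_1 c : 0 < c -> 0 < exp (- c) < 1.
Proof.
intros H; split; [apply exp_pos|]. assert (K : exp (- c) < exp 0) by (apply exp_increasing; lra).
rewrite exp_0 in K; auto.
Qed.

Lemma bsum_exp_abs c : 0 < c -> bsum (fun k : Z => exp (- c * Rabs (IZR k))) ((1 + exp (- c)) / (1 - exp (- c))).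
Proof.
intros H. assert (P : 0 <= exp (- c) < 1).
{ split. left; apply exp_pos. rewrite <- exp_0. apply exp_increasing; lra. }
generalize (bsum_geom _ P). apply bsum_mono; [|lra]. intros k. rewrite exp_pow, INR_abs_nat. right; f_equal; ring.
Qed.

(** The bound is uniform in [s]: replacing [s] by its integer part costs a factor [exp 1], after
    which an integer translation reindexes the sum. *)
Lemma exp_sum : exists M, 0 < M /\ forall s, bsum (fun k : Z => exp (- Rabs (s - IZR k))) M.
Proof.
exists (exp 1 * ((1 + exp (- (1))) / (1 - exp (- (1))))).
assert (B := bsum_exp_abs 1 Rlt_0_1). split.
- destruct (exp_neg_lt_1 1 Rlt_0_1). apply Rmult_lt_0_compat; [apply exp_pos|]. apply Rdiv_lt_0_compat.
  apply Rplus_lt_0_compat; [lra|auto]. apply Rlt_0_minus; auto.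
- intros s. set (j := Int_part s).
  assert (Hj := base_Int_part s). fold j in Hj.
  apply (bsum_scal (exp 1)) in B; [|left; apply exp_pos].
  apply (bsum_inj (fun k : Z => (k - j)%Z)) in B; [|intros; lia].
  revert B. apply bsum_mono; [|lra]. intros k. rewrite <- exp_plus. apply exp_le.
  rewrite minus_IZR. assert (T : Rabs (IZR k - IZR j) <= Rabs (s - IZR k) + 1); [|lra].
  replace (IZR k - IZR j) with (- (s - IZR k) + (s - IZR j)) by ring.
  eapply Rle_trans; [apply Rabs_triang|]. rewrite Rabs_Ropp, (Rabs_pos_eq (s - IZR j)); lra.
Qed.

(** From [1 + |x| <= exp |x|] it remains to bound [(p + 1)|x| - c x^2], and completing the square
    gives the constant. *)
Lemma gauss_dom c p : 0 < c -> exists M, 0 < M /\ forall x, (1 + Rabs x) ^ p * exp (- c * x ^ 2) <= M * exp (- Rabs x).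
Proof.
intros H. exists (exp ((INR p + 1) ^ 2 / (4 * c))). split; [apply exp_pos|]. intros x.
apply Rle_trans with (exp (INR p * Rabs x) * exp (- c * x ^ 2)).
- apply Rmult_le_compat_r. left; apply exp_pos. rewrite <- exp_pow. apply pow_incr.
  assert (0 <= Rabs x) by apply Rabs_pos. split; [lra|]. apply exp_ineq1_le.
- rewrite <- !exp_plus. apply exp_le.
  replace (x ^ 2) with (Rabs x ^ 2) by (rewrite pow2_abs; auto).
  set (y := Rabs x). set (q := INR p + 1).
  assert (0 <= (q - 2 * c * y) ^ 2 / (4 * c)).
  { apply Rmult_le_pos. apply pow2_ge_0. left; apply Rinv_0_lt_compat; lra. }
  replace (q ^ 2 / (4 * c) + - y) with ((q - 2 * c * y) ^ 2 / (4 * c) + (INR p * y + - c * y ^ 2)).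
  lra. unfold q. field; lra.
Qed.

(** * Termwise differentiation of series through quadratic remainders *)

(** Differentiability at [t] with an explicit remainder. The constants [M] add up over a series, so
    termwise differentiation reduces to their summability. *)
Definition taylor1 (f : R -> C) (t : R) (d : C) (M : R) : Prop :=
  forall h, Rabs h <= 1 -> Cmod (f (t + h)%R - f t - RtoC h * d)%C <= M * h ^ 2.

Lemma usum_taylor1 {I} (u : I -> R -> C) t (d : I -> C) m M :
  (forall i, taylor1 (u i) t (d i) (m i)) -> bsum m M -> (forall x, exists A, abs_bsum (fun i => u i x) A) ->
  (exists A, abs_bsum d A) -> taylor1 (fun x => usum (fun i => u i x)) t (usum d) M.
Proof.
intros Hq Hm Hu [A HA] h Hh.
destruct (Hu (t + h)) as [A1 H1], (Hu t) as [A2 H2].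
assert (E : (usum (fun i => u i (t + h)%R) - usum (fun i => u i t) - RtoC h * usum d)%C =
  usum (fun i => u i (t + h)%R + ((- (1)) * u i t + (- RtoC h) * d i))%C).
{ rewrite (usum_plus _ _ _ _ H1 (abs_bsum_plus _ _ _ _ (abs_bsum_scal _ _ _ H2) (abs_bsum_scal _ _ _ HA))).
  rewrite (usum_plus _ _ _ _ (abs_bsum_scal _ _ _ H2) (abs_bsum_scal _ _ _ HA)).
  rewrite (usum_scal _ _ _ H2), (usum_scal _ _ _ HA). ring. }
rewrite E. apply usum_Cmod. rewrite Rmult_comm.
generalize (bsum_scal (h ^ 2) _ _ (pow2_ge_0 h) Hm). apply bsum_mono; [|lra]. intros i. rewrite Rmult_comm.
eapply Rle_trans; [|apply (Hq i h Hh)]. right; f_equal. ring.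
Qed.

Lemma DeriveE (u u1 : R -> R) : (forall x, is_derive u x (u1 x)) ->
  forall x : R, Derive (fun x : R => u x) x = u1 x.
Proof. intros H x. apply is_derive_unique, H. Qed.

(** The mean value theorem is applied twice: to [u] minus its linear part, then to [u1]. This gives
    the constant [B], without the factor 1/2. *)
Lemma real_taylor1 (u u1 u2 : R -> R) t B h : (forall x, is_derive u x (u1 x)) -> (forall x, is_derive u1 x (u2 x)) ->
  (forall x, Rabs (x - t) <= 1 -> Rabs (u2 x) <= B) -> Rabs h <= 1 ->
  Rabs (u (t + h) - u t - h * u1 t) <= B * h ^ 2.
Proof.
intros H1 H2 HB Hh.
destruct (MVT_gen (fun x => u x - x * u1 t) t (t + h) (fun x => u1 x - u1 t)) as (c & Hc & E).
- intros x _. auto_derive. exists (u1 x); auto. rewrite (DeriveE u u1 H1). ring.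
- intros x _. apply continuity_pt_filterlim. apply (ex_derive_continuous (fun x => u x - x * u1 t)).
  auto_derive. exists (u1 x); auto.
- replace (u (t + h) - u t - h * u1 t) with (u (t + h) - (t + h) * u1 t - (u t - t * u1 t)) by ring.
  rewrite E.
  destruct (MVT_gen u1 t c u2) as (c' & Hc' & E').
  + intros x _; auto.
  + intros x _. apply continuity_pt_filterlim. apply (ex_derive_continuous u1). exists (u2 x); auto.
  + rewrite E'. rewrite !Rabs_mult. replace (t + h - t) with h by ring.
    assert (Hch : Rabs (c - t) <= Rabs h).
    { unfold Rmin, Rmax in Hc. destruct (Rle_dec t (t + h)); unfold Rabs; destruct Rcase_abs, Rcase_abs; lra. }
    assert (Hc'h : Rabs (c' - t) <= 1).
    { apply Rle_trans with (Rabs (c - t)); [|lra].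
      unfold Rmin, Rmax in Hc'. destruct (Rle_dec t c); unfold Rabs; destruct Rcase_abs, Rcase_abs; lra. }
    specialize (HB c' Hc'h). rewrite <- (pow2_abs h).
    assert (P1 := Rabs_pos (u2 c')). assert (P2 := Rabs_pos (c - t)). assert (P3 := Rabs_pos h).
    apply Rle_trans with (B * Rabs h * Rabs h); [|right; ring].
    apply Rmult_le_compat_r; auto. apply Rmult_le_compat; auto.
Qed.

Lemma Cmod_le_2 z M : Rabs (Re z) <= M -> Rabs (Im z) <= M -> Cmod z <= 2 * M.
Proof.
intros H1 H2. destruct z as [x y]. simpl in *.
replace ((x, y) : C) with (RtoC x + Ci * RtoC y)%C by (apply injective_projections; simpl; ring).
eapply Rle_trans; [apply Cmod_triangle|]. rewrite Cmod_mult, !Cmod_R.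
replace (Cmod Ci) with 1. lra. unfold Cmod, Ci; simpl. replace (0 * (0 * 1) + 1 * (1 * 1)) with 1 by ring. rewrite sqrt_1; auto.
Qed.

Lemma Re_le_Cmod z : Rabs (Re z) <= Cmod z.
Proof. eapply Rle_trans; [apply Rmax_l|apply Rmax_Cmod]. Qed.
Lemma Im_le_Cmod z : Rabs (Im z) <= Cmod z.
Proof. eapply Rle_trans; [apply Rmax_r|apply Rmax_Cmod]. Qed.

Lemma Rabs_cos x : Rabs (cos x) <= 1.
Proof. assert (K := COS_bound x). apply Rabs_le; lra. Qed.
Lemma Rabs_sin x : Rabs (sin x) <= 1.
Proof. assert (K := SIN_bound x). apply Rabs_le; lra. Qed.

Lemma trig_bound b g0 g1 g2 c s B : Rabs c <= 1 -> Rabs s <= 1 -> Rabs g0 <= B -> Rabs g1 <= B -> Rabs g2 <= B ->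
  Rabs (g2 * c + 2 * (b * (g1 * s)) + b ^ 2 * (g0 * c)) <= B * (1 + Rabs b) ^ 2.
Proof.
intros Hc Hs H0 H1 H2.
assert (P := Rabs_pos b). assert (PB : 0 <= B) by (assert (Q := Rabs_pos g0); lra).
assert (K : forall g x, Rabs g <= B -> Rabs x <= 1 -> Rabs (g * x) <= B).
{ intros g x Hg Hx. rewrite Rabs_mult. assert (Q := Rabs_pos g). assert (Q' := Rabs_pos x). nra. }
eapply Rle_trans; [apply Rabs_triang|]. eapply Rle_trans; [apply Rplus_le_compat_r, Rabs_triang|].
rewrite (Rabs_mult 2), (Rabs_mult b), (Rabs_mult (b ^ 2)), (Rabs_pos_eq 2), <- RPow_abs by lra.
assert (K1 := K _ _ H2 Hc). assert (K2 := K _ _ H1 Hs). assert (K3 := K _ _ H0 Hc).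
assert (Rabs b * Rabs (g1 * s) <= Rabs b * B) by (apply Rmult_le_compat_l; auto).
assert (Rabs b ^ 2 * Rabs (g0 * c) <= Rabs b ^ 2 * B) by (apply Rmult_le_compat_l; auto; apply pow2_ge_0).
nra.
Qed.

(** The second derivative of [G] times a sine or cosine of frequency [b] is at most [B (1 + |b|)^2];
    the factor 2 adds the real and the imaginary part. *)
Lemma term_taylor1 (G G1 G2 : R -> R) (b g t B : R) :
  (forall x, is_derive G x (G1 x)) -> (forall x, is_derive G1 x (G2 x)) ->
  (forall x, Rabs (x - t) <= 1 -> Rabs (G x) <= B /\ Rabs (G1 x) <= B /\ Rabs (G2 x) <= B) ->
  taylor1 (fun x => RtoC (G x) * expi (b * x + g))%C t
     ((RtoC (G1 t) + Ci * RtoC (b * G t)) * expi (b * t + g))%C (2 * (B * (1 + Rabs b) ^ 2)).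
Proof.
intros H1 H2 HB h Hh. rewrite Rmult_assoc. apply Cmod_le_2.
- assert (E : forall z, Re z = fst z) by reflexivity.
  replace (Re _) with ((fun x => G x * cos (b * x + g)) (t + h) - (fun x => G x * cos (b * x + g)) t
     - h * (fun x => G1 x * cos (b * x + g) - b * (G x * sin (b * x + g))) t).
  2:{ unfold expi, RtoC, Ci, Cminus, Cplus, Copp, Cmult, Re; simpl. ring. }
  apply (real_taylor1 (fun x => G x * cos (b * x + g)) (fun x => G1 x * cos (b * x + g) - b * (G x * sin (b * x + g))) (fun x => G2 x * cos (b * x + g) + 2 * (b * (G1 x * (- sin (b * x + g)))) + b ^ 2 * (G x * - cos (b * x + g)))); auto.
  + intros x. auto_derive. exists (G1 x); auto. rewrite (DeriveE G G1 H1). ring.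
  + intros x. auto_derive. split; [exists (G2 x); auto|split; [exists (G1 x); auto|auto]].
    rewrite (DeriveE G G1 H1), (DeriveE G1 G2 H2). ring.
  + intros x Hx. destruct (HB x Hx) as (B0 & B1 & B2).
    replace (b ^ 2 * (G x * - cos (b * x + g))) with (b ^ 2 * ((- G x) * cos (b * x + g))) by ring.
    apply trig_bound; auto. apply Rabs_cos. rewrite Rabs_Ropp; apply Rabs_sin. rewrite Rabs_Ropp; auto.
- replace (Im _) with ((fun x => G x * sin (b * x + g)) (t + h) - (fun x => G x * sin (b * x + g)) t
     - h * (fun x => G1 x * sin (b * x + g) + b * (G x * cos (b * x + g))) t).
  2:{ unfold expi, RtoC, Ci, Cminus, Cplus, Copp, Cmult, Im; simpl. ring. }
  apply (real_taylor1 (fun x => G x * sin (b * x + g)) (fun x => G1 x * sin (b * x + g) + b * (G x * cos (b * x + g))) (fun x => G2 x * sin (b * x + g) + 2 * (b * (G1 x * (cos (b * x + g)))) + b ^ 2 * (G x * - sin (b * x + g)))); auto.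
  + intros x. auto_derive. exists (G1 x); auto. rewrite (DeriveE G G1 H1). ring.
  + intros x. auto_derive. split; [exists (G2 x); auto|split; [exists (G1 x); auto|auto]].
    rewrite (DeriveE G G1 H1), (DeriveE G1 G2 H2). ring.
  + intros x Hx. destruct (HB x Hx) as (B0 & B1 & B2).
    replace (b ^ 2 * (G x * - sin (b * x + g))) with (b ^ 2 * ((- G x) * sin (b * x + g))) by ring.
    apply trig_bound; auto. apply Rabs_sin. apply Rabs_cos. rewrite Rabs_Ropp; auto.
Qed.

Lemma real_taylor1_derive (u : R -> R) t d M : 
  (forall h, Rabs h <= 1 -> Rabs (u (t + h) - u t - h * d) <= M * h ^ 2) -> is_derive u t d.
Proof.
intros H. apply is_derive_Reals. intros eps He.
assert (P : 0 < Rmin 1 (eps / (Rabs M + 1))).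
{ apply Rmin_pos; [lra|]. apply Rdiv_lt_0_compat; auto. assert (Q := Rabs_pos M); lra. }
exists (mkposreal _ P). intros h Hh Hd. simpl in Hd.
assert (Q := Rabs_pos M).
assert (H1 : Rabs h <= 1) by (eapply Rle_trans; [left; exact Hd|apply Rmin_l]).
assert (H2 : Rabs h < eps / (Rabs M + 1)) by (eapply Rlt_le_trans; [exact Hd|apply Rmin_r]).
specialize (H h H1).
replace ((u (t + h) - u t) / h - d) with ((u (t + h) - u t - h * d) / h) by (field; auto).
unfold Rdiv. rewrite Rabs_mult, Rabs_inv.
assert (Ph : 0 < Rabs h) by (apply Rabs_pos_lt; auto).
apply Rlt_div_l; auto.
eapply Rle_lt_trans; [exact H|]. rewrite <- (pow2_abs h).
apply Rlt_div_r in H2; [|lra]. assert (M <= Rabs M) by apply Rle_abs. simpl. 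
assert (0 < Rabs h * Rabs h) by nra. nra.
Qed.

Lemma taylor1_Re f t d M : taylor1 f t d M -> is_derive (fun x => Re (f x)) t (Re d).
Proof.
intros H. apply (real_taylor1_derive _ _ _ M). intros h Hh.
eapply Rle_trans; [|apply (H h Hh)]. eapply Rle_trans; [|apply Re_le_Cmod]. right; f_equal.
unfold Re, Cminus, Cplus, Copp, Cmult, RtoC; simpl. ring.
Qed.

Lemma taylor1_Im f t d M : taylor1 f t d M -> is_derive (fun x => Im (f x)) t (Im d).
Proof.
intros H. apply (real_taylor1_derive _ _ _ M). intros h Hh.
eapply Rle_trans; [|apply (H h Hh)]. eapply Rle_trans; [|apply Im_le_Cmod]. right; f_equal.
unfold Im, Cminus, Cplus, Copp, Cmult, RtoC; simpl. ring.
Qed.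

(** * Integration of complex functions over one period *)

Definition contC (f : R -> C) : Prop :=
  forall t, continuous (fun x : R => Re (f x)) t /\ continuous (fun x : R => Im (f x)) t.

Definition CI (f : R -> C) : C := (RInt (fun x => Re (f x)) 0 1, RInt (fun x => Im (f x)) 0 1).

Lemma contC_taylor1 f : (forall t, exists d M, taylor1 f t d M) -> contC f.
Proof.
intros H t. destruct (H t) as (d & M & Hq). split.
- apply (ex_derive_continuous (fun x : R => Re (f x))). exists (Re d). eapply taylor1_Re; eauto.
- apply (ex_derive_continuous (fun x : R => Im (f x))). exists (Im d). eapply taylor1_Im; eauto.
Qed.

Lemma contC_plus f g : contC f -> contC g -> contC (fun x => f x + g x)%C.
Proof.
intros H H' t. destruct (H t) as [A B], (H' t) as [A' B']. split.
- apply (continuous_plus (V := R_NormedModule) (fun x : R => Re (f x)) (fun x : R => Re (g x))); auto.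
- apply (continuous_plus (V := R_NormedModule) (fun x : R => Im (f x)) (fun x : R => Im (g x))); auto.
Qed.

Lemma contC_mult f g : contC f -> contC g -> contC (fun x => f x * g x)%C.
Proof.
intros H H' t. destruct (H t) as [A B], (H' t) as [A' B']. split.
- apply (continuous_minus (V := R_NormedModule) (fun x : R => Re (f x) * Re (g x)) (fun x : R => Im (f x) * Im (g x)));
  apply (continuous_mult (K := R_AbsRing)); auto.
- apply (continuous_plus (V := R_NormedModule) (fun x : R => Re (f x) * Im (g x)) (fun x : R => Im (f x) * Re (g x)));
  apply (continuous_mult (K := R_AbsRing)); auto.
Qed.

Lemma contC_const c : contC (fun _ => c).
Proof. intros t. split; apply continuous_const. Qed.

Lemma contC_expi b : contC (fun x => expi (b * x)).
Proof.
intros t. split; simpl.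
- apply (ex_derive_continuous (fun x : R => cos (b * x))). auto_derive; auto.
- apply (ex_derive_continuous (fun x : R => sin (b * x))). auto_derive; auto.
Qed.

Ltac contC_tac := repeat match goal with
  | |- contC (fun x => Cplus (@?f x) (@?g x)) => apply (contC_plus f g)
  | |- contC (fun x => Cmult (@?f x) (@?g x)) => apply (contC_mult f g)
  | |- contC (fun _ => ?c) => exact (contC_const c)
  | |- contC _ => assumption
  end.

Lemma contC_ext f g : (forall x, f x = g x) -> contC f -> contC g.
Proof.
intros E. assert (K : f = g) by (extensionality x; auto). subst; auto.
Qed.

Lemma ex_RInt_cont (u : R -> R) a b : (forall t, continuous u t) -> ex_RInt u a b.
Proof. intros H. apply (ex_RInt_continuous (V := R_CompleteNormedModule)). auto. Qed.

Lemma CI_ext f g : (forall x, f x = g x) -> CI f = CI g.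
Proof. intros E. assert (K : f = g) by (extensionality x; auto). subst; auto. Qed.

Lemma CI_plus f g : contC f -> contC g -> CI (fun x => f x + g x)%C = (CI f + CI g)%C.
Proof.
intros H H'. unfold CI. apply injective_projections; simpl.
- apply (RInt_plus (V := R_CompleteNormedModule)); apply ex_RInt_cont; intros t; [apply H|apply H'].
- apply (RInt_plus (V := R_CompleteNormedModule)); apply ex_RInt_cont; intros t; [apply H|apply H'].
Qed.

Lemma CI_scal c f : contC f -> CI (fun x => c * f x)%C = (c * CI f)%C.
Proof.
intros H. unfold CI.
assert (E1 : ex_RInt (fun x : R => Re (f x)) 0 1) by (apply ex_RInt_cont; intros; apply H).
assert (E2 : ex_RInt (fun x : R => Im (f x)) 0 1) by (apply ex_RInt_cont; intros; apply H).
assert (S : forall k u, ex_RInt u 0 1 -> RInt (fun x => k * u x) 0 1 = k * RInt u 0 1).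
{ intros k u Hu. apply (RInt_scal (V := R_CompleteNormedModule) u 0 1 k); auto. }
assert (X : forall k u, ex_RInt u 0 1 -> ex_RInt (fun x => k * u x) 0 1).
{ intros k u Hu. apply (ex_RInt_scal (V := R_CompleteNormedModule) u 0 1 k); auto. }
apply injective_projections; simpl.
- transitivity (RInt (fun x => minus (fst c * Re (f x)) (snd c * Im (f x))) 0 1); [reflexivity|].
  rewrite (RInt_minus (V := R_CompleteNormedModule)); auto. rewrite !S; auto.
- transitivity (RInt (fun x => plus (fst c * Im (f x)) (snd c * Re (f x))) 0 1); [reflexivity|].
  rewrite (RInt_plus (V := R_CompleteNormedModule)); auto. rewrite !S; auto.
Qed.

Lemma RInt_abs_le (u : R -> R) M : (forall t, continuous u t) -> (forall t, Rabs (u t) <= M) -> Rabs (RInt u 0 1) <= M.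
Proof.
intros Hc H.
assert (K := abs_RInt_le_const u 0 1 M ltac:(lra) (ex_RInt_cont u 0 1 Hc) (fun t _ => H t)).
rewrite Rminus_0_r, Rmult_1_l in K. exact K.
Qed.

Lemma CI_bound f M : contC f -> (forall t, Cmod (f t) <= M) -> Cmod (CI f) <= 2 * M.
Proof.
intros Hc H. apply Cmod_le_2; apply RInt_abs_le; try (intros t; apply Hc); intros t.
- eapply Rle_trans; [apply Re_le_Cmod|]; auto.
- eapply Rle_trans; [apply Im_le_Cmod|]; auto.
Qed.

Lemma CI_FTC f df : (forall t, exists M, taylor1 f t (df t) M) -> contC df -> CI df = (f 1 - f 0)%C.
Proof.
intros H Hc. unfold CI. apply injective_projections; cbn [fst snd Cminus Cplus Copp].
- apply is_RInt_unique. apply (is_RInt_derive (fun x : R => Re (f x)) (fun x : R => Re (df x))).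
  + intros x _. destruct (H x) as (M & HM). eapply taylor1_Re; eauto.
  + intros x _. apply Hc.
- apply is_RInt_unique. apply (is_RInt_derive (fun x : R => Im (f x)) (fun x : R => Im (df x))).
  + intros x _. destruct (H x) as (M & HM). eapply taylor1_Im; eauto.
  + intros x _. apply Hc.
Qed.

Lemma CI_expi n : CI (fun s => expi (2 * PI * IZR n * s)) = if Z.eq_dec n 0 then RtoC 1 else RtoC 0.
Proof.
destruct (Z.eq_dec n 0) as [->|N].
- rewrite (CI_ext _ (fun _ => RtoC 1)).
  + unfold CI. simpl. rewrite !RInt_const. unfold scal; simpl; unfold mult; simpl.
    apply injective_projections; simpl; ring.
  + intros s. replace (2 * PI * 0 * s) with 0 by ring. apply expi_0.
- set (b := 2 * PI * IZR n).
  assert (Pb : b <> 0). { unfold b. apply Rmult_integral_contrapositive_currified.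
    assert (P := PI_RGT_0); lra. apply not_0_IZR; auto. }
  assert (E : CI (fun s => Ci * RtoC b * expi (b * s))%C = (expi (b * 1) - expi (b * 0))%C).
  { apply (CI_FTC (fun s => expi (b * s))).
    - intros t. exists (2 * (1 * (1 + Rabs b) ^ 2)).
      assert (B1 : Rabs 1 <= 1) by (rewrite Rabs_R1; lra).
      assert (B0 : Rabs 0 <= 1) by (rewrite Rabs_R0; lra).
      generalize (term_taylor1 (fun _ => 1) (fun _ => 0) (fun _ => 0) b 0 t 1
         (fun x => is_derive_const (1 : R_NormedModule) x) (fun x => is_derive_const (0 : R_NormedModule) x)
         (fun x _ => conj B1 (conj B0 B0))).
      unfold taylor1. intros K h Hh. eapply Rle_trans; [|apply (K h Hh)]. right; f_equal.
      rewrite !Rplus_0_r, Rmult_1_r. ring.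
    - apply contC_mult. apply contC_const. apply contC_expi. }
  rewrite CI_scal in E by apply contC_expi.
  replace (expi (b * 1) - expi (b * 0))%C with (RtoC 0) in E.
  2:{ rewrite Rmult_0_r, Rmult_1_r, expi_0. unfold b. rewrite expi_2PI. ring. }
  assert (Z : (Ci * RtoC b)%C <> RtoC 0).
  { intros Z. apply (f_equal Cmod) in Z.
    rewrite Cmod_mult, Cmod_0, Cmod_R in Z. replace (Cmod Ci) with 1 in Z.
    assert (0 < Rabs b) by (apply Rabs_pos_lt; auto). lra.
    unfold Cmod, Ci; simpl. replace (0 * (0 * 1) + 1 * (1 * 1)) with 1 by ring. rewrite sqrt_1; auto. }
  transitivity (/ (Ci * RtoC b) * (Ci * RtoC b * CI (fun s => expi (b * s))))%C.
  + field. split; intros K; apply Z; rewrite K; ring.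
  + rewrite E. ring.
Qed.

(* A kernel [K >= 1 + eta] near [t0] and [|K| <= 1] away from [t0]: its powers
   concentrate at [t0] although they are trigonometric polynomials. *)
Lemma kernel_contra (d : R -> R) t0 M : 0 < t0 < 1 -> (forall t, continuous d t) -> (forall t, Rabs (d t) <= M) ->
  0 < d t0 ->
  (forall q N, RInt (fun s => d s * (cos (2 * PI * (s - t0)) + q) ^ N) 0 1 = 0) -> False.
Proof.
intros Ht Hc HM H0 HI.
destruct (proj1 (filterlim_locally d (d t0)) (Hc t0) (mkposreal _ (Rlt_mult_inv_pos _ 2 H0 Rlt_0_2))) as (e & He).
simpl in He.
(* Three demands: the window stays inside [(0, 1)], [d] stays above [d t0 / 2] on it, and
   [dl <= 1/4] keeps the cosine at its edge nonnegative. *)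
set (dl := Rmin (Rmin (e / 2) (1 / 4)) (Rmin (t0 / 2) ((1 - t0) / 2))).
assert (Hdl : 0 < dl /\ dl < e /\ dl <= 1 / 4 /\ dl < t0 /\ dl < 1 - t0).
{ assert (0 < e) by apply cond_pos. unfold dl.
  assert (A := Rmin_l (Rmin (e / 2) (1 / 4)) (Rmin (t0 / 2) ((1 - t0) / 2))).
  assert (B := Rmin_r (Rmin (e / 2) (1 / 4)) (Rmin (t0 / 2) ((1 - t0) / 2))).
  assert (C := Rmin_l (e / 2) (1 / 4)). assert (D := Rmin_r (e / 2) (1 / 4)).
  assert (E := Rmin_l (t0 / 2) ((1 - t0) / 2)). assert (F := Rmin_r (t0 / 2) ((1 - t0) / 2)).
  split; [|lra]. repeat apply Rmin_pos; lra. }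
assert (P := PI_RGT_0).
(* This choice makes the kernel equal to 1 exactly at distance [dl] from [t0]. *)
set (q := 1 - cos (2 * PI * dl)).
set (K := fun s => cos (2 * PI * (s - t0)) + q).
set (eta := cos (PI * dl) - cos (2 * PI * dl)).
assert (Heta : 0 < eta).
{ unfold eta. assert (cos (2 * PI * dl) < cos (PI * dl)); [|lra]. apply cos_decreasing_1; nra. }
assert (Hcd : 0 <= cos (2 * PI * dl) <= 1).
{ split; [apply cos_ge_0; nra|apply COS_bound]. }
assert (CA : forall s, cos (2 * PI * (s - t0)) = cos (2 * PI * Rabs (s - t0))).
{ intros s. unfold Rabs. destruct Rcase_abs; auto. rewrite <- cos_neg. f_equal; ring. }
assert (K1 : forall s, 0 <= s <= 1 -> dl <= Rabs (s - t0) -> Rabs (K s) <= 1).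
{ intros s Hs Hd. unfold K, q. rewrite CA.
  assert (U : Rabs (s - t0) <= 1 - dl) by (unfold Rabs; destruct Rcase_abs; lra).
  assert (Q := COS_bound (2 * PI * Rabs (s - t0))).
  assert (cos (2 * PI * Rabs (s - t0)) <= cos (2 * PI * dl)).
  { destruct (Rle_dec (Rabs (s - t0)) (1 / 2)).
    - apply cos_decr_1; nra.
    - replace (cos (2 * PI * dl)) with (cos (2 * PI * (1 - dl))).
      + apply cos_incr_1; nra.
      + replace (2 * PI * (1 - dl)) with (- (2 * PI * dl) + 2 * INR 1 * PI) by (simpl; ring).
        rewrite cos_period, cos_neg; auto. }
  apply Rabs_le; lra. }
assert (K2 : forall s, Rabs (s - t0) <= dl -> 1 <= K s).
{ intros s Hs. unfold K, q. rewrite CA. assert (cos (2 * PI * dl) <= cos (2 * PI * Rabs (s - t0))); [|lra].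
  assert (W := Rabs_pos (s - t0)). apply cos_decr_1; nra. }
assert (K3 : forall s, Rabs (s - t0) <= dl / 2 -> 1 + eta <= K s).
{ intros s Hs. unfold K, q, eta. rewrite CA. assert (cos (PI * dl) <= cos (2 * PI * Rabs (s - t0))); [|lra].
  assert (W := Rabs_pos (s - t0)). apply cos_decr_1; nra. }
assert (D2 : forall s, Rabs (s - t0) <= dl -> d t0 / 2 <= d s).
{ intros s Hs. assert (B : ball (d t0) (d t0 * / 2) (d s)).
  { apply He. unfold ball; simpl; unfold AbsRing_ball, abs, minus, plus, opp; simpl.
    replace (s + - t0) with (s - t0) by ring. lra. }
  unfold ball in B; simpl in B; unfold AbsRing_ball, abs, minus, plus, opp in B; simpl in B.
  apply Rabs_def2 in B. lra. }
assert (PM : 0 <= M) by (assert (X := HM 0); assert (Y := Rabs_pos (d 0)); lra).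
assert (contK : forall N t, continuous (fun s : R => d s * K s ^ N) t).
{ intros N t. apply (continuous_mult (K := R_AbsRing)); auto.
  apply (ex_derive_continuous (fun s : R => K s ^ N)). unfold K. auto_derive; auto. }
(* Far from [t0] the kernel is at most 1 in absolute value; inside the window the integrand is
   nonnegative. So its powers can never push the integrand below [- M]. *)
assert (low : forall N s, 0 <= s <= 1 -> - M <= d s * K s ^ N).
{ intros N s Hs. destruct (Rle_dec dl (Rabs (s - t0))) as [L|L].
  - assert (A : Rabs (d s * K s ^ N) <= M).
    { rewrite Rabs_mult, <- RPow_abs. specialize (K1 s Hs L). specialize (HM s).
      assert (Rabs (K s) ^ N <= 1). { rewrite <- (pow1 N). apply pow_incr. split; auto. apply Rabs_pos. }
      assert (0 <= Rabs (K s) ^ N) by (apply pow_le, Rabs_pos). assert (X := Rabs_pos (d s)). nra. }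
    assert (Y := Rabs_def2 (d s * K s ^ N) (M + 1)). unfold Rabs in A; destruct Rcase_abs in A; lra.
  - assert (0 <= K s ^ N). { apply pow_le. specialize (K2 s); lra. }
    specialize (D2 s). nra. }
(* Only the half window is used for the gain, where the kernel is at least [1 + eta]; the intervals
   on the two sides lose at most [M] each. *)
assert (Main : forall N, 0 >= - M + dl * (d t0 / 2 * (1 + eta) ^ N) - M).
{ intros N. assert (E := HI q N). fold K in E.
  assert (X : forall a b, ex_RInt (fun s => d s * K s ^ N) a b) by (intros; apply ex_RInt_cont; auto).
  change (RInt (fun s => d s * K s ^ N) 0 1 = 0) in E.
  rewrite <- (RInt_Chasles (V := R_CompleteNormedModule) _ 0 (t0 - dl / 2) 1) in E by auto.
  rewrite <- (RInt_Chasles (V := R_CompleteNormedModule) _ (t0 - dl / 2) (t0 + dl / 2) 1) in E by auto.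
  unfold plus in E; simpl in E.
  assert (RC : forall a b v, RInt (fun _ => v) a b = (b - a) * v) by (intros; rewrite RInt_const; reflexivity).
  assert (L1 : (t0 - dl / 2 - 0) * - M <= RInt (fun s => d s * K s ^ N) 0 (t0 - dl / 2)).
  { rewrite <- (RC 0 (t0 - dl / 2) (- M)).
    apply RInt_le; auto. lra. apply ex_RInt_const. intros s Hs. apply low; lra. }
  assert (L3 : (1 - (t0 + dl / 2)) * - M <= RInt (fun s => d s * K s ^ N) (t0 + dl / 2) 1).
  { rewrite <- (RC (t0 + dl / 2) 1 (- M)).
    apply RInt_le; auto. lra. apply ex_RInt_const. intros s Hs. apply low; lra. }
  assert (L2 : (t0 + dl / 2 - (t0 - dl / 2)) * (d t0 / 2 * (1 + eta) ^ N) <= RInt (fun s => d s * K s ^ N) (t0 - dl / 2) (t0 + dl / 2)).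
  { rewrite <- (RC (t0 - dl / 2) (t0 + dl / 2) _).
    apply RInt_le; auto. lra. apply ex_RInt_const. intros s Hs.
    assert (A : Rabs (s - t0) <= dl / 2) by (apply Rabs_le; lra).
    apply Rmult_le_compat. lra. apply pow_le; lra. apply D2; lra. apply pow_incr. specialize (K3 s A). lra. }
  nra. }
destruct (Pow_x_infinity (1 + eta)) with (b := 2 * M / (dl * (d t0 / 2)) + 1) as (N & HN).
{ rewrite Rabs_pos_eq; lra. }
specialize (HN N (le_n N)). rewrite Rabs_pos_eq in HN by (apply pow_le; lra).
specialize (Main N).
assert (Q : 0 < dl * (d t0 / 2)) by (apply Rmult_lt_0_compat; lra).
assert (Y : dl * (d t0 / 2) * (2 * M / (dl * (d t0 / 2)) + 1) <= dl * (d t0 / 2) * (1 + eta) ^ N).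
{ apply Rmult_le_compat_l; lra. }
replace (dl * (d t0 / 2) * (2 * M / (dl * (d t0 / 2)) + 1)) with (2 * M + dl * (d t0 / 2)) in Y by (field; lra).
lra.
Qed.

Lemma Cmod_Ci : Cmod Ci = 1.
Proof. unfold Cmod, Ci; simpl. replace (0 * (0 * 1) + 1 * (1 * 1)) with 1 by ring. apply sqrt_1. Qed.

Lemma cos_expi x : RtoC (cos x) = (RtoC (/ 2) * (expi x + expi (- x)))%C.
Proof. unfold expi. rewrite cos_neg, sin_neg. apply injective_projections; simpl; field. Qed.

(** * A continuous periodic function with vanishing Fourier coefficients is zero *)

Section FourierUniqueness.
Variable D : R -> C.
Hypothesis Dc : contC D.
Hypothesis D0 : forall n : Z, CI (fun s => D s * expi (2 * PI * IZR n * s))%C = RtoC 0.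

Lemma contC_RtoC (u : R -> R) : (forall t, continuous u t) -> contC (fun s => RtoC (u s)).
Proof. intros H t. split; simpl; auto. apply continuous_const. Qed.

Lemma contC_kernel t0 q N : contC (fun s => RtoC ((cos (2 * PI * (s - t0)) + q) ^ N)).
Proof.
apply contC_RtoC. intros t.
apply (ex_derive_continuous (fun s : R => (cos (2 * PI * (s - t0)) + q) ^ N)). auto_derive; auto.
Qed.

(** One more factor [cos + q] expresses the integral at frequency [n] through those at [n + 1],
    [n - 1] and [n]; hence the induction runs over all frequencies simultaneously. *)
Lemma kernel_coef t0 q N : forall n : Z,
  CI (fun s => D s * RtoC ((cos (2 * PI * (s - t0)) + q) ^ N) * expi (2 * PI * IZR n * s))%C = RtoC 0.
Proof.
induction N as [|N IH]; intros n.
- rewrite <- (D0 n). apply CI_ext. intros s. simpl. ring.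
- assert (B : forall m, contC (fun s => D s * RtoC ((cos (2 * PI * (s - t0)) + q) ^ N) * expi (2 * PI * IZR m * s))%C).
  { intros m. apply contC_mult; [apply contC_mult|]; auto. apply contC_kernel. apply contC_expi. }
  set (f := fun m s => (D s * RtoC ((cos (2 * PI * (s - t0)) + q) ^ N) * expi (2 * PI * IZR m * s))%C) in *.
  set (a := (RtoC (/ 2) * expi (- (2 * PI * t0)))%C). set (b := (RtoC (/ 2) * expi (2 * PI * t0))%C).
  transitivity (CI (fun s => (a * f (n + 1)%Z s + b * f (n - 1)%Z s) + RtoC q * f n s)%C).
  + apply CI_ext. intros s. unfold f, a, b. rewrite plus_IZR, minus_IZR. cbn [pow].
    rewrite RtoC_mult, RtoC_plus, cos_expi.
    replace (2 * PI * (s - t0)) with (2 * PI * s + - (2 * PI * t0)) by ring.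
    replace (- (2 * PI * s + - (2 * PI * t0))) with (- (2 * PI * s) + 2 * PI * t0) by ring.
    replace (2 * PI * (IZR n + 1) * s) with (2 * PI * IZR n * s + 2 * PI * s) by ring.
    replace (2 * PI * (IZR n - 1) * s) with (2 * PI * IZR n * s + - (2 * PI * s)) by ring.
    rewrite !expi_plus. ring.
  + assert (Bf : forall m, contC (f m)) by exact B.
    assert (If : forall m, CI (f m) = RtoC 0) by exact IH. clearbody f.
    assert (B1 := Bf (n + 1)%Z). assert (B2 := Bf (n - 1)%Z). assert (B3 := Bf n).
    rewrite CI_plus, CI_plus, !CI_scal by contC_tac. rewrite !If. ring.
Qed.

Variable M : R.
Hypothesis DM : forall t, Cmod (D t) <= M.

Lemma fourier_zero_open t0 : 0 < t0 < 1 -> D t0 = RtoC 0.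
Proof.
intros Ht. apply NNPP. intros N.
(* Multiplying by the conjugate of the value makes the real part at [t0] equal to the squared
   modulus, hence positive. *)
set (v := Cconj (D t0)).
apply (kernel_contra (fun s => Re (v * D s)%C) t0 (Cmod v * M) Ht).
- intros t. exact (proj1 (contC_mult _ _ (contC_const v) Dc t)).
- intros t. eapply Rle_trans; [apply Re_le_Cmod|]. rewrite Cmod_mult.
  apply Rmult_le_compat_l; auto. apply Cmod_ge_0.
- unfold v. assert (E : Re (Cconj (D t0) * D t0)%C = Re (D t0) ^ 2 + Im (D t0) ^ 2).
  { unfold Cconj, Cmult, Re, Im; simpl; ring. }
  rewrite E. assert (Q1 := pow2_ge_0 (Re (D t0))). assert (Q2 := pow2_ge_0 (Im (D t0))).
  destruct (Req_dec (Re (D t0) ^ 2 + Im (D t0) ^ 2) 0) as [Z|Z]; [|lra].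
  exfalso. apply N. assert (Z1 : Re (D t0) ^ 2 = 0) by lra. assert (Z2 : Im (D t0) ^ 2 = 0) by lra.
  apply injective_projections; simpl; [unfold Re in Z1|unfold Im in Z2]; nra.
- intros q K. assert (E := kernel_coef t0 q K 0).
  apply (f_equal (fun z => Re (v * z)%C)) in E. rewrite <- CI_scal in E.
  2:{ apply contC_mult; [apply contC_mult|]; auto. apply contC_kernel. apply contC_expi. }
  rewrite Cmult_0_r in E. eapply eq_trans; [|exact E]. unfold CI. cbn [Re fst]. apply RInt_ext. intros s _.
  replace (2 * PI * 0 * s) with 0 by ring. rewrite expi_0. unfold Cmult, Re, RtoC; simpl. ring.
Qed.

Lemma fourier_unique : (forall s k, D (s + IZR k) = D s) -> forall t, D t = RtoC 0.
Proof.
intros Per t. set (k := Int_part t). assert (Hk := base_Int_part t). fold k in Hk.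
replace t with ((t - IZR k) + IZR k) by ring. rewrite Per.
destruct (Req_dec (t - IZR k) 0) as [Z|Z]; [|apply fourier_zero_open; lra].
rewrite Z.
(* The integers are not reached by [fourier_zero_open]; the value there follows from continuity at
   the endpoint. *)
assert (K : forall u : R -> R, (forall x, 0 < x < 1 -> u x = 0) -> continuous u 0 -> u 0 = 0).
{ intros u H0 Hu. destruct (Req_dec (u 0) 0) as [|N]; auto. exfalso.
  assert (P := Rabs_pos_lt _ N).
  destruct (proj1 (filterlim_locally u (u 0)) Hu (mkposreal _ P)) as (e & He). simpl in He.
  assert (Pe : 0 < e) by apply cond_pos.
  set (x := Rmin (e / 2) (1 / 2)).
  assert (Hx : 0 < x < 1 /\ x < e). { unfold x. assert (A := Rmin_l (e / 2) (1 / 2)). assert (B := Rmin_r (e / 2) (1 / 2)).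
    assert (0 < Rmin (e / 2) (1 / 2)) by (apply Rmin_pos; lra). lra. }
  specialize (He x). rewrite (H0 x) in He by lra.
  assert (B : ball (u 0) (Rabs (u 0)) 0).
  { apply He. unfold ball; simpl; unfold AbsRing_ball, abs, minus, plus, opp; simpl.
    replace (x + - 0) with x by ring. rewrite Rabs_pos_eq; lra. }
  unfold ball in B; simpl in B; unfold AbsRing_ball, abs, minus, plus, opp in B; simpl in B.
  rewrite Rplus_0_l, Rabs_Ropp in B. lra. }
apply injective_projections; simpl.
- apply (K (fun x => Re (D x))); [|apply Dc]. intros x Hx. rewrite fourier_zero_open; auto.
- apply (K (fun x => Im (D x))); [|apply Dc]. intros x Hx. rewrite fourier_zero_open; auto.
Qed.

End FourierUniqueness.

(** * Periodizations of rapidly decaying functions *)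

Lemma taylor1_ext f g t d d' M : (forall x, f x = g x) -> d = d' -> taylor1 f t d M -> taylor1 g t d' M.
Proof. intros E ->. assert (K : f = g) by (extensionality x; auto). subst; auto. Qed.

Lemma is_derive_shift (G G1 : R -> R) a x : (forall x, is_derive G x (G1 x)) ->
  is_derive (fun x => G (x - a)) x (G1 (x - a)).
Proof.
intros H. auto_derive. exists (G1 (x - a)); apply H. rewrite (DeriveE G G1 H). unfold Rminus. ring.
Qed.

Section ShiftSum.
Variables (G G1 G2 : R -> R) (B : R).
Hypothesis H1 : forall x, is_derive G x (G1 x).
Hypothesis H2 : forall x, is_derive G1 x (G2 x).
Hypothesis HB : forall x, Rabs (G x) <= B * exp (- Rabs x) /\ Rabs (G1 x) <= B * exp (- Rabs x) /\ Rabs (G2 x) <= B * exp (- Rabs x).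

(** The modulation is applied before periodizing, so the integral over one period unfolds to the
    integral of [G x * expi (b * x)] over the line. *)
Definition periodize (b s : R) : C := usum (fun k : Z => RtoC (G (s - IZR k)) * expi (b * (s - IZR k)))%C.

Lemma B_pos : 0 <= B.
Proof.
destruct (HB 0) as [K _]. assert (Q := Rabs_pos (G 0)). rewrite Rabs_R0, Ropp_0, exp_0 in K. lra.
Qed.

Lemma periodize_abs_bsum b : exists A, forall s, abs_bsum (fun k : Z => RtoC (G (s - IZR k)) * expi (b * (s - IZR k)))%C A.
Proof.
destruct exp_sum as (M & PM & HM). exists (B * M). intros s.
generalize (bsum_scal B _ _ B_pos (HM s)). apply bsum_mono; [|lra]. intros k.
rewrite Cmod_mult, Cmod_expi, Cmod_R, Rmult_1_r. apply HB.
Qed.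

Lemma periodize_taylor1 b s : exists M,
  taylor1 (periodize b) s (usum (fun k : Z => (RtoC (G1 (s - IZR k)) + Ci * RtoC (b * G (s - IZR k))) * expi (b * (s - IZR k))))%C M.
Proof.
destruct exp_sum as (M & PM & HM).
set (m := fun k : Z => 2 * (B * exp 1 * exp (- Rabs (s - IZR k)) * (1 + Rabs b) ^ 2)).
exists (2 * (B * exp 1) * (1 + Rabs b) ^ 2 * M).
unfold periodize. apply (usum_taylor1 (fun k x => RtoC (G (x - IZR k)) * expi (b * (x - IZR k)))%C s _ m).
- intros k. unfold m.
  apply (taylor1_ext (fun x => RtoC (G (x - IZR k)) * expi (b * x + - (b * IZR k)))%C _ s
    ((RtoC (G1 (s - IZR k)) + Ci * RtoC (b * G (s - IZR k))) * expi (b * s + - (b * IZR k)))%C).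
  + intros x. do 2 f_equal. ring.
  + do 2 f_equal. ring.
  + apply (term_taylor1 (fun x => G (x - IZR k)) (fun x => G1 (x - IZR k)) (fun x => G2 (x - IZR k))).
    * intros x. apply is_derive_shift; auto.
    * intros x. apply is_derive_shift; auto.
    * intros x Hx. assert (E : B * exp (- Rabs (x - IZR k)) <= B * exp 1 * exp (- Rabs (s - IZR k))).
      { rewrite Rmult_assoc. apply Rmult_le_compat_l. apply B_pos. rewrite <- exp_plus. apply exp_le.
        assert (T := Rabs_triang (x - IZR k) (- (x - s))). rewrite Rabs_Ropp in T.
        replace (x - IZR k + - (x - s)) with (s - IZR k) in T by ring. lra. }
      destruct (HB (x - IZR k)) as (A0 & A1 & A2). repeat split; lra.
- assert (P : 0 <= 2 * (B * exp 1) * (1 + Rabs b) ^ 2).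
  { assert (Q := B_pos). assert (Q' := exp_pos 1). assert (Q2 := pow2_ge_0 (1 + Rabs b)).
    apply Rmult_le_pos; auto. apply Rmult_le_pos; [lra|]. apply Rmult_le_pos; lra. }
  generalize (bsum_scal _ _ _ P (HM s)). apply bsum_mono; [|lra]. intros k. unfold m. right; ring.
- intros x. destruct (periodize_abs_bsum b) as (A & HA). exists A; auto.
- exists (B * (1 + Rabs b) * M).
  assert (P : 0 <= B * (1 + Rabs b)). { assert (Q := B_pos). assert (Q' := Rabs_pos b). apply Rmult_le_pos; lra. }
  generalize (bsum_scal _ _ _ P (HM s)). apply bsum_mono; [|lra]. intros k.
  rewrite Cmod_mult, Cmod_expi, Rmult_1_r. eapply Rle_trans; [apply Cmod_triangle|].
  rewrite Cmod_mult, !Cmod_R, Cmod_Ci, Rabs_mult. destruct (HB (s - IZR k)) as (A0 & A1 & A2).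
  assert (Q' := Rabs_pos b). nra.
Qed.

Lemma periodize_cont b : contC (periodize b).
Proof. apply contC_taylor1. intros t. destruct (periodize_taylor1 b t) as (M & HM). eauto. Qed.

Lemma periodize_shift b s j : periodize b (s + IZR j) = periodize b s.
Proof.
unfold periodize. destruct (periodize_abs_bsum b) as (A & HA).
rewrite (usum_inj (fun k : Z => (k + j)%Z) _ A (HA _)).
- apply usum_ext. intros k. rewrite plus_IZR. replace (s + IZR j - (IZR k + IZR j)) with (s - IZR k) by ring. auto.
- intros; lia.
- intros i _. exists (i - j)%Z. lia.
Qed.

End ShiftSum.

(** * The Fourier transform of a Gaussian *)

Section Poisson.
Variable c : R.
Hypothesis Pc : 0 < c.

Definition gauss (x : R) : R := exp (- c * x ^ 2).
Definition gauss1 (x : R) : R := - 2 * c * (x * gauss x).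
Definition gauss2 (x : R) : R := - 2 * c * (gauss x - 2 * c * x ^ 2 * gauss x).
Definition xgauss1 (x : R) : R := gauss x - 2 * c * x ^ 2 * gauss x.
Definition xgauss2 (x : R) : R := (- 6 * c * x + 4 * c ^ 2 * x ^ 3) * gauss x.

Lemma gauss_der x : is_derive gauss x (gauss1 x).
Proof. unfold gauss, gauss1, gauss. auto_derive; auto. cbn [pow]. ring. Qed.
Lemma gauss1_der x : is_derive gauss1 x (gauss2 x).
Proof. unfold gauss1, gauss2, gauss. auto_derive; auto. cbn [pow]. ring. Qed.
Lemma xgauss_der x : is_derive (fun x => x * gauss x) x (xgauss1 x).
Proof. unfold xgauss1, gauss. auto_derive; auto. cbn [pow]. ring. Qed.
Lemma xgauss1_der x : is_derive xgauss1 x (xgauss2 x).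
Proof. unfold xgauss1, xgauss2, gauss. auto_derive; auto. cbn [pow]. ring. Qed.

Lemma gauss_pos x : 0 < gauss x.
Proof. apply exp_pos. Qed.

Lemma gauss_poly_bound : exists B, 0 < B /\ forall x, (1 + Rabs x) ^ 3 * gauss x <= B * exp (- Rabs x).
Proof. destruct (gauss_dom c 3 Pc) as (M & PM & HM). exists M. split; auto. Qed.

Lemma poly_le x K p : Rabs p <= K * (1 + Rabs x) ^ 3 -> forall B, (1 + Rabs x) ^ 3 * gauss x <= B * exp (- Rabs x) -> 0 <= K ->
  Rabs (p * gauss x) <= K * B * exp (- Rabs x).
Proof.
intros H B HB HK. rewrite Rabs_mult, (Rabs_pos_eq (gauss x)) by (left; apply gauss_pos).
assert (P := gauss_pos x). apply Rle_trans with (K * (1 + Rabs x) ^ 3 * gauss x).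
apply Rmult_le_compat_r; lra. rewrite !Rmult_assoc. apply Rmult_le_compat_l; auto.
Qed.

Lemma gauss_C2_bounds : exists B, forall x, Rabs (gauss x) <= B * exp (- Rabs x) /\ Rabs (gauss1 x) <= B * exp (- Rabs x) /\ Rabs (gauss2 x) <= B * exp (- Rabs x).
Proof.
destruct gauss_poly_bound as (B & PB & HB).
exists ((1 + 2 * c + 4 * c ^ 2) * B). intros x.
assert (Q := Rabs_pos x). assert (Pc2 : 0 < c ^ 2) by (apply pow_lt; auto).
set (K := 1 + 2 * c + 4 * c ^ 2). assert (PK : 0 <= K) by (unfold K; lra).
assert (X3 : forall y, 0 <= y -> 1 <= (1 + y) ^ 3 /\ y <= (1 + y) ^ 3 /\ y ^ 2 <= (1 + y) ^ 3).
{ intros y Hy. assert (0 <= y ^ 2) by apply pow2_ge_0. assert (0 <= y ^ 3) by (apply pow_le; auto).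
  replace ((1 + y) ^ 3) with (1 + 3 * y + 3 * y ^ 2 + y ^ 3) by ring. repeat split; lra. }
destruct (X3 _ Q) as (Y0 & Y1 & Y2). set (Z := (1 + Rabs x) ^ 3) in *.
assert (E2 : x ^ 2 = Rabs x ^ 2) by (rewrite pow2_abs; auto).
repeat split.
- replace (gauss x) with (1 * gauss x) by ring. apply poly_le; auto. rewrite Rabs_R1. fold Z. unfold K. nra.
- unfold gauss1. replace (- 2 * c * (x * gauss x)) with ((- (2 * c * x)) * gauss x) by ring. apply poly_le; auto.
  rewrite Rabs_Ropp, !Rabs_mult, (Rabs_pos_eq 2), (Rabs_pos_eq c) by lra. fold Z. unfold K. nra.
- unfold gauss2. replace (- 2 * c * (gauss x - 2 * c * x ^ 2 * gauss x)) with ((- (2 * c) + 4 * c ^ 2 * x ^ 2) * gauss x) by ring.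
  apply poly_le; auto. eapply Rle_trans; [apply Rabs_triang|].
  rewrite Rabs_Ropp, (Rabs_pos_eq (2 * c)), (Rabs_pos_eq (4 * c ^ 2 * x ^ 2)) by nra. rewrite E2. fold Z. unfold K.
  assert (4 * c ^ 2 * Rabs x ^ 2 <= 4 * c ^ 2 * Z) by (apply Rmult_le_compat_l; lra). nra.
Qed.

Lemma xgauss_C2_bounds : exists B, forall x, Rabs (x * gauss x) <= B * exp (- Rabs x) /\ Rabs (xgauss1 x) <= B * exp (- Rabs x) /\ Rabs (xgauss2 x) <= B * exp (- Rabs x).
Proof.
destruct gauss_poly_bound as (B & PB & HB).
exists ((1 + 6 * c + 4 * c ^ 2) * B). intros x.
assert (Q := Rabs_pos x). assert (Pc2 : 0 < c ^ 2) by (apply pow_lt; auto).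
set (K := 1 + 6 * c + 4 * c ^ 2). assert (PK : 0 <= K) by (unfold K; lra).
assert (X3 : forall y, 0 <= y -> 1 <= (1 + y) ^ 3 /\ y <= (1 + y) ^ 3 /\ y ^ 2 <= (1 + y) ^ 3 /\ y ^ 3 <= (1 + y) ^ 3).
{ intros y Hy. assert (0 <= y ^ 2) by apply pow2_ge_0. assert (0 <= y ^ 3) by (apply pow_le; auto).
  replace ((1 + y) ^ 3) with (1 + 3 * y + 3 * y ^ 2 + y ^ 3) by ring. repeat split; lra. }
destruct (X3 _ Q) as (Y0 & Y1 & Y2 & Y3). set (Z := (1 + Rabs x) ^ 3) in *.
assert (E2 : x ^ 2 = Rabs x ^ 2) by (rewrite pow2_abs; auto).
repeat split.
- apply poly_le; auto. fold Z. unfold K. nra.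
- unfold xgauss1. replace (gauss x - 2 * c * x ^ 2 * gauss x) with ((1 + - (2 * c * x ^ 2)) * gauss x) by ring. apply poly_le; auto.
  eapply Rle_trans; [apply Rabs_triang|]. rewrite Rabs_R1, Rabs_Ropp, Rabs_pos_eq by nra. rewrite E2. fold Z. unfold K.
  assert (2 * c * Rabs x ^ 2 <= 2 * c * Z) by (apply Rmult_le_compat_l; lra). nra.
- unfold xgauss2. apply poly_le; auto. eapply Rle_trans; [apply Rabs_triang|].
  rewrite !Rabs_mult, <- !RPow_abs, (Rabs_pos_eq c), (Rabs_pos_eq 4) by lra.
  replace (Rabs (- 6)) with 6 by (unfold Rabs; destruct Rcase_abs; lra).
  fold Z. unfold K. assert (6 * c * Rabs x <= 6 * c * Z) by (apply Rmult_le_compat_l; lra).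
  assert (4 * c ^ 2 * Rabs x ^ 3 <= 4 * c ^ 2 * Z) by (apply Rmult_le_compat_l; lra). nra.
Qed.

(** The Fourier transform of the Gaussian at [xi], with the real line folded onto one period. *)
Definition FT (xi : R) : C := CI (periodize gauss (- 2 * PI * xi)).

(** The classical differential equation: differentiating in [xi] brings down [-2 PI i x], and
    [x * gauss x] is a multiple of the derivative of the Gaussian, so integration by parts gives
    [xi] times the transform back. *)
Lemma FT_taylor1 xi : exists M, taylor1 FT xi (RtoC (- (2 * PI ^ 2 * xi / c)) * FT xi)%C M.
Proof.
assert (PP := PI_RGT_0). assert (PP3 : 1 <= 2 * PI) by (assert (X := PI2_1); unfold PI2 in X; lra).
destruct gauss_C2_bounds as (B & HB). destruct xgauss_C2_bounds as (B' & HB').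
destruct gauss_poly_bound as (B3 & PB3 & HB3).
destruct exp_sum as (M & PM & HM).
set (b := fun x => - 2 * PI * x).
set (X := periodize (fun x => x * gauss x)).
assert (cT := periodize_cont gauss gauss1 gauss2 B gauss_der gauss1_der HB).
assert (cX := periodize_cont (fun x => x * gauss x) xgauss1 xgauss2 B' xgauss_der xgauss1_der HB').
destruct (periodize_abs_bsum gauss gauss1 gauss2 B HB (b xi)) as (A0 & HA0).
destruct (periodize_abs_bsum (fun x => x * gauss x) xgauss1 xgauss2 B' HB' (b xi)) as (A1 & HA1).
assert (cTx := cT (b xi)). assert (cXx := cX (b xi)). fold X in cXx.
(* the derivative of the periodization integrates to 0 over a period *)
assert (E : CI (X (b xi)) = (RtoC (- (PI * xi / c)) * Ci * FT xi)%C).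
{ assert (E : CI (fun s => RtoC (- 2 * c) * X (b xi) s + Ci * RtoC (b xi) * periodize gauss (b xi) s)%C =
     (periodize gauss (b xi) 1 - periodize gauss (b xi) 0)%C).
  { apply (CI_FTC (periodize gauss (b xi))).
    - intros t. destruct (periodize_taylor1 gauss gauss1 gauss2 B gauss_der gauss1_der HB (b xi) t) as (M' & HM'). exists M'.
      revert HM'. apply taylor1_ext; auto. unfold X, periodize.
      rewrite <- (usum_scal _ _ _ (HA1 t)), <- (usum_scal _ _ _ (HA0 t)).
      rewrite <- (usum_plus _ _ _ _ (abs_bsum_scal _ _ _ (HA1 t)) (abs_bsum_scal _ _ _ (HA0 t))).
      apply usum_ext. intros k. unfold gauss1. rewrite !RtoC_mult. ring.
    - contC_tac. }
  rewrite CI_plus, !CI_scal in E by contC_tac.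
  replace (periodize gauss (b xi) 1) with (periodize gauss (b xi) 0) in E.
  2:{ rewrite <- (periodize_shift gauss gauss1 gauss2 B HB (b xi) 0 1). f_equal. ring. }
  fold (FT xi) in E. change (CI (periodize gauss (b xi))) with (FT xi) in E.
  assert (Nc : RtoC (- 2 * c) <> RtoC 0). { intros Z. apply RtoC_inj in Z. lra. }
  transitivity (/ RtoC (- 2 * c) * (RtoC (-2 * c) * CI (X (b xi)) + Ci * RtoC (b xi) * FT xi - Ci * RtoC (b xi) * FT xi))%C.
  field; auto. rewrite E.
  replace (RtoC (- (PI * xi / c))) with (- (/ RtoC (-2 * c) * RtoC (b xi)))%C. ring.
  rewrite <- RtoC_inv by lra. rewrite <- RtoC_mult, <- RtoC_opp. f_equal. unfold b. field. lra. }
exists (2 * (2 * ((2 * PI) ^ 2 * B3) * M)). intros h Hh.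
assert (PK : 0 <= 2 * ((2 * PI) ^ 2 * B3)).
{ apply Rmult_le_pos; [lra|]. apply Rmult_le_pos; [apply pow2_ge_0|lra]. }
(* differentiation in [xi], uniformly in [s] *)
assert (U : forall s, taylor1 (fun y => periodize gauss (b y) s) xi (RtoC (- (2 * PI)) * Ci * X (b xi) s)%C (2 * ((2 * PI) ^ 2 * B3) * M)).
{ intros s. unfold periodize.
  apply (taylor1_ext (fun y => usum (fun k : Z => RtoC (gauss (s - IZR k)) * expi (b y * (s - IZR k))))%C _ xi
    (usum (fun k : Z => (RtoC 0 + Ci * RtoC (- 2 * PI * (s - IZR k) * gauss (s - IZR k))) * expi (b xi * (s - IZR k)))%C)).
  - auto.
  - unfold X, periodize. rewrite <- (usum_scal _ _ _ (HA1 s)). apply usum_ext. intros k.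
    rewrite !RtoC_mult, RtoC_opp, RtoC_mult. ring.
  - apply (usum_taylor1 _ _ _ (fun k => 2 * (gauss (s - IZR k) * (1 + Rabs (- 2 * PI * (s - IZR k))) ^ 2))).
    + intros k. apply (taylor1_ext (fun y => RtoC (gauss (s - IZR k)) * expi ((- 2 * PI * (s - IZR k)) * y + 0))%C _ xi
        ((RtoC 0 + Ci * RtoC (- 2 * PI * (s - IZR k) * gauss (s - IZR k))) * expi ((- 2 * PI * (s - IZR k)) * xi + 0))%C).
      * intros y. unfold b. do 2 f_equal. ring.
      * unfold b. do 2 f_equal; ring.
      * apply (term_taylor1 (fun _ => gauss (s - IZR k)) (fun _ => 0) (fun _ => 0)).
        intros x; apply (is_derive_const (gauss (s - IZR k) : R_NormedModule)).
        intros x; apply (is_derive_const (0 : R_NormedModule)).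
        intros x _. assert (Q := gauss_pos (s - IZR k)). rewrite Rabs_R0, Rabs_pos_eq; lra.
    + generalize (bsum_scal _ _ _ PK (HM s)). apply bsum_mono; [|lra]. intros k.
      set (x := s - IZR k). assert (Q := gauss_pos x). assert (Q' := Rabs_pos x).
      rewrite !Rabs_mult. replace (Rabs (-2)) with 2 by (unfold Rabs; destruct Rcase_abs; lra).
      rewrite (Rabs_pos_eq PI) by lra. specialize (HB3 x).
      apply Rle_trans with (2 * ((2 * PI) ^ 2 * ((1 + Rabs x) ^ 3 * gauss x))).
      * assert (T : (1 + 2 * PI * Rabs x) ^ 2 <= (2 * PI) ^ 2 * (1 + Rabs x) ^ 3).
        { apply Rle_trans with ((2 * PI * (1 + Rabs x)) ^ 2).
          apply pow_incr. split; [|nra]. nra.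
          rewrite Rpow_mult_distr. apply Rmult_le_compat_l. apply pow2_ge_0. apply Rle_pow; [lra|lia]. }
        nra.
      * assert (0 <= (2 * PI) ^ 2) by apply pow2_ge_0. nra.
    + intros y. destruct (periodize_abs_bsum gauss gauss1 gauss2 B HB (b y)) as (A & HA). exists A. apply HA.
    + exists (2 * PI * A1). generalize (bsum_scal (2 * PI) _ _ ltac:(lra) (HA1 s)). apply bsum_mono; [|lra].
      intros k. rewrite !Cmod_mult, Cmod_expi, !Rmult_1_r, Cplus_0_l, Cmod_mult, Cmod_Ci, !Cmod_R.
      rewrite Rmult_1_l, !Rabs_mult. replace (Rabs (-2)) with 2 by (unfold Rabs; destruct Rcase_abs; lra).
      rewrite (Rabs_pos_eq PI) by lra. lra. }
replace (FT (xi + h)%R - FT xi - RtoC h * (RtoC (- (2 * PI ^ 2 * xi / c)) * FT xi))%C with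
  (CI (fun s => periodize gauss (b (xi + h)%R) s + ((- (1)) * periodize gauss (b xi) s + (- RtoC h * (RtoC (- (2 * PI)) * Ci)) * X (b xi) s)))%C.
- rewrite Rmult_assoc. apply CI_bound.
  + assert (cTh := cT (b (xi + h))). contC_tac.
  + intros s. eapply Rle_trans; [|apply (U s h Hh)]. right. f_equal. ring.
- assert (cTh := cT (b (xi + h))). rewrite CI_plus, CI_plus, !CI_scal, E by contC_tac.
  + fold (FT xi) (FT (xi + h)). unfold b. fold (FT xi) (FT (xi + h)).
    replace (- RtoC h * (RtoC (- (2 * PI)) * Ci) * (RtoC (- (PI * xi / c)) * Ci * FT xi))%C with
      (- (RtoC h * (RtoC (- (2 * PI)) * RtoC (- (PI * xi / c)) * (Ci * Ci)) * FT xi))%C by ring.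
    replace (Ci * Ci)%C with (- RtoC 1)%C by (apply injective_projections; simpl; ring).
    replace (RtoC (- (2 * PI ^ 2 * xi / c))) with (- (RtoC (- (2 * PI)) * RtoC (- (PI * xi / c))))%C. ring.
    rewrite <- RtoC_mult, <- RtoC_opp. f_equal. field. lra.
Qed.

(** The product of [u] with the integrating factor [exp (k * x ^ 2)] has zero derivative. *)
Lemma ode_gauss (u : R -> R) k : (forall x, is_derive u x (- (2 * k * x) * u x)) -> forall x, u x = exp (- k * x ^ 2) * u 0.
Proof.
intros H x.
assert (D : forall t, is_derive (fun y => exp (k * y ^ 2) * u y) t 0).
{ intros t. auto_derive. eexists; apply H. rewrite (DeriveE u _ H). ring. }
assert (E : exp (k * x ^ 2) * u x = exp (k * 0 ^ 2) * u 0).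
{ destruct (Rtotal_order x 0) as [L|[->|L]]; auto.
  - apply (eq_is_derive (fun y : R => exp (k * y ^ 2) * u y) x 0); [intros t _; apply D|auto].
  - symmetry. apply (eq_is_derive (fun y : R => exp (k * y ^ 2) * u y) 0 x); [intros t _; apply D|auto]. }
replace (k * 0 ^ 2) with 0 in E by ring. rewrite exp_0, Rmult_1_l in E. rewrite <- E, <- Rmult_assoc, <- exp_plus.
replace (- k * x ^ 2 + k * x ^ 2) with 0 by ring. rewrite exp_0; ring.
Qed.

Lemma FT_gauss xi : FT xi = (RtoC (exp (- (PI ^ 2 / c) * xi ^ 2)) * FT 0)%C.
Proof.
assert (HR := ode_gauss (fun x => Re (FT x)) (PI ^ 2 / c)).
assert (HI := ode_gauss (fun x => Im (FT x)) (PI ^ 2 / c)).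
apply injective_projections.
- change (Re (FT xi) = Re (RtoC (exp (- (PI ^ 2 / c) * xi ^ 2)) * FT 0)%C).
  rewrite HR. unfold Cmult, Re, RtoC; simpl. ring.
  intros x. destruct (FT_taylor1 x) as (M & HM). apply taylor1_Re in HM. revert HM.
  match goal with |- is_derive _ _ ?A -> is_derive _ _ ?B => replace A with B; auto end.
  unfold Cmult, Re, RtoC; simpl. field. lra.
- change (Im (FT xi) = Im (RtoC (exp (- (PI ^ 2 / c) * xi ^ 2)) * FT 0)%C).
  rewrite HI. unfold Cmult, Im, RtoC; simpl. ring.
  intros x. destruct (FT_taylor1 x) as (M & HM). apply taylor1_Im in HM. revert HM.
  match goal with |- is_derive _ _ ?A -> is_derive _ _ ?B => replace A with B; auto end.
  unfold Cmult, Im, RtoC; simpl. field. lra.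
Qed.

End Poisson.

Lemma Cmod_small_0 z : (forall eps, 0 < eps -> Cmod z <= eps) -> z = RtoC 0.
Proof.
intros H. apply Cmod_eq_0. apply Rle_antisym; [|apply Cmod_ge_0]. apply le_epsilon. intros eps He.
rewrite Rplus_0_l; auto.
Qed.

Lemma CI_lsum {I} (f : I -> R -> C) l : (forall i, contC (f i)) ->
  contC (fun s => lsum (fun i => f i s) l) /\ CI (fun s => lsum (fun i => f i s) l) = lsum (fun i => CI (f i)) l.
Proof.
intros H. induction l as [|i l [IH1 IH2]]; simpl.
- split; [apply contC_const|]. unfold CI. simpl. rewrite !RInt_const. unfold scal; simpl; unfold mult; simpl.
  apply injective_projections; simpl; ring.
- split; [apply contC_plus; auto|]. rewrite (CI_plus (f i)); auto. rewrite IH2; auto.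
Qed.

Lemma lsum_single {I} (a : I -> C) i l : NoDup l -> In i l ->
  lsum (fun j => if eqdec j i then a j else RtoC 0) l = a i.
Proof.
intros Nl Hi. rewrite (lsum_support _ (i :: nil) l); auto.
- simpl. destruct (eqdec i i); [ring|congruence].
- apply NoDup1.
- intros x [<-|[]]; auto.
- intros x _ Hx. destruct (eqdec x i); auto. subst; elim Hx; simpl; auto.
Qed.

(** A finite head is integrated termwise and the remaining coefficients have small total mass, so
    their contribution is small uniformly in [s]. *)
Lemma series_coef (a : Z -> C) A m : abs_bsum a A ->
  contC (fun s => usum (fun n => a n * expi (2 * PI * IZR n * s))%C) ->
  CI (fun s => usum (fun n => a n * expi (2 * PI * IZR n * s)) * expi (2 * PI * IZR m * s))%C = a (- m)%Z.
Proof.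
intros HA Hc. set (Sg := fun s => usum (fun n => a n * expi (2 * PI * IZR n * s))%C) in *.
assert (Z : (CI (fun s => Sg s * expi (2 * PI * IZR m * s)) - a (- m)%Z)%C = RtoC 0).
2:{ change (CI (fun s => Sg s * expi (2 * PI * IZR m * s))%C = a (- m)%Z). revert Z. generalize (CI (fun s => Sg s * expi (2 * PI * IZR m * s))%C). intros z Z.
    replace z with ((z - a (- m)%Z) + a (- m)%Z)%C by ring. rewrite Z. ring. }
apply Cmod_small_0. intros eps He.
destruct (bsum_tail (fun n => Cmod (a n)) A (eps / 2)) as (l0 & N0 & H0); auto; try lra.
{ intros; apply Cmod_ge_0. }
destruct (union_ex ((- m)%Z :: nil) l0) as (l & Nl & i1 & i2).
set (tail := fun n => if in_dec eqdec n l then RtoC 0 else a n).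
set (head := fun n => if in_dec eqdec n l then a n else RtoC 0).
assert (Ht : abs_bsum tail (eps / 2)).
{ revert H0. apply bsum_mono; [|lra]. intros n. unfold tail. destruct (in_dec eqdec n l); [rewrite Cmod_0|].
  destruct (in_dec eqdec n l0); [lra|apply Cmod_ge_0].
  destruct (in_dec eqdec n l0); [exfalso; auto|lra]. }
assert (E : forall s, Sg s = (lsum (fun n => a n * expi (2 * PI * IZR n * s)) l + usum (fun n => tail n * expi (2 * PI * IZR n * s)))%C).
{ intros s. unfold Sg.
  assert (B : abs_bsum (fun n => tail n * expi (2 * PI * IZR n * s))%C (eps / 2)).
  { revert Ht. apply bsum_mono; [|lra]. intros n. rewrite Cmod_mult, Cmod_expi; lra. }
  assert (U : is_usum (fun n => head n * expi (2 * PI * IZR n * s))%C (lsum (fun n => head n * expi (2 * PI * IZR n * s))%C l)).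
  { apply is_usum_support; auto. intros n Hn. unfold head. destruct (in_dec eqdec n l); [contradiction|ring]. }
  assert (V := is_usum_plus _ _ _ _ U (abs_bsum_usum _ _ B)).
  rewrite (lsum_ext (fun n => a n * expi (2 * PI * IZR n * s))%C (fun n => head n * expi (2 * PI * IZR n * s))%C l).
  2:{ intros n Hn. unfold head. destruct (in_dec eqdec n l); [auto|contradiction]. }
  rewrite <- (usum_unique _ _ V). apply usum_ext. intros n. unfold head, tail.
  destruct (in_dec eqdec n l); ring. }
assert (ce : contC (fun s => expi (2 * PI * IZR m * s))) by apply contC_expi.
destruct (CI_lsum (fun n s => a n * expi (2 * PI * IZR (n + m) * s))%C l) as (cl & E_l1).
{ intros n. apply contC_mult; [apply contC_const|apply contC_expi]. }
assert (E2 : forall s, (Sg s * expi (2 * PI * IZR m * s))%C = (lsum (fun n => a n * expi (2 * PI * IZR (n + m) * s)) l +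
   usum (fun n => tail n * expi (2 * PI * IZR n * s)) * expi (2 * PI * IZR m * s))%C).
{ intros s. rewrite E. rewrite Cmult_plus_distr_r. f_equal.
  rewrite Cmult_comm, <- lsum_scal. apply lsum_ext. intros n _. rewrite plus_IZR.
  replace (2 * PI * (IZR n + IZR m) * s) with (2 * PI * IZR m * s + 2 * PI * IZR n * s) by ring.
  rewrite expi_plus. ring. }
assert (cr : contC (fun s => usum (fun n => tail n * expi (2 * PI * IZR n * s)) * expi (2 * PI * IZR m * s))%C).
{ apply (contC_ext (fun s => Sg s * expi (2 * PI * IZR m * s) + (- (1)) * lsum (fun n => a n * expi (2 * PI * IZR (n + m) * s)) l)%C).
  - intros s. rewrite E2. ring.
  - apply contC_plus; apply contC_mult; auto. apply contC_const. }
rewrite (CI_ext _ _ E2), CI_plus, E_l1; auto.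
rewrite (lsum_ext _ (fun n => if eqdec n (- m)%Z then a n else RtoC 0)).
2:{ intros n _. rewrite CI_scal by apply contC_expi. rewrite CI_expi.
    destruct (eqdec n (- m)%Z), (Z.eq_dec (n + m) 0); try lia; ring. }
rewrite lsum_single; auto. 2: apply i1; left; auto.
match goal with |- Cmod (?x + ?y - ?x)%C <= _ => replace (x + y - x)%C with y by ring end.
replace eps with (2 * (eps / 2)) by field. apply CI_bound; auto.
intros s. rewrite Cmod_mult, Cmod_expi, Rmult_1_r. apply usum_Cmod.
revert Ht. apply bsum_mono; [|lra]. intros n. rewrite Cmod_mult, Cmod_expi; lra.
Qed.

Lemma gauss_abs_bsum c s : 0 < c -> exists A, abs_bsum (fun k : Z => RtoC (gauss c (s - IZR k))) A.
Proof.
intros Pc. destruct (gauss_C2_bounds c Pc) as (B & HB). destruct exp_sum as (M & PM & HM).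
assert (PB : 0 <= B). { destruct (HB 0) as [K _]. assert (Q := Rabs_pos (gauss c 0)). rewrite Rabs_R0, Ropp_0, exp_0 in K. lra. }
exists (B * M). generalize (bsum_scal B _ _ PB (HM s)). apply bsum_mono; [|lra]. intros k. rewrite Cmod_R. apply HB.
Qed.

Lemma dual_series_cont c w : 0 < c ->
  contC (fun s => usum (fun n : Z => RtoC (gauss c (w - IZR n)) * expi (2 * PI * IZR n * s))%C).
Proof.
intros Pc. apply contC_taylor1. intros t.
assert (PP := PI_RGT_0). assert (PP3 : 1 <= 2 * PI) by (assert (X := PI2_1); unfold PI2 in X; lra).
destruct (gauss_poly_bound c Pc) as (B & PB & HB). destruct exp_sum as (M & PM & HM).
set (K := (2 * PI) ^ 2 * (1 + Rabs w) ^ 2 * B).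
assert (PK : 0 <= 2 * K). { unfold K. assert (Q1 := pow2_ge_0 (2 * PI)). assert (Q2 := pow2_ge_0 (1 + Rabs w)). 
 apply Rmult_le_pos; [lra|]. apply Rmult_le_pos; [|lra]. apply Rmult_le_pos; auto. }
assert (Main : forall n, (1 + Rabs (2 * PI * IZR n)) ^ 2 * gauss c (w - IZR n) <= K * exp (- Rabs (w - IZR n))).
{ intros n. specialize (HB (w - IZR n)). set (x := w - IZR n) in *. assert (Qx := Rabs_pos x). assert (Qw := Rabs_pos w).
  rewrite !Rabs_mult, (Rabs_pos_eq 2), (Rabs_pos_eq PI) by lra.
  assert (Tn : Rabs (IZR n) <= Rabs w + Rabs x).
  { replace (IZR n) with (w + - x) by (unfold x; ring). eapply Rle_trans; [apply Rabs_triang|]. rewrite Rabs_Ropp; lra. }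
  assert (Gp := gauss_pos c x).
  apply Rle_trans with ((2 * PI) ^ 2 * (1 + Rabs w) ^ 2 * ((1 + Rabs x) ^ 3 * gauss c x)).
  - rewrite <- Rmult_assoc. apply Rmult_le_compat_r; [lra|].
    apply Rle_trans with (((2 * PI) * ((1 + Rabs w) * (1 + Rabs x))) ^ 2).
    + apply pow_incr. assert (Qn := Rabs_pos (IZR n)). split; [nra|].
      assert (1 + Rabs (IZR n) <= (1 + Rabs w) * (1 + Rabs x)) by nra. nra.
    + replace ((2 * PI * ((1 + Rabs w) * (1 + Rabs x))) ^ 2) with ((2 * PI) ^ 2 * ((1 + Rabs w) ^ 2 * (1 + Rabs x) ^ 2)) by ring.
      rewrite Rmult_assoc. apply Rmult_le_compat_l. apply pow2_ge_0.
      apply Rmult_le_compat_l. apply pow2_ge_0. apply Rle_pow; [lra|lia].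
  - unfold K. rewrite (Rmult_assoc _ B). apply Rmult_le_compat_l; auto. apply Rmult_le_pos; apply pow2_ge_0. }
assert (Hm : bsum (fun n : Z => 2 * (gauss c (w - IZR n) * (1 + Rabs (2 * PI * IZR n)) ^ 2)) (2 * K * M)).
{ generalize (bsum_scal _ _ _ PK (HM w)). apply bsum_mono; [|lra]. intros n. specialize (Main n). nra. }
eexists. exists (2 * K * M).
apply (usum_taylor1 (fun (n : Z) s => RtoC (gauss c (w - IZR n)) * expi (2 * PI * IZR n * s))%C t
   (fun n : Z => (RtoC 0 + Ci * RtoC (2 * PI * IZR n * gauss c (w - IZR n))) * expi (2 * PI * IZR n * t))%C
   (fun n : Z => 2 * (gauss c (w - IZR n) * (1 + Rabs (2 * PI * IZR n)) ^ 2))); auto.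
- intros n. assert (T := term_taylor1 (fun _ => gauss c (w - IZR n)) (fun _ => 0) (fun _ => 0) (2 * PI * IZR n) 0 t (gauss c (w - IZR n))).
  apply (taylor1_ext (fun x => RtoC (gauss c (w - IZR n)) * expi (2 * PI * IZR n * x + 0))%C _ t
    ((RtoC 0 + Ci * RtoC (2 * PI * IZR n * gauss c (w - IZR n))) * expi (2 * PI * IZR n * t + 0))%C); [| |apply T].
  + intros x. rewrite Rplus_0_r. auto.
  + rewrite Rplus_0_r. auto.
  + intros x; apply (is_derive_const (gauss c (w - IZR n) : R_NormedModule)).
  + intros x; apply (is_derive_const (0 : R_NormedModule)).
  + intros x _. assert (Q := gauss_pos c (w - IZR n)). rewrite Rabs_R0, Rabs_pos_eq; lra.
- intros x. destruct (gauss_abs_bsum c w Pc) as (A & HA). exists A. revert HA. apply bsum_mono; [|lra].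
  intros n. rewrite Cmod_mult, Cmod_expi; lra.
- exists (2 * K * M). revert Hm. apply bsum_mono; [|lra]. intros n.
  rewrite Cplus_0_l, !Cmod_mult, Cmod_expi, Cmod_Ci, Cmod_R, Rabs_mult.
  assert (Q := gauss_pos c (w - IZR n)). rewrite (Rabs_pos_eq (gauss c _)) by lra.
  set (y := Rabs (2 * PI * IZR n)). assert (Qy : 0 <= y) by apply Rabs_pos.
  assert (y <= 2 * (1 + y) ^ 2) by nra. nra.
Qed.

(* The constant is not needed explicitly, which avoids the Gaussian integral. *)
Lemma poisson_gauss c : 0 < c -> exists C0 : C, C0 <> RtoC 0 /\ forall w s,
  usum (fun k : Z => RtoC (gauss c (s - IZR k)) * expi (2 * PI * w * (s - IZR k)))%C =
  (C0 * usum (fun n : Z => RtoC (gauss (PI ^ 2 / c) (w - IZR n)) * expi (2 * PI * IZR n * s)))%C.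
Proof.
intros Pc. set (c' := PI ^ 2 / c).
assert (Pc' : 0 < c') by (apply Rdiv_lt_0_compat; auto; apply pow_lt, PI_RGT_0).
set (C0 := FT c 0).
assert (Main : forall w s, usum (fun k : Z => RtoC (gauss c (s - IZR k)) * expi (2 * PI * w * (s - IZR k)))%C =
  (C0 * usum (fun n : Z => RtoC (gauss c' (w - IZR n)) * expi (2 * PI * IZR n * s)))%C).
(* At [w = s = 0] the left side is a sum of positive terms with the term 1 at [k = 0], so [C0]
   cannot vanish. *)
2:{ exists C0. split; auto. intros Z0. specialize (Main 0 0).
    rewrite Z0, Cmult_0_l in Main.
    assert (E : usum (fun k : Z => RtoC (gauss c (0 - IZR k)) * expi (2 * PI * 0 * (0 - IZR k)))%C = usum (fun k : Z => RtoC (gauss c (0 - IZR k)))).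
    { apply usum_ext. intros k. replace (2 * PI * 0 * (0 - IZR k)) with 0 by ring. rewrite expi_0. ring. }
    rewrite E in Main. destruct (gauss_abs_bsum c 0 Pc) as (A & HA).
    assert (K := usum_real_ge (fun k : Z => gauss c (0 - IZR k)) A 0%Z).
    cbv beta in K. rewrite Main in K. simpl in K. rewrite Rminus_diag in K. unfold gauss in K at 3.
    replace (- c * 0 ^ 2) with 0 in K by ring. rewrite exp_0 in K.
    assert (1 <= 0); [|lra]. apply K.
    - intros i. left; apply gauss_pos.
    - revert HA. apply bsum_mono; [|lra]. intros i. rewrite Cmod_R, Rabs_pos_eq. lra. left; apply gauss_pos. }
intros w s0. destruct (gauss_C2_bounds c Pc) as (B & HB).
assert (cT : contC (periodize (gauss c) (2 * PI * w))) by (eapply periodize_cont; [apply gauss_der|apply gauss1_der|exact HB]).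
assert (cS := dual_series_cont c' w Pc').
destruct (periodize_abs_bsum (gauss c) (gauss1 c) (gauss2 c) B HB (2 * PI * w)) as (A1 & HA1).
destruct (gauss_abs_bsum c' w Pc') as (A2 & HA2).
assert (HA3 : forall s, abs_bsum (fun n : Z => RtoC (gauss c' (w - IZR n)) * expi (2 * PI * IZR n * s))%C A2).
{ intros s. revert HA2. apply bsum_mono; [|lra]. intros n. rewrite Cmod_mult, Cmod_expi; lra. }
set (Sg := fun s => usum (fun n : Z => RtoC (gauss c' (w - IZR n)) * expi (2 * PI * IZR n * s))%C) in *.
set (D := fun s => (periodize (gauss c) (2 * PI * w) s + (- C0) * Sg s)%C).
assert (D0 : D s0 = RtoC 0).
{ apply (fourier_unique D) with (M := A1 + Cmod (- C0)%C * A2).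
  - apply contC_plus; auto. apply contC_mult; auto. apply contC_const.
  - intros m. unfold D.
    transitivity (CI (fun s => periodize (gauss c) (2 * PI * w) s * expi (2 * PI * IZR m * s) + (- C0) * (Sg s * expi (2 * PI * IZR m * s)))%C).
    { apply CI_ext. intros s; ring. }
    assert (ce : contC (fun s => expi (2 * PI * IZR m * s))) by apply contC_expi.
    rewrite CI_plus, CI_scal by contC_tac.
    unfold Sg. rewrite (series_coef _ A2 m HA2 cS).
    (* The extra phase has period 1, so it can be absorbed into the modulation of each term: the
       coefficient of the periodization is a value of [FT]. *)
    assert (E : forall s, (periodize (gauss c) (2 * PI * w) s * expi (2 * PI * IZR m * s))%C = periodize (gauss c) (- 2 * PI * (- (w + IZR m))) s).
    { intros s. unfold periodize. rewrite Cmult_comm, <- (usum_scal _ _ _ (HA1 s)). apply usum_ext. intros k.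
      transitivity (RtoC (gauss c (s - IZR k)) * (expi (2 * PI * IZR m * s) * expi (2 * PI * w * (s - IZR k)) * expi (2 * PI * IZR (- (m * k)))))%C.
      rewrite expi_2PI; ring. rewrite <- !expi_plus. do 2 f_equal. rewrite opp_IZR, mult_IZR. ring. }
    rewrite (CI_ext _ _ E). fold (FT c (- (w + IZR m))). change (CI (periodize (gauss c) (- 2 * PI * (- (w + IZR m))))) with (FT c (- (w + IZR m))).
    rewrite FT_gauss by auto. fold C0 c'. unfold gauss. rewrite opp_IZR.
    replace (- c' * (- (w + IZR m)) ^ 2) with (- c' * (w - - IZR m) ^ 2) by ring. ring.
  - intros t. unfold D. eapply Rle_trans; [apply Cmod_triangle|]. rewrite Cmod_mult.
    apply Rplus_le_compat. apply usum_Cmod; auto. apply Rmult_le_compat_l. apply Cmod_ge_0. apply usum_Cmod; auto.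
  - intros s k. unfold D. rewrite (periodize_shift (gauss c) (gauss1 c) (gauss2 c) B HB). f_equal. f_equal. unfold Sg. apply usum_ext.
    intros n. replace (2 * PI * IZR n * (s + IZR k)) with (2 * PI * IZR n * s + 2 * PI * IZR (n * k)) by (rewrite mult_IZR; ring).
    rewrite expi_plus, expi_2PI. ring. }
unfold D in D0. change (periodize (gauss c) (2 * PI * w) s0 = (C0 * Sg s0)%C).
replace (periodize (gauss c) (2 * PI * w) s0) with ((periodize (gauss c) (2 * PI * w) s0 + - C0 * Sg s0) + C0 * Sg s0)%C by ring.
rewrite D0. ring.
Qed.

(** * The Gaussian rank-one operator *)

Lemma gauss_even c x : gauss c (- x) = gauss c x.
Proof. unfold gauss. f_equal. ring. Qed.

Lemma gauss_sym c x y : gauss c (x - y) = gauss c (y - x).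
Proof. rewrite <- gauss_even. f_equal; ring. Qed.

Lemma gauss_le1 c x : 0 < c -> gauss c x <= 1.
Proof.
intros H. unfold gauss. rewrite <- exp_0. apply exp_le. assert (Q := pow2_ge_0 x). nra.
Qed.

(** Splitting [|k| <= |y| + |k - y|] isolates the growth in [y]; completing the square absorbs the
    exponential in [k - y] into the Gaussian. *)
Lemma gauss_weighted_sum c T : 0 < c -> 0 <= T -> exists A, 0 < A /\ forall y,
  bsum (fun k : Z => exp (T * Rabs (IZR k)) * gauss c (IZR k - y)) (A * exp (T * Rabs y)).
Proof.
intros Pc PT. destruct exp_sum as (M & PM & HM).
set (B := exp ((T + 1) ^ 2 / (4 * c))).
assert (HB : forall u, exp (T * Rabs u) * gauss c u <= B * exp (- Rabs u)).
{ intros u. unfold B, gauss. rewrite <- !exp_plus. apply exp_le.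
  replace (u ^ 2) with (Rabs u ^ 2) by (rewrite pow2_abs; auto). set (v := Rabs u).
  assert (0 <= ((T + 1) - 2 * c * v) ^ 2 / (4 * c)).
  { apply Rmult_le_pos. apply pow2_ge_0. left; apply Rinv_0_lt_compat; lra. }
  replace ((T + 1) ^ 2 / (4 * c) + - v) with (((T + 1) - 2 * c * v) ^ 2 / (4 * c) + (T * v + - c * v ^ 2)).
  lra. field; lra. }
exists (B * M). split; [apply Rmult_lt_0_compat; auto; apply exp_pos|].
intros y. assert (PB : 0 <= B * exp (T * Rabs y)) by (apply Rmult_le_pos; left; apply exp_pos).
generalize (bsum_scal _ _ _ PB (HM y)). apply bsum_mono; [|lra]. intros k.
assert (E : exp (T * Rabs (IZR k)) <= exp (T * Rabs y) * exp (T * Rabs (IZR k - y))).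
{ rewrite <- exp_plus. apply exp_le. rewrite <- Rmult_plus_distr_l. apply Rmult_le_compat_l; auto.
  replace (IZR k) with (y + (IZR k - y)) at 1 by ring. apply Rabs_triang. }
specialize (HB (IZR k - y)). rewrite (Rabs_minus_sym y).
assert (G := gauss_pos c (IZR k - y)). assert (X := exp_pos (T * Rabs y)).
apply Rle_trans with (exp (T * Rabs y) * (exp (T * Rabs (IZR k - y)) * gauss c (IZR k - y))).
rewrite <- Rmult_assoc. apply Rmult_le_compat_r; lra.
replace (B * exp (T * Rabs y) * exp (- Rabs (IZR k - y))) with (exp (T * Rabs y) * (B * exp (- Rabs (IZR k - y)))) by ring.
apply Rmult_le_compat_l; lra.
Qed.

Lemma gauss_bsum c : 0 < c -> exists A, 0 < A /\ forall y, bsum (fun k : Z => gauss c (IZR k - y)) A.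
Proof.
intros Pc. destruct (gauss_weighted_sum c 0 Pc (Rle_refl 0)) as (A & PA & HA). exists A. split; auto. intros y.
specialize (HA y). revert HA. rewrite Rmult_0_l, exp_0, Rmult_1_r. apply bsum_mono; [|lra].
intros k. rewrite Rmult_0_l, exp_0. lra.
Qed.

Lemma Cmod_gauss_mul c x c' y : Cmod (RtoC (gauss c x * gauss c' y)) = gauss c x * gauss c' y.
Proof. rewrite Cmod_R. apply Rabs_pos_eq. left; apply Rmult_lt_0_compat; apply gauss_pos. Qed.

(** The width is adapted to a lattice with sides 1 and 1/2: both indices then enter [E_co] with the
    same width [PI / 4], and both enter [beta_co] with the self-dual width [PI]. *)
Definition gaussian (t : R) : C := RtoC (gauss (PI / 2) t).

(** Up to normalization, the inner product of [tf_shift (x, w) gaussian] with the Gaussian shifted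
    by the adjoint lattice point [(2k, l)]; the phase is evaluated at the midpoint [k + x / 2] of
    the two centres. *)
Definition beta_co (x w : R) (p : I2) : C :=
  (RtoC (gauss PI (IZR (fst p) - x / 2) * gauss PI (IZR (snd p) - w)) *
   expi (2 * PI * (IZR (fst p) + x / 2) * (w - IZR (snd p))))%C.

(** Up to the factor [kap], the inner product of [gaussian] with its shift by [(m, n / 2)]: the
    coefficients of the frame-type operator in the lattice expansion. *)
Definition E_co (kap : C) (p : I2) : C :=
  (kap * RtoC (gauss (PI / 4) (IZR (fst p)) * gauss (PI / 4) (IZR (snd p))) *
   expi (- (PI * IZR (snd p) * IZR (fst p) / 2)))%C.

(** The rate of growth in [(x, w)] matters: at [(m, n / 2)] with [T = 2 * tau] the exponential is
    exactly the weight [tau] of the index [(m, n)]. *)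
Lemma beta_wnorm T : 0 <= T -> exists A, 0 < A /\ forall x w,
  wnorm T (beta_co x w) (A * exp (T * (Rabs (x / 2) + Rabs w))).
Proof.
intros PT. destruct (gauss_weighted_sum PI T PI_RGT_0 PT) as (A & PA & HA).
exists (A * A). split; [apply Rmult_lt_0_compat; auto|]. intros x w.
assert (P : forall y k, 0 <= exp (T * Rabs (IZR k)) * gauss PI (IZR k - y)).
{ intros. apply Rmult_le_pos; left; [apply exp_pos|apply gauss_pos]. }
generalize (bsum_prod _ _ _ _ (P (x / 2)) (P w) (HA (x / 2)) (HA w)). apply bsum_mono.
- intros [k l]. unfold beta_co, weight; cbn [fst snd].
  rewrite Cmod_mult, Cmod_expi, Cmod_gauss_mul.
  rewrite Rmult_plus_distr_l, exp_plus. right; ring.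
- rewrite Rmult_plus_distr_l, exp_plus. right; ring.
Qed.

Lemma E_wnorm kap T : 0 <= T -> exists A, wnorm T (E_co kap) A.
Proof.
intros PT. assert (P4 : 0 < PI / 4) by (assert (X := PI_RGT_0); lra).
destruct (gauss_weighted_sum (PI / 4) T P4 PT) as (A & PA & HA).
specialize (HA 0). rewrite Rabs_R0, Rmult_0_r, exp_0, Rmult_1_r in HA.
assert (P : forall k : Z, 0 <= exp (T * Rabs (IZR k)) * gauss (PI / 4) (IZR k - 0)).
{ intros. apply Rmult_le_pos; left; [apply exp_pos|apply gauss_pos]. }
exists (Cmod kap * (A * A)).
generalize (bsum_scal _ _ _ (Cmod_ge_0 kap) (bsum_prod _ _ _ _ P P HA HA)). apply bsum_mono; [|lra].
intros [k l]. unfold E_co, weight; cbn [fst snd].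
rewrite !Cmod_mult, Cmod_expi, Cmod_gauss_mul.
rewrite !Rminus_0_r, Rmult_plus_distr_l, exp_plus. right; ring.
Qed.

Lemma beta_ok x w : exists M, abs_bsum (beta_co x w) M.
Proof.
destruct (beta_wnorm 0 (Rle_refl 0)) as (A & PA & HA). eexists. eapply wnorm_abs_bsum; [apply Rle_refl|apply HA].
Qed.
Definition beta x w : l1 := mkl1 _ (beta_ok x w).

Lemma E_ok kap : exists M, abs_bsum (E_co kap) M.
Proof.
destruct (E_wnorm kap 0 (Rle_refl 0)) as (A & HA). exists A. eapply wnorm_abs_bsum; [apply Rle_refl|apply HA].
Qed.
Definition E_l1 kap : l1 := mkl1 _ (E_ok kap).

Lemma gaussian_bdd : bdd gaussian 1.
Proof.
split; [lra|]. intros t. unfold gaussian. rewrite Cmod_R, Rabs_pos_eq by (left; apply gauss_pos).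
apply gauss_le1. assert (X := PI_RGT_0); lra.
Qed.

(** Completing the square in [m]. On the right the dependence on [m] is a single Gaussian of width
    [PI], ready for a second Poisson summation, and the adjoint translate of [gaussian] has been
    split off. *)
Lemma exponent_id t x k m :
  gauss (PI / 4) m * gauss PI (t - m / 2 - 2 * k) * gauss (PI / 2) (t - m - x) =
  gauss PI (k - x / 2) * gauss PI (m - (t - k - x / 2)) * gauss (PI / 2) (t - 2 * k).
Proof. unfold gauss. rewrite <- !exp_plus. f_equal. field. Qed.

(* Fundamental identity of Gabor analysis: the rank-one operator [E] with
   Gaussian coefficients maps every shifted Gaussian into the span of [gaussian]
   over the commutative algebra of the adjoint lattice [2Z x Z]. *)
Lemma figa : exists kap : C, forall x w t,
  actA (E_l1 kap) (tf_shift (x, w) gaussian) t = actB (beta x w) gaussian t.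
Proof.
assert (PP := PI_RGT_0).
destruct (poisson_gauss (4 * PI)) as (C1 & N1 & H1); [lra|].
destruct (poisson_gauss PI) as (C2 & N2 & H2); [lra|].
replace (PI ^ 2 / (4 * PI)) with (PI / 4) in H1 by (field; lra).
replace (PI ^ 2 / PI) with PI in H2 by (field; lra).
(* Each Poisson summation brings its constant, one for width [4 PI] and one for [PI]; [kap] cancels
   both. *)
exists (C1 * / C2)%C. intros x w t. set (kap := (C1 * / C2)%C).
destruct (gauss_bsum PI) as (A & PA & HA); [lra|].
destruct (gauss_bsum (PI / 4)) as (A4 & PA4 & HA4); [lra|].
assert (HA2 : forall y, bsum (fun k : Z => gauss PI (y - 2 * IZR k)) A).
{ intros y. generalize (bsum_inj (fun k : Z => (2 * k)%Z) _ _ ltac:(intros ? ? H; cbv beta in H; lia) (HA y)). apply bsum_mono; [|lra].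
  intros k. rewrite mult_IZR, (gauss_sym PI y). lra. }
(* Poisson summation in [n], then in [m] below *)
assert (T1 : forall s, (C1 * usum (fun n : Z => RtoC (gauss (PI / 4) (IZR n)) * expi (PI * IZR n * s)))%C =
   usum (fun k : Z => RtoC (gauss PI (s - 2 * IZR k)))).
{ intros s. specialize (H1 0 (s / 2)). 
  transitivity (C1 * usum (fun n : Z => RtoC (gauss (PI / 4) (0 - IZR n)) * expi (2 * PI * IZR n * (s / 2))))%C.
  - f_equal. apply usum_ext. intros n. rewrite Rminus_0_l, gauss_even. do 2 f_equal. field.
  - rewrite <- H1. apply usum_ext. intros k. replace (2 * PI * 0 * (s / 2 - IZR k)) with 0 by ring.
    rewrite expi_0, Cmult_1_r. f_equal. unfold gauss. f_equal. field. }
(* The double series obtained once the sum over [n] has been replaced by its dual sum over [k]. *)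
set (F := fun p : Z * Z => (RtoC (gauss (PI / 4) (IZR (fst p)) * gauss PI (t - IZR (fst p) / 2 - 2 * IZR (snd p))
    * gauss (PI / 2) (t - IZR (fst p) - x)) * expi (2 * PI * (t - IZR (fst p)) * w))%C).
(* Summability is seen with [k] as the outer index: by [exponent_id] the sum over [m] is bounded
   uniformly in [k], and a Gaussian in [k] is left over. *)
assert (HF : abs_bsum (fun p : Z * Z => F (snd p, fst p)) (A * A)).
{ apply (bsum_mono _ (fun p : Z * Z => (fun k m : Z => gauss PI (IZR k - x / 2) * gauss PI (IZR m - (t - IZR k - x / 2))) (fst p) (snd p)) _ (A * A)); [|lra|].
  - intros [k m]. unfold F; cbn [fst snd]. rewrite exponent_id, Cmod_mult, Cmod_expi, Rmult_1_r, Cmod_R.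
    assert (G1 := gauss_pos PI (IZR k - x / 2)). assert (G2 := gauss_pos PI (IZR m - (t - IZR k - x / 2))).
    assert (G3 := gauss_pos (PI / 2) (t - 2 * IZR k)). assert (G4 := gauss_le1 (PI / 2) (t - 2 * IZR k) ltac:(lra)).
    assert (0 < gauss PI (IZR k - x / 2) * gauss PI (IZR m - (t - IZR k - x / 2))) by (apply Rmult_lt_0_compat; auto).
    rewrite Rabs_pos_eq; nra.
  - apply (bsum_pair (fun k : Z => gauss PI (IZR k - x / 2)) (fun k m : Z => gauss PI (IZR k - x / 2) * gauss PI (IZR m - (t - IZR k - x / 2)))).
    + intros k m. left; apply Rmult_lt_0_compat; apply gauss_pos.
    + intros k. left; apply gauss_pos.
    + intros k. rewrite Rmult_comm. apply bsum_scal; auto. left; apply gauss_pos.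
    + lra.
    + apply HA. }
assert (HF' : abs_bsum F (A * A)).
{ apply abs_bsum_swap in HF. revert HF. apply bsum_mono; [|lra]. intros [m k]; simpl. lra. }
assert (L : actA (E_l1 kap) (tf_shift (x, w) gaussian) t = (kap * / C1 * usum F)%C).
{ destruct (E_wnorm kap 0 (Rle_refl 0)) as (A0 & HA0).
  assert (Hb : bdd (tf_shift (x, w) gaussian) 1) by (apply shift_bdd, gaussian_bdd).
  assert (Ha := act_abs_bsum eA sA eA_mod (E_l1 kap) _ 1 A0 t Hb (wnorm_abs_bsum _ _ _ (Rle_refl 0) HA0)).
  unfold act. rewrite <- (usum_fubini _ _ Ha). rewrite <- (usum_fubini _ _ HF').
  rewrite <- (usum_scal _ _ (A * A)).
  2:{ assert (HR := bsum_usum (fun _ => 1) F (A * A) (fun _ => Rlt_0_1)).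
      cut (bsum (fun i : Z => 1 * Cmod (usum (fun j : Z => F (i, j)))) (A * A)).
      apply bsum_mono; [|lra]. intros; lra. apply HR. revert HF'. apply bsum_mono; [|lra]. intros; lra. }
  apply usum_ext. intros m. unfold F; cbn [fst snd].
  transitivity (kap * / C1 * RtoC (gauss (PI / 4) (IZR m) * gauss (PI / 2) (t - IZR m - x)) * expi (2 * PI * (t - IZR m) * w)
     * usum (fun k : Z => RtoC (gauss PI (t - IZR m / 2 - 2 * IZR k))))%C.
  - rewrite <- T1. rewrite !RtoC_mult.
    transitivity (kap * RtoC (gauss (PI / 4) (IZR m)) * RtoC (gauss (PI / 2) (t - IZR m - x)) * expi (2 * PI * (t - IZR m) * w)
     * usum (fun n : Z => RtoC (gauss (PI / 4) (IZR n)) * expi (PI * IZR n * (t - IZR m / 2))))%C; [|field; auto].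
    rewrite <- (usum_scal _ _ A4).
    2:{ specialize (HA4 0). revert HA4. apply bsum_mono; [|lra]. intros n.
        rewrite Cmod_mult, Cmod_expi, Cmod_R, Rabs_pos_eq, Rminus_0_r by (left; apply gauss_pos). lra. }
    apply usum_ext. intros n. simpl. unfold E_co, eA, sA, tf_shift, gaussian; cbn [fst snd].
    replace (PI * IZR n * (t - IZR m / 2)) with (PI * IZR n * t + - (PI * IZR n * IZR m / 2)) by field.
    rewrite expi_plus, RtoC_mult. ring.
  - rewrite <- (usum_scal _ _ A).
    2:{ generalize (HA2 (t - IZR m / 2)). apply bsum_mono; [|lra]. intros k.
        rewrite Cmod_R, Rabs_pos_eq by (left; apply gauss_pos). lra. }
    rewrite <- (usum_scal _ _ (A * A)).
    2:{ apply (abs_bsum_row F _ m HF'). }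
    apply usum_ext. intros k. rewrite !RtoC_mult. ring. }
rewrite L, <- (usum_swap F _ HF'), <- (usum_fubini _ _ HF).
destruct (beta_wnorm 0 (Rle_refl 0)) as (Ab & PAb & HAb).
assert (Hb := act_abs_bsum eB sB eB_mod (beta x w) _ 1 _ t gaussian_bdd (wnorm_abs_bsum _ _ _ (Rle_refl 0) (HAb x w))).
unfold act. rewrite <- (usum_fubini _ _ Hb).
rewrite <- (usum_scal _ _ (A * A)).
2:{ assert (HR := bsum_usum (fun _ => 1) (fun p : Z * Z => F (snd p, fst p)) (A * A) (fun _ => Rlt_0_1)).
    cut (bsum (fun i : Z => 1 * Cmod (usum (fun j : Z => F (snd (i, j), fst (i, j))))) (A * A)).
    apply bsum_mono; [|lra]. intros; lra. apply HR. revert HF. apply bsum_mono; [|lra]. intros; lra. }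
apply usum_ext. intros k. unfold F; cbn [fst snd].
(* The centre of the Gaussian in [m]; with it the inner sum has the form of the left side of
   [H2]. *)
set (s := t - IZR k - x / 2).
transitivity (kap * / C1 * (RtoC (gauss PI (IZR k - x / 2) * gauss (PI / 2) (t - 2 * IZR k)) * expi (2 * PI * (IZR k + x / 2) * w) *
   usum (fun m : Z => RtoC (gauss PI (s - IZR m)) * expi (2 * PI * w * (s - IZR m)))))%C.
- f_equal. rewrite <- (usum_scal _ _ A).
  2:{ generalize (HA s). apply bsum_mono; [|lra]. intros m.
      rewrite Cmod_mult, Cmod_expi, Cmod_R, Rabs_pos_eq by (left; apply gauss_pos). rewrite (gauss_sym PI (IZR m)). lra. }
  apply usum_ext. intros m. rewrite exponent_id. fold s. rewrite (gauss_sym PI (IZR m) s), !RtoC_mult.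
  replace (2 * PI * (t - IZR m) * w) with (2 * PI * (IZR k + x / 2) * w + 2 * PI * w * (s - IZR m)) by (unfold s; field).
  rewrite expi_plus. ring.
- rewrite H2. unfold kap.
  transitivity (RtoC (gauss PI (IZR k - x / 2) * gauss (PI / 2) (t - 2 * IZR k)) * expi (2 * PI * (IZR k + x / 2) * w) *
     usum (fun n : Z => RtoC (gauss PI (w - IZR n)) * expi (2 * PI * IZR n * s)))%C; [field; auto|].
  rewrite <- (usum_scal _ _ A).
  2:{ generalize (HA w). apply bsum_mono; [|lra]. intros m.
      rewrite Cmod_mult, Cmod_expi, Cmod_R, Rabs_pos_eq by (left; apply gauss_pos). rewrite (gauss_sym PI (IZR m)). lra. }
  apply usum_ext. intros l. simpl. unfold beta_co, eB, sB, gaussian; cbn [fst snd].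
  rewrite !RtoC_mult, (gauss_sym PI w).
  transitivity (RtoC (gauss PI (IZR k - x / 2)) * RtoC (gauss PI (IZR l - w)) * RtoC (gauss (PI / 2) (t - 2 * IZR k)) *
    (expi (2 * PI * (IZR k + x / 2) * w) * expi (2 * PI * IZR l * s)))%C; [ring|].
  transitivity (RtoC (gauss PI (IZR k - x / 2)) * RtoC (gauss PI (IZR l - w)) * RtoC (gauss (PI / 2) (t - 2 * IZR k)) *
    (expi (2 * PI * (IZR k + x / 2) * (w - IZR l)) * expi (2 * PI * IZR l * t)))%C; [|ring].
  f_equal. rewrite <- !expi_plus. f_equal. unfold s. field.
Qed.

(** * Perturbation of the invariant line *)

Lemma pow_small q c eps : 0 <= q < 1 -> 0 <= c -> 0 < eps -> exists n, c * q ^ n <= eps.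
Proof.
intros Hq Hc He.
destruct (pow_lt_1_zero q (Rabs_def1 _ _ (proj2 Hq) ltac:(lra)) (eps / (c + 1))) as (N & HN).
{ apply Rdiv_lt_0_compat; lra. }
exists N. specialize (HN N (Nat.le_refl N)). rewrite Rabs_pos_eq in HN by (apply pow_le; lra).
assert (P : 0 <= q ^ N) by (apply pow_le; lra).
apply Rle_trans with ((c + 1) * (eps / (c + 1))); [|right; field; lra]. nra.
Qed.

Lemma wnorm_limit_0 tau (a : l1) c q : 0 <= tau -> 0 <= q < 1 -> 0 <= c ->
  (forall n, wnorm tau a (c * q ^ n)) -> a = l1_0.
Proof.
intros Ht Hq Hc H. apply (wnorm_zero tau); auto. intros eps He.
destruct (pow_small q c eps Hq Hc He) as (n & Hn). eapply wnorm_mono; [apply Rle_refl|exact Hn|apply H].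
Qed.

(** The Neumann series as the iteration [u (n+1) = 1 - x u n], whose limit solves [y = 1 - x y]. *)
Lemma neumann T (x : l1) q : 0 <= T -> q < 1 -> wnorm T x q ->
  exists y, cmul (l1_add l1_1 x) y = l1_1 /\ wnorm T y (/ (1 - q)).
Proof.
intros HT Hq1 Hx. assert (Hq0 := wnorm_ge0 _ _ _ Hx). assert (Hq : 0 <= q < 1) by lra.
set (u := fix u n := match n with O => l1_0 | S n => l1_sub l1_1 (cmul x (u n)) end).
assert (D : forall n, wnorm T (l1_sub (u (S n)) (u n)) (1 * q ^ n)).
{ induction n as [|n IH].
  - simpl u. replace (l1_sub (l1_sub l1_1 (cmul x l1_0)) l1_0) with l1_1 by ring. simpl. rewrite Rmult_1_l. apply wnorm_1.
  - change (u (S (S n))) with (l1_sub l1_1 (cmul x (u (S n)))). change (u (S n)) with (l1_sub l1_1 (cmul x (u n))) at 2.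
    replace (l1_sub (l1_sub l1_1 (cmul x (u (S n)))) (l1_sub l1_1 (cmul x (u n)))) with
      (l1_opp (cmul x (l1_sub (u (S n)) (u n)))) by ring.
    apply wnorm_opp. replace (1 * q ^ S n) with (q * (1 * q ^ n)) by (simpl; ring). apply cmul_wnorm; auto. }
destruct (l1_complete T u 1 q HT Hq Rle_0_1 D) as (y & Hy).
exists y. split.
- assert (Z : l1_sub (cmul (l1_add l1_1 x) y) l1_1 = l1_0).
  { apply (wnorm_limit_0 T _ (2 / (1 - q)) q); auto. apply Rdiv_le_0_compat; lra.
    intros n.
    replace (l1_sub (cmul (l1_add l1_1 x) y) l1_1) with
      (l1_add (l1_sub y (u (S n))) (cmul x (l1_sub y (u n)))) by (simpl u; ring).
    eapply wnorm_mono; [apply Rle_refl| |apply wnorm_add; [apply Hy|apply cmul_wnorm; [auto|apply Hx|apply Hy]]].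
    simpl. assert (P : 0 <= q ^ n) by (apply pow_le; lra). assert (Pi : 0 < / (1 - q)) by (apply Rinv_0_lt_compat; lra).
    unfold Rdiv. assert (q * q ^ n <= q ^ n) by nra. nra. }
  replace (cmul (l1_add l1_1 x) y) with (l1_add (l1_sub (cmul (l1_add l1_1 x) y) l1_1) l1_1) by ring. rewrite Z. ring.
- specialize (Hy O). simpl u in Hy. replace (l1_sub y l1_0) with y in Hy by ring.
  simpl in Hy. unfold Rdiv in Hy. rewrite !Rmult_1_l in Hy. exact Hy.
Qed.

(** [H g] is a superposition of Gaussians shifted by lattice points, and [figa] gives the image of
    each under [E]; summing the resulting [beta_co] gives the coefficients of [E H g] in B. *)
Definition theta_co (H : I2 -> C) (kp : I2) : C :=
  usum (fun lam => H lam * beta_co (IZR (fst lam)) (IZR (snd lam) / 2) kp)%C.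

(** The growth of [beta_co] at lattice points in weight [2 * tau] equals the weight [tau] of the
    point, so no decay is lost. *)
Lemma theta_bsum tau : 0 <= tau -> exists A, 0 < A /\ forall H M, wnorm tau H M ->
  bsum (fun q : I2 * I2 => weight (2 * tau) (fst q) * Cmod (H (snd q) * beta_co (IZR (fst (snd q))) (IZR (snd (snd q)) / 2) (fst q))%C) (A * M).
Proof.
intros Ht. destruct (beta_wnorm (2 * tau)) as (A & PA & HA); [lra|]. exists A. split; auto. intros H M HM.
assert (K : bsum (fun p : I2 * I2 => (fun lam kp => weight (2 * tau) kp * Cmod (H lam * beta_co (IZR (fst lam)) (IZR (snd lam) / 2) kp)%C) (fst p) (snd p)) (A * M)).
{ apply (bsum_pair (fun lam => weight tau lam * Cmod (H lam)) (fun lam kp => weight (2 * tau) kp * Cmod (H lam * beta_co (IZR (fst lam)) (IZR (snd lam) / 2) kp)%C)); auto.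
  - intros i j. apply Rmult_le_pos; [left; apply weight_pos|apply Cmod_ge_0].
  - intros i. apply Rmult_le_pos; [left; apply weight_pos|apply Cmod_ge_0].
  - intros lam. specialize (HA (IZR (fst lam)) (IZR (snd lam) / 2)).
    assert (E : exp (2 * tau * (Rabs (IZR (fst lam) / 2) + Rabs (IZR (snd lam) / 2))) = weight tau lam).
    { unfold weight. f_equal. unfold Rdiv. rewrite !Rabs_mult, (Rabs_pos_eq (/ 2)) by lra. field. }
    rewrite E in HA. replace (A * (weight tau lam * Cmod (H lam))) with (Cmod (H lam) * (A * weight tau lam)) by ring.
    apply (bsum_scal _ _ _ (Cmod_ge_0 (H lam))) in HA. revert HA. apply bsum_mono; [|lra].
    intros kp. rewrite Cmod_mult. right; ring.
  - lra. }
apply (bsum_inj (fun q : I2 * I2 => (snd q, fst q))) in K; [exact K|].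
intros [a b] [a' b'] E. injection E; intros; congruence.
Qed.

Lemma theta_ok (H : l1) : exists M, abs_bsum (theta_co H) M.
Proof.
destruct (theta_bsum 0 (Rle_refl 0)) as (A & PA & HA). destruct (l1_ok H) as (M & HM).
exists (A * M). apply (wnorm_abs_bsum 0); [lra|].
apply (bsum_usum (weight 0) (fun q : I2 * I2 => H (snd q) * beta_co (IZR (fst (snd q))) (IZR (snd (snd q)) / 2) (fst q))%C).
intros; apply weight_pos. specialize (HA H M (abs_bsum_wnorm _ _ HM)). rewrite Rmult_0_r in HA. exact HA.
Qed.
Definition theta (H : l1) : l1 := mkl1 _ (theta_ok H).

Lemma theta_wnorm tau : 0 <= tau -> exists A, 0 < A /\ forall (H : l1) M, wnorm tau H M -> wnorm (2 * tau) (theta H) (A * M).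
Proof.
intros Ht. destruct (theta_bsum tau Ht) as (A & PA & HA). exists A. split; auto. intros H M HM.
apply (bsum_usum (weight (2 * tau)) (fun q : I2 * I2 => H (snd q) * beta_co (IZR (fst (snd q))) (IZR (snd (snd q)) / 2) (fst q))%C).
intros; apply weight_pos. apply HA; auto.
Qed.

Lemma theta_row (H : l1) kp : exists M, abs_bsum (fun lam => H lam * beta_co (IZR (fst lam)) (IZR (snd lam) / 2) kp)%C M.
Proof.
destruct (theta_bsum 0 (Rle_refl 0)) as (A & PA & HA). destruct (l1_ok H) as (M & HM).
exists (A * M). specialize (HA H M (abs_bsum_wnorm _ _ HM)).
apply (bsum_inj (fun lam => (kp, lam))) in HA; [|intros x y E; congruence].
revert HA. apply bsum_mono; [|lra]. intros lam. simpl. rewrite Rmult_0_r, weight_0. lra.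
Qed.

Lemma theta_add a b : theta (l1_add a b) = l1_add (theta a) (theta b).
Proof.
apply l1_eq; intros kp; simpl. unfold theta_co.
destruct (theta_row a kp) as (M & HM), (theta_row b kp) as (M' & HM').
rewrite <- (usum_plus _ _ _ _ HM HM'). apply usum_ext. intros; simpl; ring.
Qed.

Lemma theta_scal c a : theta (l1_scal c a) = l1_scal c (theta a).
Proof.
apply l1_eq; intros kp; simpl. unfold theta_co.
destruct (theta_row a kp) as (M & HM).
rewrite <- (usum_scal _ _ _ HM). apply usum_ext. intros; simpl; ring.
Qed.

Lemma theta_sub a b : theta (l1_sub a b) = l1_sub (theta a) (theta b).
Proof. unfold l1_sub, l1_opp. rewrite theta_add, theta_scal. auto. Qed.

Lemma theta_1 : theta l1_1 = beta 0 0.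
Proof.
apply l1_eq; intros kp; simpl. unfold theta_co.
transitivity (lsum (fun lam => l1_1 lam * beta_co (IZR (fst lam)) (IZR (snd lam) / 2) kp)%C ((0,0)%Z :: nil)).
- apply usum_unique, is_usum_support. apply NoDup1. intros i Hi. simpl. unfold delta.
  destruct (eqdec i (0,0)%Z). subst; elim Hi; simpl; auto. ring.
- simpl. unfold delta. destruct (eqdec (0,0)%Z (0,0)%Z); [|congruence].
  replace (0 / 2) with 0 by field. ring.
Qed.

Lemma gaussian_bdd_ex : exists M, bdd gaussian M.
Proof. exists 1. apply gaussian_bdd. Qed.

(** The eigenvector property of [E]: both sides are double series, exchanged by Fubini so that
    [figa] applies to each lattice shift separately. *)
Lemma theta_act kap (H : l1) t : (forall x w t, actA (E_l1 kap) (tf_shift (x, w) gaussian) t = actB (beta x w) gaussian t) ->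
  actA (E_l1 kap) (actA H gaussian) t = actB (theta H) gaussian t.
Proof.
intros FG. destruct (l1_ok H) as (M & HM). destruct (E_wnorm kap 0 (Rle_refl 0)) as (A & HA).
apply (wnorm_abs_bsum 0) in HA; [|lra].
set (ph := fun lam : I2 => tf_shift (IZR (fst lam), IZR (snd lam) / 2) gaussian).
assert (Hph : forall lam, bdd (ph lam) 1) by (intros; apply shift_bdd, gaussian_bdd).
assert (Eph : forall lam u, (eA lam u * gaussian (u - sA lam)%R)%C = ph lam u).
{ intros lam u. unfold ph, tf_shift, eA, sA; simpl. do 2 f_equal. field. }
set (F := fun p : I2 * I2 => (E_l1 kap (fst p) * (eA (fst p) t * (H (snd p) * ph (snd p) (t - sA (fst p))%R)))%C).
assert (HF : abs_bsum F (A * M)).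
{ generalize (bsum_prod _ _ _ _ (fun i => Cmod_ge_0 (E_l1 kap i)) (fun i => Cmod_ge_0 (H i)) HA HM). apply bsum_mono; [|lra].
  intros [i j]; unfold F; cbn [fst snd]. rewrite !Cmod_mult, eA_mod, Rmult_1_l.
  destruct (Hph j) as [_ B]. specialize (B (t - sA i)).
  assert (X := Cmod_ge_0 (E_l1 kap i)). assert (Y := Cmod_ge_0 (H j)). assert (0 <= Cmod (E_l1 kap i) * Cmod (H j)) by (apply Rmult_le_pos; auto). nra. }
transitivity (usum F).
{ rewrite <- (usum_fubini _ _ HF). apply usum_ext. intros i. unfold F; cbn [fst snd].
  transitivity (E_l1 kap i * eA i t * actA H gaussian (t - sA i)%R)%C; [ring|].
  unfold act. rewrite <- (usum_scal _ _ (1 * M)). apply usum_ext. intros j. rewrite Eph. ring.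
  apply act_abs_bsum; auto. apply eA_mod. apply gaussian_bdd. }
rewrite <- (usum_swap _ _ HF). apply abs_bsum_swap in HF. rewrite <- (usum_fubini _ _ HF).
destruct (theta_bsum 0 (Rle_refl 0)) as (A2 & PA2 & HA2). specialize (HA2 H M (abs_bsum_wnorm _ _ HM)). rewrite Rmult_0_r in HA2.
set (G := fun q : I2 * I2 => (H (snd q) * beta_co (IZR (fst (snd q))) (IZR (snd (snd q)) / 2) (fst q) * (eB (fst q) t * gaussian (t - sB (fst q))%R))%C).
assert (HG : abs_bsum G (A2 * M)).
{ revert HA2. apply bsum_mono; [|lra]. intros [i j]; unfold G; cbn [fst snd]. rewrite weight_0, Rmult_1_l, !Cmod_mult, eB_mod, Rmult_1_l.
  destruct gaussian_bdd as [_ B]. specialize (B (t - sB i)).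
  assert (X := Cmod_ge_0 (H j)). assert (Y := Cmod_ge_0 (beta_co (IZR (fst j)) (IZR (snd j) / 2) i)).
  assert (0 <= Cmod (H j) * Cmod (beta_co (IZR (fst j)) (IZR (snd j) / 2) i)) by (apply Rmult_le_pos; auto). nra. }
transitivity (usum G).
- rewrite <- (usum_swap _ _ HG). apply abs_bsum_swap in HG. rewrite <- (usum_fubini _ _ HG).
  apply usum_ext. intros lam. unfold F, G; cbn [fst snd].
  transitivity (H lam * actA (E_l1 kap) (ph lam) t)%C.
  + unfold act. rewrite <- (usum_scal _ _ (1 * A)). apply usum_ext; intros; ring.
    apply act_abs_bsum; auto. apply eA_mod.
  + unfold ph. rewrite FG. destruct (l1_ok (beta (IZR (fst lam)) (IZR (snd lam) / 2))) as (Bb & HBb). unfold act.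
    rewrite <- (usum_scal _ _ (1 * Bb)). apply usum_ext; intros; simpl; ring.
    apply act_abs_bsum; auto. apply eB_mod. apply gaussian_bdd.
- rewrite <- (usum_fubini _ _ HG). apply usum_ext. intros kp. unfold G; cbn [fst snd]. simpl.
  unfold theta_co. destruct (theta_row H kp) as (M' & HM').
  transitivity ((eB kp t * gaussian (t - sB kp)%R) * usum (fun lam => H lam * beta_co (IZR (fst lam)) (IZR (snd lam) / 2) kp))%C; [|ring].
  rewrite <- (usum_scal _ _ _ HM'). apply usum_ext; intros; ring.
Qed.

(** Dominated convergence: off a finite list the majorant [m] is small, and on that list pointwise
    convergence suffices. *)
Lemma wnorm_dominated T (a : nat -> I2 -> C) (m : I2 -> R) M :
  bsum (fun i => weight T i * m i) M -> (forall i, 0 <= m i) ->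
  (forall N i, Cmod (a N i) <= m i) ->
  (forall i eps, 0 < eps -> exists N0, forall N, (N0 <= N)%nat -> Cmod (a N i) <= eps) ->
  forall eps, 0 < eps -> exists N0, forall N, (N0 <= N)%nat -> wnorm T (a N) eps.
Proof.
intros HM Pm Hd Hp eps He.
destruct (bsum_tail (fun i => weight T i * m i) M (eps / 2)) as (l0 & Nl0 & H0); auto; try lra.
{ intros i. apply Rmult_le_pos; auto. left; apply weight_pos. }
assert (K : exists N0, forall N, (N0 <= N)%nat -> rsum (fun i => weight T i * Cmod (a N i)) l0 <= eps / 2).
{ clear H0 Nl0. assert (G : forall e, 0 < e -> exists N0, forall N, (N0 <= N)%nat -> rsum (fun i => weight T i * Cmod (a N i)) l0 <= e).
  { induction l0 as [|x l0 IH]; intros e Pe; simpl.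
    - exists O. intros; lra.
    - destruct (IH (e / 2)) as (N1 & H1); [lra|].
      destruct (Hp x (e / 2 / weight T x)) as (N2 & H2). { apply Rdiv_lt_0_compat; [lra|apply weight_pos]. }
      exists (N1 + N2)%nat. intros N HN. specialize (H1 N ltac:(lia)). specialize (H2 N ltac:(lia)).
      assert (W := weight_pos T x). apply (Rmult_le_compat_l (weight T x)) in H2; [|lra].
      replace (weight T x * (e / 2 / weight T x)) with (e / 2) in H2 by (field; lra). lra. }
  apply G; lra. }
destruct K as (N0 & HN0). exists N0. intros N HN. specialize (HN0 N HN).
intros l Nl.
apply Rle_trans with (rsum (fun i => (if in_dec eqdec i l0 then 0 else weight T i * m i) + (if in_dec eqdec i l0 then weight T i * Cmod (a N i) else 0)) l).
- apply rsum_le. intros i. destruct (in_dec eqdec i l0); [lra|]. rewrite Rplus_0_r.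
  apply Rmult_le_compat_l; auto. left; apply weight_pos.
- rewrite rsum_plus. specialize (H0 l Nl).
  assert (rsum (fun i => if in_dec eqdec i l0 then weight T i * Cmod (a N i) else 0) l <= rsum (fun i => weight T i * Cmod (a N i)) l0); [|lra].
  eapply Rle_trans; [|apply (rsum_incl _ (filter (fun i => if in_dec eqdec i l0 then true else false) l) l0)].
  + clear. induction l as [|x l IH]; simpl; [lra|]. destruct (in_dec eqdec x l0); simpl; lra.
  + intros i. apply Rmult_le_pos; [left; apply weight_pos|apply Cmod_ge_0].
  + apply NoDup_filter; auto.
  + intros i Hi. apply filter_In in Hi. destruct Hi as [_ Hi]. destruct (in_dec eqdec i l0); auto; discriminate.
Qed.

(** * Contraction for the correction [k] together with the inverse of [1 + th k] *)

Section FixedPoint.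
Variables (tau T A h0 : R) (th : l1 -> l1) (H0 : l1).
Hypotheses (Ht : 0 <= tau) (HT : 0 <= T) (HA : 1 <= A) (Hh : wnorm tau H0 h0).
Hypothesis th_sub : forall a b, th (l1_sub a b) = l1_sub (th a) (th b).
Hypothesis th_wnorm : forall (a : l1) M, wnorm tau a M -> wnorm T (th a) (A * M).

(* [z] stands for [(1 + th k)^-1]; keeping it as an unknown makes the equations polynomial. *)
Lemma fixed_point (Q : l1 -> l1 -> l1) e kp : 0 < kp -> 4 * A * kp <= 1 -> 0 <= e ->
  (forall a b v, Q (l1_sub a b) v = l1_sub (Q a v) (Q b v)) ->
  (forall a v w, Q a (l1_sub v w) = l1_sub (Q a v) (Q a w)) ->
  (forall (a v : l1) Z V, wnorm T a Z -> wnorm tau v V -> wnorm tau (Q a v) (e * (Z * V))) ->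
  e * (2 * (h0 + 1)) <= kp -> e * (h0 + 1) <= / (16 * A) -> e <= / 8 ->
  exists k z : l1, wnorm tau k (2 * kp) /\ wnorm T z 3 /\
    z = l1_sub l1_1 (cmul (th k) z) /\ k = Q z (l1_add H0 k).
Proof.
intros Pk Ak Pe Qa Qv Qn E1 E2 E3.
assert (Ph := wnorm_ge0 _ _ _ Hh).
(* [z] is updated first and its new value enters the update of [k]; a fixed pair solves both
   equations. *)
set (step := fun p : l1 * l1 => let z := l1_sub l1_1 (cmul (th (fst p)) (snd p)) in (Q z (l1_add H0 (fst p)), z)).
set (u := fix u n := match n with O => (l1_0, l1_1) | S n => step (u n) end).
set (k := fun n => fst (u n)). set (z := fun n => snd (u n)).
assert (zS : forall n, z (S n) = l1_sub l1_1 (cmul (th (k n)) (z n))) by reflexivity.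
assert (kS : forall n, k (S n) = Q (z (S n)) (l1_add H0 (k n))) by reflexivity.
assert (Inv : forall n, wnorm tau (k n) kp /\ wnorm T (z n) 2).
{ induction n as [|n [I1 I2]].
  - split; simpl. eapply wnorm_mono; [apply Rle_refl| |apply wnorm_0]; lra. eapply wnorm_mono; [apply Rle_refl| |apply wnorm_1]; lra.
  - assert (J : wnorm T (z (S n)) 2).
    { rewrite zS. eapply wnorm_mono; [apply Rle_refl| |apply wnorm_sub; [apply wnorm_1|apply cmul_wnorm; [auto|apply th_wnorm, I1|apply I2]]]. nra. }
    split; auto. rewrite kS.
    eapply wnorm_mono; [apply Rle_refl| |apply Qn; [apply J|apply wnorm_add; [apply Hh|apply I1]]].
    assert (kp <= 1) by nra. assert (h0 + kp <= h0 + 1) by lra. 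
    assert (e * (2 * (h0 + kp)) <= e * (2 * (h0 + 1))) by (apply Rmult_le_compat_l; lra). lra. }
assert (Pk1 : kp <= 1) by nra.
assert (kDiff : forall n, wnorm T (l1_sub (z (S n)) (z n)) (1 * (/ 2) ^ n) -> (n = O \/ exists m, n = S m /\ wnorm tau (l1_sub (k (S m)) (k m)) (/ (8 * A) * (/ 2) ^ m)) ->
   wnorm tau (l1_sub (k (S n)) (k n)) (/ (8 * A) * (/ 2) ^ n)).
{ intros n Hz [->|(m & -> & Hm)].
  - rewrite kS. change (k O) with l1_0. replace (l1_sub (Q (z 1%nat) (l1_add H0 l1_0)) l1_0) with (Q (z 1%nat) H0).
    2:{ replace (l1_add H0 l1_0) with H0 by ring. ring. }
    eapply wnorm_mono; [apply Rle_refl| |apply Qn; [apply Inv|apply Hh]].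
    simpl. rewrite Rmult_1_r. assert (E : / (8 * A) = 2 * / (16 * A)) by (field; lra). rewrite E.
    assert (e * h0 <= e * (h0 + 1)) by (apply Rmult_le_compat_l; lra). lra.
  - rewrite (kS (S m)).
    replace (l1_sub (Q (z (S (S m))) (l1_add H0 (k (S m)))) (k (S m))) with
      (l1_add (Q (l1_sub (z (S (S m))) (z (S m))) (l1_add H0 (k (S m)))) (Q (z (S m)) (l1_sub (k (S m)) (k m)))).
    2:{ rewrite Qa. replace (l1_sub (k (S m)) (k m)) with (l1_sub (l1_add H0 (k (S m))) (l1_add H0 (k m))) by ring.
        rewrite (Qv (z (S m))), <- (kS m). ring. }
    eapply wnorm_mono; [apply Rle_refl| |apply wnorm_add; [apply Qn; [apply Hz|apply wnorm_add; [apply Hh|apply Inv]]|apply Qn; [apply Inv|apply Hm]]].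
    set (p := (/ 2) ^ m). assert (Pp : 0 < p) by (apply pow_lt; lra).
    replace ((/ 2) ^ S m) with (/ 2 * p) by reflexivity.
    assert (Ai : 0 < / (8 * A)) by (apply Rinv_0_lt_compat; lra).
    assert (E : / (16 * A) = / 2 * / (8 * A)) by (field; lra). rewrite E in E2.
    assert (X1 : e * (h0 + kp) <= / 2 * / (8 * A)).
    { eapply Rle_trans; [apply Rmult_le_compat_l; [auto|]|apply E2]. lra. }
    assert (X2 : e * / (8 * A) <= / 8 * / (8 * A)) by (apply Rmult_le_compat_r; lra).
    set (B := / (8 * A)) in *.
    replace (e * (1 * (/ 2 * p) * (h0 + kp)) + e * (2 * (B * p))) with (/ 2 * p * (e * (h0 + kp)) + 2 * p * (e * B)) by ring.
    apply Rle_trans with (/ 2 * p * (/ 2 * B) + 2 * p * (/ 8 * B)).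
    apply Rplus_le_compat; apply Rmult_le_compat_l; lra.
    right; field. }
(* The factor [/ (8 * A)] balances the two increments: the change of [k] moves [z] by at most 1/4 of
   the current rate, and the bound [A * kp <= 1/4] contributes another 1/4, which adds up to the
   ratio 1/2. *)
assert (D : forall n, wnorm T (l1_sub (z (S n)) (z n)) (1 * (/ 2) ^ n) /\ wnorm tau (l1_sub (k (S n)) (k n)) (/ (8 * A) * (/ 2) ^ n)).
{ induction n as [|n [IZ IK]].
  - assert (Z0 : wnorm T (l1_sub (z 1%nat) (z O)) (1 * (/ 2) ^ 0)).
    { rewrite zS. change (z O) with l1_1. change (k O) with l1_0.
      assert (T0 : th l1_0 = l1_0). { replace l1_0 with (l1_sub l1_0 l1_0) at 1 by ring. rewrite th_sub. ring. }
      rewrite T0. replace (l1_sub (l1_sub l1_1 (cmul l1_0 l1_1)) l1_1) with l1_0 by ring.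
      eapply wnorm_mono; [apply Rle_refl| |apply wnorm_0]. simpl; lra. }
    split; auto.
  - assert (Z1 : wnorm T (l1_sub (z (S (S n))) (z (S n))) (1 * (/ 2) ^ S n)).
    { rewrite (zS (S n)). rewrite (zS n) at 2.
      replace (l1_sub (l1_sub l1_1 (cmul (th (k (S n))) (z (S n)))) (l1_sub l1_1 (cmul (th (k n)) (z n)))) with
        (l1_opp (l1_add (cmul (th (l1_sub (k (S n)) (k n))) (z (S n))) (cmul (th (k n)) (l1_sub (z (S n)) (z n))))).
      2:{ rewrite th_sub. ring. }
      apply wnorm_opp.
      eapply wnorm_mono; [apply Rle_refl| |apply wnorm_add; apply cmul_wnorm; auto; [apply th_wnorm, IK|apply Inv|apply th_wnorm, Inv|apply IZ]].
      set (p := (/ 2) ^ n). assert (Pp : 0 < p) by (apply pow_lt; lra).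
      replace ((/ 2) ^ S n) with (/ 2 * p) by reflexivity.
      replace (A * (/ (8 * A) * p) * 2) with (p / 4) by (field; lra). nra. }
    split; auto. apply kDiff; auto. right. exists n; auto. }
assert (Hhalf : 0 <= / 2 < 1) by lra.
assert (PA : 0 <= / (8 * A)) by (left; apply Rinv_0_lt_compat; lra).
destruct (l1_complete T z 1 (/ 2) HT Hhalf Rle_0_1 (fun n => proj1 (D n))) as (zz & Hz).
destruct (l1_complete tau k (/ (8 * A)) (/ 2) Ht Hhalf PA (fun n => proj2 (D n))) as (kk & Hk).
exists kk, zz.
assert (Hz' : forall n, wnorm T (l1_sub zz (z n)) (2 * (/ 2) ^ n)).
{ intros n. eapply wnorm_mono; [apply Rle_refl| |apply Hz]. right; field. }
assert (Hk' : forall n, wnorm tau (l1_sub kk (k n)) (1 * (/ 2) ^ n)).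
{ intros n. eapply wnorm_mono; [apply Rle_refl| |apply Hk]. assert (0 < (/ 2) ^ n) by (apply pow_lt; lra).
  assert (/ (8 * A) <= / 8) by (apply Rinv_le_contravar; lra). replace (1 - / 2) with (/ 2) by field.
  unfold Rdiv. rewrite Rinv_inv. nra. }
assert (Bk : wnorm tau kk (2 * kp)).
{ destruct (pow_small (/ 2) 1 kp Hhalf Rle_0_1 Pk) as (n & Hn).
  replace kk with (l1_add (l1_sub kk (k n)) (k n)) by ring.
  eapply wnorm_mono; [apply Rle_refl| |apply wnorm_add; [apply Hk'|apply Inv]]. lra. }
assert (Bz : wnorm T zz 3).
{ specialize (Hz' O). change (z O) with l1_1 in Hz'. replace zz with (l1_add (l1_sub zz l1_1) l1_1) by ring.
  eapply wnorm_mono; [apply Rle_refl| |apply wnorm_add; [apply Hz'|apply wnorm_1]]. simpl; lra. }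
split; auto. split; auto. split.
- assert (E : l1_sub zz (l1_sub l1_1 (cmul (th kk) zz)) = l1_0).
  { apply (wnorm_limit_0 T _ (3 * A + 3) (/ 2)); auto; try lra. intros n.
    replace (l1_sub zz (l1_sub l1_1 (cmul (th kk) zz))) with
      (l1_add (l1_sub zz (z (S n))) (l1_add (cmul (th (l1_sub kk (k n))) zz) (cmul (th (k n)) (l1_sub zz (z n))))).
    2:{ rewrite zS, th_sub. ring. }
    eapply wnorm_mono; [apply Rle_refl| |apply wnorm_add; [apply Hz'|apply wnorm_add; [apply cmul_wnorm; [exact HT|apply th_wnorm, Hk'|apply Bz]|apply cmul_wnorm; [exact HT|apply th_wnorm, Inv|apply Hz']]]].
    set (p := (/ 2) ^ n). assert (Pp : 0 < p) by (apply pow_lt; lra).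
    replace ((/ 2) ^ S n) with (/ 2 * p) by reflexivity. nra. }
  replace zz with (l1_add (l1_sub zz (l1_sub l1_1 (cmul (th kk) zz))) (l1_sub l1_1 (cmul (th kk) zz))) at 1 by ring.
  rewrite E. ring.
- assert (E : l1_sub kk (Q zz (l1_add H0 kk)) = l1_0).
  { apply (wnorm_limit_0 tau _ (2 + h0 + 5) (/ 2)); auto; try lra. intros n.
    replace (l1_sub kk (Q zz (l1_add H0 kk))) with
      (l1_sub (l1_sub kk (k (S n))) (l1_add (Q (l1_sub zz (z (S n))) (l1_add H0 kk)) (Q (z (S n)) (l1_sub kk (k n))))).
    2:{ rewrite Qa. replace (l1_sub kk (k n)) with (l1_sub (l1_add H0 kk) (l1_add H0 (k n))) by ring.
        rewrite (Qv (z (S n))), <- (kS n). ring. }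
    eapply wnorm_mono; [apply Rle_refl| |apply wnorm_sub; [apply Hk'|apply wnorm_add; [apply Qn; [apply Hz'|apply wnorm_add; [apply Hh|apply Bk]]|apply Qn; [apply Inv|apply Hk']]]].
    set (p := (/ 2) ^ n). assert (Pp : 0 < p) by (apply pow_lt; lra).
    replace ((/ 2) ^ S n) with (/ 2 * p) by reflexivity.
    assert (X : e * (2 * (/ 2 * p) * (h0 + 2 * kp)) <= 1 * (p * (h0 + 2))).
    { apply Rmult_le_compat; try lra. apply Rmult_le_pos; [lra|]. lra.
      replace (2 * (/ 2 * p)) with p by field. apply Rmult_le_compat_l; lra. }
    assert (Y : e * (2 * (1 * p)) <= 1 * (2 * p)) by (apply Rmult_le_compat; lra). nra. }
  replace kk with (l1_add (l1_sub kk (Q zz (l1_add H0 kk))) (Q zz (l1_add H0 kk))) at 1 by ring.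
  rewrite E. ring.
Qed.

End FixedPoint.

(** * The cohomological equation *)

(* Infinite descent: [(k, l) -> (n l - s k, k - s l)]. *)
Lemma nonsquare_descent n s : (0 < s)%Z -> (s * s < n)%Z -> (n < (s + 1) * (s + 1))%Z ->
  forall k l, (k * k = n * (l * l))%Z -> l = 0%Z.
Proof.
intros Ps H1 H2.
assert (K : forall m : nat, forall k l, (0 <= k)%Z -> (0 <= l < Z.of_nat m)%Z -> (k * k = n * (l * l))%Z -> l = 0%Z).
{ induction m as [|m IH]; intros k l Hk Hl E; [lia|].
  destruct (Z.eq_dec l 0) as [|N]; auto. exfalso.
  assert (A : (s * l < k)%Z) by nia.
  assert (B : (k < (s + 1) * l)%Z) by nia.
  assert (C : (k - s * l = 0)%Z).
  { apply (IH (n * l - s * k)%Z).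
    - assert (s * k < s * ((s + 1) * l))%Z by nia. nia.
    - nia.
    - nia. }
  nia. }
intros k l E.
assert (Z.abs l = 0)%Z; [|lia].
apply (K (S (Z.to_nat (Z.abs l))) (Z.abs k)); [lia|lia|].
rewrite <- !Z.abs_mul, !Z.abs_eq; nia.
Qed.

Lemma sqrt_lin_indep n s (Ps : (0 < s)%Z) (H1 : (s * s < n)%Z) (H2 : (n < (s + 1) * (s + 1))%Z) k l :
  IZR k + sqrt (IZR n) * IZR l = 0 -> k = 0%Z /\ l = 0%Z.
Proof.
intros E. assert (Pn : 0 <= IZR n) by (apply IZR_le; nia).
assert (S := sqrt_sqrt _ Pn).
assert (L : l = 0%Z).
{ apply (nonsquare_descent n s Ps H1 H2 k). apply eq_IZR. rewrite !mult_IZR.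
  replace (IZR k) with (- (sqrt (IZR n) * IZR l)) by lra. rewrite <- S at 3. ring. }
subst l. rewrite Rmult_0_r, Rplus_0_r in E. apply eq_IZR in E. auto.
Qed.

(* A derivation of [l1]; irrationality of [sqrt 2] makes the constants its only kernel. *)
Definition dsymb (p : I2) : R := IZR (fst p) + sqrt 2 * IZR (snd p).
(** A relation and not a map, because multiplication by the unbounded symbol [dsymb] may leave
    [l1]. *)
Definition deriv_of (a a' : l1) : Prop := forall p, a' p = (RtoC (dsymb p) * a p)%C.
Definition l1_cst (c : C) : l1 := l1_scal c l1_1.

Lemma dsymb_nonzero p : p <> (0, 0)%Z -> dsymb p <> 0.
Proof.
intros N E. apply N. destruct p as [k l]. unfold dsymb in E; cbn [fst snd] in E.
destruct (sqrt_lin_indep 2 1 ltac:(lia) ltac:(lia) ltac:(lia) k l E) as [-> ->]; auto.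
Qed.

Lemma scal_l1_cst c a : l1_scal c a = cmul (l1_cst c) a.
Proof. unfold l1_cst, cmul. rewrite gmul_scal_l, gmul_1_l; auto. Qed.

Lemma scal_scal c c' a : l1_scal c (l1_scal c' a) = l1_scal (c * c')%C a.
Proof. apply l1_eq; intros p; simpl; ring. Qed.

Lemma deriv_of_add a a' b b' : deriv_of a a' -> deriv_of b b' -> deriv_of (l1_add a b) (l1_add a' b').
Proof. intros H H' p. simpl. rewrite H, H'. ring. Qed.

Lemma deriv_of_scal c a a' : deriv_of a a' -> deriv_of (l1_scal c a) (l1_scal c a').
Proof. intros H p. simpl. rewrite H. ring. Qed.

Lemma deriv_of_opp a a' : deriv_of a a' -> deriv_of (l1_opp a) (l1_opp a').
Proof. apply deriv_of_scal. Qed.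

Lemma deriv_of_modulate th a a' : deriv_of a a' -> deriv_of (modulate th a) (modulate th a').
Proof. intros H p. simpl. rewrite H. ring. Qed.

Lemma deriv_of_1 : deriv_of l1_1 l1_0.
Proof.
intros p. simpl. unfold delta. destruct (eqdec p (0,0)%Z) as [->|]; [|ring].
unfold dsymb; cbn [fst snd]. rewrite Rmult_0_r, Rplus_0_r. ring.
Qed.

Lemma deriv_of_mul a a' b b' : deriv_of a a' -> deriv_of b b' -> deriv_of (cmul a b) (l1_add (cmul a' b) (cmul a b')).
Proof.
intros H H' p. simpl. unfold conv.
destruct (conv_row _ one_tw_mod a b p) as [M HM], (conv_row _ one_tw_mod a' b p) as [M1 HM1], (conv_row _ one_tw_mod a b' p) as [M2 HM2].
rewrite <- (usum_scal _ _ _ HM), <- (usum_plus _ _ _ _ HM1 HM2). apply usum_ext. intros mu.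
unfold one_tw. rewrite H, H'. replace (dsymb p) with (dsymb mu + dsymb (zsub p mu)).
rewrite RtoC_plus. ring.
unfold dsymb, zsub; cbn [fst snd]. rewrite !minus_IZR. ring.
Qed.

Lemma deriv_of_eq a a' b : deriv_of a a' -> a' = b -> deriv_of a b.
Proof. intros H <-; auto. Qed.

(** This replaces power series identities between exponential and logarithm: an expression is shown
    to be constant by differentiating it. The price is that its constant value stays unknown and
    must be shown nonzero separately. *)
Lemma deriv_of_ker a : deriv_of a l1_0 -> a = l1_cst (a (0, 0)%Z).
Proof.
intros H. apply l1_eq. intros p. simpl. unfold delta. destruct (eqdec p (0,0)%Z) as [->|N]; [ring|].
rewrite Cmult_0_r. specialize (H p). simpl in H. symmetry in H.
assert (Nd : RtoC (dsymb p) <> RtoC 0). { intros E. apply RtoC_inj in E. apply (dsymb_nonzero p); auto. }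
transitivity (/ RtoC (dsymb p) * (RtoC (dsymb p) * a p))%C; [field; auto|]. rewrite H. ring.
Qed.

Lemma deriv_of_lim (u u' : nat -> l1) a a' T c c' q : 0 <= T -> 0 <= q < 1 -> 0 <= c -> 0 <= c' ->
  (forall n, deriv_of (u n) (u' n)) -> (forall n, wnorm T (l1_sub a (u n)) (c * q ^ n)) ->
  (forall n, wnorm T (l1_sub a' (u' n)) (c' * q ^ n)) -> deriv_of a a'.
Proof.
intros HT Hq Pc Pc' HD H1 H2 p.
assert (Z : (a' p - RtoC (dsymb p) * a p)%C = RtoC 0).
{ apply Cmod_small_0. intros eps He.
  destruct (pow_small q (c' + Rabs (dsymb p) * c) eps Hq) as (n & Hn); auto.
  { assert (Q := Rabs_pos (dsymb p)). assert (0 <= Rabs (dsymb p) * c) by (apply Rmult_le_pos; auto). lra. }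
  eapply Rle_trans; [|exact Hn].
  assert (K1 := wnorm_term T _ _ p HT (H1 n)). assert (K2 := wnorm_term T _ _ p HT (H2 n)). simpl in K1, K2.
  replace (a' p - RtoC (dsymb p) * a p)%C with ((a' p + -1 * u' n p) + - (RtoC (dsymb p) * (a p + -1 * u n p)))%C.
  2:{ rewrite (HD n p). ring. }
  eapply Rle_trans; [apply Cmod_triangle|]. rewrite Cmod_opp, Cmod_mult, Cmod_R.
  apply (Rmult_le_compat_l (Rabs (dsymb p))) in K1; [|apply Rabs_pos]. lra. }
replace (a' p) with ((a' p - RtoC (dsymb p) * a p) + RtoC (dsymb p) * a p)%C by ring. rewrite Z. ring.
Qed.

(** Passing to a smaller weight pays for the symbol: [|dsymb p|] is at most twice the size of [p],
    and the size times [T - T'] is below the ratio of the weights. *)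
Lemma deriv_of_ex T T' : 0 <= T' < T -> exists K, 0 < K /\ forall (a : l1) M, wnorm T a M ->
  exists a', deriv_of a a' /\ wnorm T' a' (K * M).
Proof.
intros HT. exists (2 / (T - T')). split; [apply Rdiv_lt_0_compat; lra|]. intros a M Ha.
assert (N : wnorm T' (fun p => RtoC (dsymb p) * a p)%C (2 / (T - T') * M)).
{ assert (P : 0 <= 2 / (T - T')) by (apply Rdiv_le_0_compat; lra).
  generalize (bsum_scal _ _ _ P Ha). apply bsum_mono; [|lra]. intros p.
  rewrite Cmod_mult, Cmod_R, <- !Rmult_assoc. apply Rmult_le_compat_r. apply Cmod_ge_0.
  unfold weight. set (y := Rabs (IZR (fst p)) + Rabs (IZR (snd p))).
  assert (Py : Rabs (dsymb p) <= 2 * y).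
  { unfold dsymb, y. eapply Rle_trans; [apply Rabs_triang|]. rewrite Rabs_mult.
    assert (0 <= sqrt 2) by apply sqrt_pos. assert (sqrt 2 * sqrt 2 = 2) by (apply sqrt_sqrt; lra).
    rewrite (Rabs_pos_eq (sqrt 2)) by auto. assert (sqrt 2 <= 2) by nra.
    assert (Q1 := Rabs_pos (IZR (fst p))). assert (Q2 := Rabs_pos (IZR (snd p))).
    assert (sqrt 2 * Rabs (IZR (snd p)) <= 2 * Rabs (IZR (snd p))) by (apply Rmult_le_compat_r; auto). lra. }
  replace (T * y) with (T' * y + (T - T') * y) by ring. rewrite exp_plus.
  assert (E := exp_ineq1_le ((T - T') * y)).
  assert (Py0 : 0 <= y). { unfold y. assert (Q1 := Rabs_pos (IZR (fst p))). assert (Q2 := Rabs_pos (IZR (snd p))). lra. }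
  assert (X := exp_pos (T' * y)).
  apply Rle_trans with (exp (T' * y) * (2 * y)). apply Rmult_le_compat_l; lra.
  replace (2 / (T - T') * (exp (T' * y) * exp ((T - T') * y))) with (exp (T' * y) * (2 * (exp ((T - T') * y) / (T - T')))) by (field; lra).
  apply Rmult_le_compat_l; [lra|]. apply Rmult_le_compat_l; [lra|].
  apply Rle_div_r; lra. }
exists (l1_of T' _ (conj (proj1 HT) (ex_intro _ _ N))). split; [|exact N]. intros p. reflexivity.
Qed.

(** * Logarithm and exponential in the commutative algebra *)

Fixpoint l1_pow (x : l1) (n : nat) : l1 := match n with O => l1_1 | S n => cmul x (l1_pow x n) end.

Lemma l1_pow_wnorm T (x : l1) q n : 0 <= T -> wnorm T x q -> wnorm T (l1_pow x n) (q ^ n).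
Proof. intros HT Hx. induction n as [|n IH]; simpl. apply wnorm_1. apply cmul_wnorm; auto. Qed.

Lemma l1_pow_deriv_of x x' n : deriv_of x x' -> deriv_of (l1_pow x (S n)) (l1_scal (INR (S n)) (cmul (l1_pow x n) x')).
Proof.
intros H. induction n as [|n IH].
- apply (deriv_of_eq _ _ _ (deriv_of_mul _ _ _ _ H deriv_of_1)). simpl l1_pow.
  assert (E : forall a, l1_scal (INR 1) a = a) by (intros; apply l1_eq; intros; simpl; ring).
  rewrite E. ring.
- apply (deriv_of_eq _ _ _ (deriv_of_mul _ _ _ _ H IH)).
  assert (E : forall a b, l1_add a (cmul b (l1_scal (INR (S n)) (cmul (l1_pow x n) x'))) = l1_add a (l1_scal (INR (S n)) (cmul b (cmul (l1_pow x n) x')))).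
  { intros. unfold cmul. rewrite !gmul_scal_r. auto. }
  rewrite E. change (l1_pow x (S n)) with (cmul x (l1_pow x n)).
  replace (cmul x' (cmul x (l1_pow x n))) with (cmul (cmul x (l1_pow x n)) x') by ring.
  replace (cmul x (cmul (l1_pow x n) x')) with (cmul (cmul x (l1_pow x n)) x') by ring.
  apply l1_eq. intros p. rewrite (S_INR (S n)). simpl co. rewrite RtoC_plus. ring.
Qed.

(** [L] is the series of [log (1 + x)]. The only trace of its being a logarithm is the derivative
    [S], with [(1 + x) S = x']. *)
Lemma log_ex T (x x' : l1) q M : 0 <= T -> q <= / 2 -> wnorm T x q -> deriv_of x x' -> wnorm 0 x' M ->
  exists L S : l1, wnorm T L (2 * q) /\ deriv_of L S /\ cmul (l1_add l1_1 x) S = x'.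
Proof.
intros HT Hq Hx HD Hx'. assert (Pq := wnorm_ge0 _ _ _ Hx). assert (PM := wnorm_ge0 _ _ _ Hx').
assert (Hx0 : wnorm 0 x q) by (eapply wnorm_mono; [exact HT|apply Rle_refl|exact Hx]).
set (cf := fun n : nat => RtoC ((-1) ^ n / INR (S n))).
set (L := fix L n := match n with O => l1_0 | S n => l1_add (L n) (l1_scal (cf n) (l1_pow x (S n))) end).
set (S' := fix S' n := match n with O => l1_0 | S n => l1_add (S' n) (l1_scal (RtoC ((-1) ^ n)) (cmul (l1_pow x n) x')) end).
assert (Hh : 0 <= / 2 < 1) by lra.
assert (P1 : forall n, Rabs ((-1) ^ n) = 1).
{ intros n. rewrite <- RPow_abs. replace (Rabs (-1)) with 1 by (unfold Rabs; destruct Rcase_abs; lra). apply pow1. }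
assert (qn : forall n, q ^ n <= (/ 2) ^ n) by (intros; apply pow_incr; lra).
assert (D1 : forall n, wnorm T (l1_sub (L (S n)) (L n)) (q * (/ 2) ^ n)).
{ intros n. simpl L. replace (l1_sub (l1_add (L n) (l1_scal (cf n) (cmul x (l1_pow x n)))) (L n)) with (l1_scal (cf n) (cmul x (l1_pow x n))) by ring.
  eapply wnorm_mono; [apply Rle_refl| |apply wnorm_scal; apply (l1_pow_wnorm T x q (S n)); auto].
  unfold cf. rewrite Cmod_R. unfold Rdiv. rewrite Rabs_mult, P1, Rmult_1_l, Rabs_inv, (Rabs_pos_eq (INR (S n))) by apply pos_INR.
  assert (1 <= INR (S n)). { rewrite S_INR. assert (K := pos_INR n). lra. }
  assert (/ INR (S n) <= 1). { rewrite <- Rinv_1. apply Rinv_le_contravar; lra. }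
  simpl. assert (0 <= q ^ n) by (apply pow_le; lra). specialize (qn n).
  assert (0 <= q * q ^ n) by (apply Rmult_le_pos; auto).
  apply Rle_trans with (1 * (q * q ^ n)). apply Rmult_le_compat_r; auto. nra. }
assert (D2 : forall n, wnorm 0 (l1_sub (S' (S n)) (S' n)) (M * (/ 2) ^ n)).
{ intros n. simpl S'. replace (l1_sub (l1_add (S' n) (l1_scal (RtoC ((-1) ^ n)) (cmul (l1_pow x n) x'))) (S' n)) with (l1_scal (RtoC ((-1) ^ n)) (cmul (l1_pow x n) x')) by ring.
  eapply wnorm_mono; [apply Rle_refl| |apply wnorm_scal; apply cmul_wnorm; [lra|apply l1_pow_wnorm; [lra|apply Hx0]|apply Hx']].
  rewrite Cmod_R, P1. specialize (qn n). nra. }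
destruct (l1_complete T L q (/ 2) HT Hh Pq D1) as (Li & HL).
destruct (l1_complete 0 S' M (/ 2) (Rle_refl 0) Hh PM D2) as (Si & HS).
assert (HL' : forall n, wnorm T (l1_sub Li (L n)) (2 * q * (/ 2) ^ n)).
{ intros n. eapply wnorm_mono; [apply Rle_refl| |apply HL]. right; field. }
assert (HS' : forall n, wnorm 0 (l1_sub Si (S' n)) (2 * M * (/ 2) ^ n)).
{ intros n. eapply wnorm_mono; [apply Rle_refl| |apply HS]. right; field. }
exists Li, Si. split; [|split].
- specialize (HL' O). change (L O) with l1_0 in HL'. replace (l1_sub Li l1_0) with Li in HL' by ring.
  rewrite Rmult_1_r in HL'. exact HL'.
- apply (deriv_of_lim L S' _ _ 0 (2 * q) (2 * M) (/ 2)); auto; try lra.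
  + intros n. induction n as [|n IH].
    * intros p. simpl. ring.
    * simpl L; simpl S'. apply deriv_of_add; auto.
      apply (deriv_of_eq _ _ _ (deriv_of_scal (cf n) _ _ (l1_pow_deriv_of x x' n HD))).
      rewrite scal_scal. unfold cf. rewrite <- RtoC_mult. do 2 f_equal. field. apply not_0_INR; lia.
  + intros n. eapply wnorm_mono; [exact HT|apply Rle_refl|apply HL'].
(* The geometric sum for [x' / (1 + x)] telescopes after multiplication by [1 + x]. *)
- assert (Tel : forall n, cmul (l1_add l1_1 x) (S' n) = l1_sub x' (l1_scal (RtoC ((-1) ^ n)) (cmul (l1_pow x n) x'))).
  { induction n as [|n IH].
    - simpl. assert (E : forall a, l1_scal 1 a = a) by (intros; apply l1_eq; intros; simpl; ring). rewrite E. ring.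
    - simpl S'. assert (E : forall a b, cmul a (l1_add (S' n) b) = l1_add (cmul a (S' n)) (cmul a b)) by (intros; ring).
      rewrite E, IH. rewrite !scal_l1_cst.
      assert (Ek : l1_cst (RtoC ((-1) ^ S n)) = l1_opp (l1_cst (RtoC ((-1) ^ n)))).
      { apply l1_eq. intros p. simpl. rewrite RtoC_mult. ring. }
      rewrite Ek. simpl l1_pow. ring. }
  assert (Z : l1_sub (cmul (l1_add l1_1 x) Si) x' = l1_0).
  { apply (wnorm_limit_0 0 _ ((1 + q) * (2 * M) + M) (/ 2)); try lra. nra.
    intros n. replace (l1_sub (cmul (l1_add l1_1 x) Si) x') with
      (l1_add (cmul (l1_add l1_1 x) (l1_sub Si (S' n))) (l1_sub (cmul (l1_add l1_1 x) (S' n)) x')) by ring.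
    rewrite Tel. replace (l1_sub (l1_sub x' (l1_scal (RtoC ((-1) ^ n)) (cmul (l1_pow x n) x'))) x') with (l1_opp (l1_scal (RtoC ((-1) ^ n)) (cmul (l1_pow x n) x'))) by ring.
    eapply wnorm_mono; [apply Rle_refl| |apply wnorm_add; [apply cmul_wnorm; [lra|apply wnorm_add; [apply wnorm_1|apply Hx0]|apply HS']|apply wnorm_opp, wnorm_scal, cmul_wnorm; [lra|apply l1_pow_wnorm; [lra|apply Hx0]|apply Hx']]].
    rewrite Cmod_R, P1. specialize (qn n). nra. }
  replace (cmul (l1_add l1_1 x) Si) with (l1_add (l1_sub (cmul (l1_add l1_1 x) Si) x') x') by ring. rewrite Z. ring.
Qed.

(** [y] is the exponential series of [x], characterized by its logarithmic derivative; the bound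
    [/ 3] is the geometric sum of the powers of 1/4 from the first on. *)
Lemma exp_ex T (x x' : l1) q M : 0 <= T -> q <= / 4 -> wnorm T x q -> deriv_of x x' -> wnorm 0 x' M ->
  exists y : l1, wnorm T (l1_sub y l1_1) (/ 3) /\ deriv_of y (cmul y x').
Proof.
intros HT Hq Hx HD Hx'. assert (Pq := wnorm_ge0 _ _ _ Hx). assert (PM := wnorm_ge0 _ _ _ Hx').
set (cf := fun n : nat => RtoC (/ INR (fact n))).
set (t := fun n => l1_scal (cf n) (l1_pow x n)).
set (u := fix u n := match n with O => l1_1 | S n => l1_add (u n) (t (S n)) end).
assert (tD : forall n, deriv_of (t (S n)) (cmul (t n) x')).
{ intros n. unfold t. apply (deriv_of_eq _ _ _ (deriv_of_scal (cf (S n)) _ _ (l1_pow_deriv_of x x' n HD))).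
  rewrite scal_scal. unfold cmul at 2. rewrite gmul_scal_l. fold cmul. unfold cf.
  rewrite <- RtoC_mult. do 2 f_equal.
  change (fact (S n)) with (S n * fact n)%nat. rewrite mult_INR. field. split; [apply INR_fact_neq_0|apply not_0_INR; lia]. }
assert (uD : forall n, deriv_of (u (S n)) (cmul (u n) x')).
{ induction n as [|n IH].
  - simpl u. apply (deriv_of_eq _ _ _ (deriv_of_add _ _ _ _ deriv_of_1 (tD O))).
    assert (E : t O = l1_1). { apply l1_eq. intros p. simpl. unfold cf. simpl. rewrite Rinv_1. ring. }
    rewrite E. ring.
  - change (u (S (S n))) with (l1_add (u (S n)) (t (S (S n)))). apply (deriv_of_eq _ _ _ (deriv_of_add _ _ _ _ IH (tD (S n)))).
    change (u (S n)) with (l1_add (u n) (t (S n))). ring. }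
assert (Hh : 0 <= / 4 < 1) by lra.
assert (D1 : forall n, wnorm T (l1_sub (u (S n)) (u n)) (/ 4 * (/ 4) ^ n)).
{ intros n. change (u (S n)) with (l1_add (u n) (t (S n))). replace (l1_sub (l1_add (u n) (t (S n))) (u n)) with (t (S n)) by ring.
  unfold t. eapply wnorm_mono; [apply Rle_refl| |apply wnorm_scal, l1_pow_wnorm; [auto|apply Hx]].
  unfold cf. rewrite Cmod_R, Rabs_inv, (Rabs_pos_eq (INR _)) by apply pos_INR.
  assert (1 <= INR (fact (S n))). { apply (le_INR 1). assert (K := lt_O_fact (S n)). lia. }
  assert (/ INR (fact (S n)) <= 1). { rewrite <- Rinv_1. apply Rinv_le_contravar; lra. }
  assert (0 < / INR (fact (S n))) by (apply Rinv_0_lt_compat; lra).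
  assert (q ^ (S n) <= (/ 4) ^ (S n)) by (apply pow_incr; lra). assert (0 <= q ^ S n) by (apply pow_le; lra).
  change (/ 4 * (/ 4) ^ n) with ((/ 4) ^ S n). nra. }
destruct (l1_complete T u (/ 4) (/ 4) HT Hh (proj1 Hh) D1) as (y & Hy).
assert (Hy' : forall n, wnorm T (l1_sub y (u n)) (/ 3 * (/ 4) ^ n)).
{ intros n. eapply wnorm_mono; [apply Rle_refl| |apply Hy]. right; field. }
exists y. split.
- specialize (Hy' O). rewrite Rmult_1_r in Hy'. exact Hy'.
- apply (deriv_of_lim (fun n => u (S n)) (fun n => cmul (u n) x') _ _ 0 (/ 3) (/ 3 * M) (/ 4)); auto; try lra.
  + intros n. eapply wnorm_mono; [exact HT| |apply Hy']. simpl. assert (0 <= (/ 4) ^ n) by (apply pow_le; lra). lra.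
  + intros n. replace (l1_sub (cmul y x') (cmul (u n) x')) with (cmul (l1_sub y (u n)) x') by ring.
    replace (/ 3 * M * (/ 4) ^ n) with (/ 3 * (/ 4) ^ n * M) by ring.
    apply cmul_wnorm; [lra| |apply Hx']. eapply wnorm_mono; [exact HT|apply Rle_refl|apply Hy'].
Qed.

Lemma modulate_cmul th a b : (forall i j, th (zadd i j) = th i + th j) -> modulate th (cmul a b) = cmul (modulate th a) (modulate th b).
Proof.
intros H. apply l1_eq. intros p. simpl. unfold conv; simpl.
destruct (conv_row _ one_tw_mod a b p) as [M HM].
rewrite Cmult_comm, <- (usum_scal _ _ _ HM). apply usum_ext. intros mu.
rewrite <- (zadd_sub p mu) at 1. rewrite H, expi_plus. ring.
Qed.

(** The coefficient at the origin of [a] is within [q] of 1. *)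
Lemma near_1_const (a : l1) c q : a = l1_cst c -> wnorm 0 (l1_sub a l1_1) q -> q < 1 -> c <> RtoC 0.
Proof.
intros -> H Hq Z. assert (K := wnorm_term 0 _ _ (0,0)%Z (Rle_refl 0) H). subst c. simpl in K. unfold delta in K.
destruct (eqdec (0,0)%Z (0,0)%Z); [|congruence].
replace (0 * 1 + -1 * 1)%C with (RtoC (-1)) in K by ring.
rewrite Cmod_R in K. replace (Rabs (-1)) with 1 in K by (unfold Rabs; destruct Rcase_abs; lra). lra.
Qed.

(* The multiplicative cohomological equation [psi gauss_series = c (psi o rotation)], solved by taking logarithms. *)
Lemma cohomological (th : I2 -> R) T T' cd : 0 < T' < T -> 0 < cd ->
  (forall i j, th (zadd i j) = th i + th j) ->
  (forall p, p <> (0, 0)%Z -> cd * exp (- ((T - T') * (Rabs (IZR (fst p)) + Rabs (IZR (snd p))))) <= Cmod (1 - expi (th p))%C) ->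
  exists kp, 0 < kp /\ forall eta : l1, wnorm T eta kp ->
    exists (psi psi' : l1) (c1 c2 c3 : C), (exists M, wnorm T' psi M) /\ c1 <> RtoC 0 /\ c2 <> RtoC 0 /\ c3 <> RtoC 0 /\
      cmul psi' psi = l1_cst c3 /\ l1_scal c1 (cmul psi (l1_add l1_1 eta)) = l1_scal c2 (modulate th psi).
Proof.
intros HT Pcd Hth SD.
(* The bound [cd / 8] makes the divided logarithm at most 1/4, as the exponential requires: the
   logarithm costs a factor 2 and the divisors a factor [/ cd]. The bound 1/16 keeps the final
   constant away from 0. *)
set (kp := Rmin (/ 16) (cd / 8)).
assert (Pk : 0 < kp) by (apply Rmin_pos; lra).
assert (K16 : kp <= / 16) by apply Rmin_l. assert (Kcd : kp <= cd / 8) by apply Rmin_r.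
exists kp. split; auto. intros eta He.
destruct (deriv_of_ex T 0 ltac:(lra)) as (Q1 & PQ1 & HQ1). destruct (HQ1 eta kp He) as (eta' & De & Ne).
destruct (log_ex T eta eta' kp _ ltac:(lra) ltac:(lra) He De Ne) as (L & S & NL & DL & ES).
(* Coefficientwise solution of [lam - (lam o rotation) = - L] away from the origin. The mean of [L]
   cannot be removed; it survives as the ratio of the constants in the conclusion. *)
set (lam_co := fun p : I2 => if eqdec p (0,0)%Z then RtoC 0 else (- L p / (1 - expi (th p)))%C).
assert (SD0 : forall p, p <> (0,0)%Z -> (1 - expi (th p))%C <> RtoC 0).
{ intros p Np E. specialize (SD p Np). rewrite E, Cmod_0 in SD.
  assert (X := exp_pos (- ((T - T') * (Rabs (IZR (fst p)) + Rabs (IZR (snd p)))))). nra. }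
assert (Nlam : wnorm T' lam_co (/ 4)).
{ assert (Pi : 0 <= / cd) by (left; apply Rinv_0_lt_compat; auto).
  generalize (bsum_scal _ _ _ Pi NL). apply bsum_mono.
  - intros p. unfold lam_co. destruct (eqdec p (0,0)%Z) as [E|Np].
    + rewrite Cmod_0, Rmult_0_r. apply Rmult_le_pos; auto. apply Rmult_le_pos; [left; apply weight_pos|apply Cmod_ge_0].
    + rewrite Cmod_div by auto. rewrite Cmod_opp. specialize (SD p Np).
      unfold weight. set (y := Rabs (IZR (fst p)) + Rabs (IZR (snd p))) in *.
      assert (X := exp_pos (- ((T - T') * y))). assert (Px : 0 < cd * exp (- ((T - T') * y))) by (apply Rmult_lt_0_compat; auto).
      assert (Y := Cmod_ge_0 (L p)).
      apply Rle_trans with (exp (T' * y) * (Cmod (L p) / (cd * exp (- ((T - T') * y))))).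
      * apply Rmult_le_compat_l; [left; apply exp_pos|]. apply Rmult_le_compat_l; auto. apply Rinv_le_contravar; auto.
      * right. replace (T * y) with (T' * y + (T - T') * y) by ring. rewrite exp_plus, exp_Ropp.
        field. split; [lra|apply Rgt_not_eq, exp_pos].
  - apply Rmult_le_reg_l with cd; auto. rewrite <- Rmult_assoc, Rinv_r by lra. lra. }
assert (HT0 : 0 <= T') by lra.
set (lam := l1_of T' lam_co (conj HT0 (ex_intro _ _ Nlam))).
assert (Nl : wnorm T' lam (/ 4)) by exact Nlam.
destruct (deriv_of_ex T' 0 ltac:(lra)) as (Q2 & PQ2 & HQ2). destruct (HQ2 lam _ Nl) as (lam' & Dl & Nl').
(* [lam + L - lam o rotation] is constant; differentiated: *)
assert (Coh : l1_sub (l1_add lam' S) (modulate th lam') = l1_0).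
{ apply l1_eq. intros p. simpl. rewrite (Dl p), (DL p). simpl. unfold lam_co.
  destruct (eqdec p (0,0)%Z) as [->|Np].
  - unfold dsymb; cbn [fst snd]. rewrite Rmult_0_r, Rplus_0_r. ring.
  - specialize (SD0 p Np). field. auto. }
destruct (exp_ex T' lam lam' (/ 4) _ HT0 (Rle_refl _) Nl Dl Nl') as (psi & N1 & D1).
destruct (exp_ex T' (l1_opp lam) (l1_opp lam') (/ 4) _ HT0 (Rle_refl _) (wnorm_opp _ _ _ Nl) (deriv_of_opp _ _ Dl) (wnorm_opp _ _ _ Nl')) as (psi' & N2 & D2).
assert (N1' : wnorm 0 (l1_sub psi l1_1) (/ 3)) by (eapply wnorm_mono; [|apply Rle_refl|exact N1]; lra).
assert (N2' : wnorm 0 (l1_sub psi' l1_1) (/ 3)) by (eapply wnorm_mono; [|apply Rle_refl|exact N2]; lra).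
assert (K1 : cmul psi' psi = l1_cst (cmul psi' psi (0,0)%Z)).
{ apply deriv_of_ker. apply (deriv_of_eq _ _ _ (deriv_of_mul _ _ _ _ D2 D1)). ring. }
set (c3 := cmul psi' psi (0,0)%Z) in *.
assert (P3 : c3 <> RtoC 0).
{ apply (near_1_const _ _ (/ 3 + (/ 3 + / 3 * / 3)) K1); [|lra].
  replace (l1_sub (cmul psi' psi) l1_1) with (l1_add (l1_sub psi' l1_1) (l1_add (l1_sub psi l1_1) (cmul (l1_sub psi' l1_1) (l1_sub psi l1_1)))) by ring.
  repeat apply wnorm_add; auto. apply cmul_wnorm; auto; lra. }
set (a := modulate th psi). set (a' := modulate th psi').
assert (Da' : deriv_of a' (l1_opp (cmul a' (modulate th lam')))).
{ apply (deriv_of_eq _ _ _ (deriv_of_modulate th _ _ D2)). rewrite modulate_cmul by auto. fold a'.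
  assert (E : modulate th (l1_opp lam') = l1_opp (modulate th lam')) by (apply l1_eq; intros; simpl; ring). rewrite E. ring. }
assert (E3 : cmul a' a = l1_cst c3).
{ unfold a, a'. rewrite <- modulate_cmul by auto. rewrite K1. apply l1_eq. intros p. simpl. unfold delta.
  destruct (eqdec p (0,0)%Z) as [->|]; [|ring]. assert (Z0 : th (0,0)%Z = 0).
  { assert (Y := Hth (0,0)%Z (0,0)%Z). change (zadd (0,0)%Z (0,0)%Z) with (0,0)%Z in Y. lra. }
  rewrite Z0, expi_0. ring. }
(* Up to a constant, [a'] is the inverse of [psi] rotated, so [rho] is the quotient to be shown
   constant; its logarithmic derivative is the expression in [Coh]. *)
set (rho := cmul (cmul psi (l1_add l1_1 eta)) a').
assert (K2 : rho = l1_cst (rho (0,0)%Z)).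
{ apply deriv_of_ker. unfold rho. apply (deriv_of_eq _ _ _ (deriv_of_mul _ _ _ _ (deriv_of_mul _ _ _ _ D1 (deriv_of_add _ _ _ _ deriv_of_1 De)) Da')).
  rewrite <- ES. set (W := l1_add l1_1 eta).
  transitivity (cmul (cmul (cmul psi W) a') (l1_sub (l1_add lam' S) (modulate th lam'))); [ring|]. rewrite Coh. ring. }
set (c2 := rho (0,0)%Z) in *.
assert (Na' : wnorm 0 (l1_sub a' l1_1) (/ 3)).
{ assert (E : l1_sub a' l1_1 = modulate th (l1_sub psi' l1_1)).
  { apply l1_eq. intros p. simpl. unfold delta. destruct (eqdec p (0,0)%Z) as [->|]; [|ring].
    assert (Z0 : th (0,0)%Z = 0). { assert (Y := Hth (0,0)%Z (0,0)%Z). change (zadd (0,0)%Z (0,0)%Z) with (0,0)%Z in Y. lra. }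
    rewrite Z0, expi_0. ring. }
  rewrite E. apply modulate_wnorm. auto. }
assert (Ne0 : wnorm 0 eta (/ 16)) by (eapply wnorm_mono; [| |exact He]; lra).
assert (P2 : c2 <> RtoC 0).
(* The factors of [rho] give [|rho - 1| <= (4/3)(17/16)(4/3) - 1 = 8/9 < 1]. *)
{ set (x := l1_sub psi l1_1) in *. set (y := l1_sub a' l1_1) in *.
  apply (near_1_const _ _ ((/ 3 + (/ 16 + / 3 * / 16)) + (/ 3 + (/ 3 + (/ 16 + / 3 * / 16)) * / 3)) K2); [|lra].
  replace (l1_sub rho l1_1) with (l1_add (l1_add x (l1_add eta (cmul x eta))) (l1_add y (cmul (l1_add x (l1_add eta (cmul x eta))) y)))
    by (unfold rho, x, y; ring).
  assert (Nx : wnorm 0 (l1_add x (l1_add eta (cmul x eta))) (/ 3 + (/ 16 + / 3 * / 16))).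
  { repeat apply wnorm_add; auto. apply cmul_wnorm; auto; lra. }
  apply wnorm_add; auto. apply wnorm_add; auto. apply cmul_wnorm; auto; lra. }
(* Multiplying [rho = c2] by the rotated [psi] turns [a' a] into [c3], which therefore is the left
   factor [c1] as well. *)
exists psi, psi', c3, c2, c3. repeat split; auto.
- exists (/ 3 + 1). replace psi with (l1_add (l1_sub psi l1_1) l1_1) by ring. apply wnorm_add; auto. apply wnorm_1.
- fold a. rewrite !scal_l1_cst, <- K2, <- E3. unfold rho. ring.
Qed.

(** * Schwartz regularity *)

Lemma norm_Cmod (z : C) : norm (K := R_AbsRing) (V := C_R_NormedModule) z = Cmod z.
Proof.
unfold norm; simpl. unfold prod_norm, Cmod. f_equal. unfold norm; simpl. unfold abs; simpl.
change (Rabs (fst z) ^ 2 + Rabs (snd z) ^ 2 = fst z ^ 2 + snd z ^ 2). rewrite !pow2_abs. auto.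
Qed.

Lemma taylor1_is_derive f t d M : taylor1 f t d M -> is_derive (V := C_R_NormedModule) f t d.
Proof.
intros H. split; [apply is_linear_scal_l|].
intros x Hx. assert (E : x = t) by (symmetry; apply (is_filter_lim_locally_unique t x Hx)). subst x.
intros eps. set (e := Rmin 1 (eps / (Rabs M + 1))).
assert (Q := Rabs_pos M). assert (Pe : 0 < eps) by apply cond_pos.
assert (P : 0 < e) by (apply Rmin_pos; [lra|apply Rdiv_lt_0_compat; lra]).
exists (mkposreal _ P). intros y Hy. unfold ball in Hy; simpl in Hy. unfold AbsRing_ball, abs, minus, plus, opp in Hy; simpl in Hy.
set (h := y - t). change (Rabs h < e) in Hy.
assert (H1 : Rabs h <= 1) by (eapply Rle_trans; [left; exact Hy|apply Rmin_l]).
assert (H2 : Rabs h < eps / (Rabs M + 1)) by (eapply Rlt_le_trans; [exact Hy|apply Rmin_r]).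
specialize (H h H1). assert (Eh : (t + h)%R = y) by (unfold h; apply Rplus_minus). rewrite Eh in H.
change (norm (K := R_AbsRing) (V := R_NormedModule) (minus y t)) with (Rabs h).
rewrite norm_Cmod.
replace (Cmod _) with (Cmod (f y - f t - RtoC h * d)%C).
2:{ f_equal. apply injective_projections; simpl; unfold h; unfold minus, plus, opp, scal, mult; simpl; unfold mult; simpl; ring. }
eapply Rle_trans; [exact H|]. rewrite <- (pow2_abs h).
assert (Ph := Rabs_pos h). assert (M <= Rabs M) by apply Rle_abs.
assert (Rabs h * (Rabs M + 1) <= eps). { apply Rlt_div_r in H2; lra. }
simpl. rewrite Rmult_1_r. assert (M * Rabs h <= eps) by nra.
replace (M * (Rabs h * Rabs h)) with ((M * Rabs h) * Rabs h) by ring. apply Rmult_le_compat_r; auto.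
Qed.

Lemma taylor1_scal c f t d M : taylor1 f t d M -> taylor1 (fun x => c * f x)%C t (c * d)%C (Cmod c * M).
Proof.
intros H h Hh. replace (c * f (t + h)%R - c * f t - RtoC h * (c * d))%C with (c * (f (t + h)%R - f t - RtoC h * d))%C by ring.
rewrite Cmod_mult, Rmult_assoc. apply Rmult_le_compat_l. apply Cmod_ge_0. auto.
Qed.

Definition l1size (i : I2) : R := Rabs (IZR (fst i)) + Rabs (IZR (snd i)).

Lemma l1size_pos i : 0 <= l1size i.
Proof. unfold l1size. assert (A := Rabs_pos (IZR (fst i))). assert (B := Rabs_pos (IZR (snd i))). lra. Qed.

(** The exponential rate is left unspecified, because each polynomial factor produced by
    differentiation is absorbed by lowering it. *)
Definition decays (h : I2 -> C) : Prop := exists tau M, 0 < tau /\ wnorm tau h M.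

Lemma poly_exp tau j : 0 < tau -> exists K, 0 < K /\ forall y, 0 <= y -> (1 + y) ^ j <= K * exp (tau * y).
Proof.
intros Ht. set (J := INR j + 1). assert (PJ : 1 <= J) by (unfold J; assert (K := pos_INR j); lra).
set (k := 1 + J / tau). assert (PJt : 0 < J / tau) by (apply Rdiv_lt_0_compat; lra).
exists (k ^ j). split; [apply pow_lt; unfold k; lra|]. intros y Hy.
assert (A : 1 + y <= k * exp (tau * y / J)).
{ assert (E := exp_ineq1_le (tau * y / J)). assert (Z : 0 <= tau * y / J) by (apply Rdiv_le_0_compat; nra).
  apply Rle_trans with (k * (1 + tau * y / J)); [|apply Rmult_le_compat_l; unfold k; lra].
  unfold k. replace ((1 + J / tau) * (1 + tau * y / J)) with (1 + tau * y / J + J / tau + y) by (field; lra). lra. }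
apply Rle_trans with ((k * exp (tau * y / J)) ^ j). apply pow_incr; lra.
rewrite Rpow_mult_distr, exp_pow. apply Rmult_le_compat_l. apply pow_le; unfold k; lra. apply exp_le.
replace (tau * y) with (J * (tau * y / J)) at 2 by (field; lra).
apply Rmult_le_compat_r. apply Rdiv_le_0_compat; nra. unfold J; lra.
Qed.

Lemma decays_poly h j : decays h -> exists M, bsum (fun i => Cmod (h i) * (1 + l1size i) ^ j) M.
Proof.
intros (tau & M & Ht & H). destruct (poly_exp tau j Ht) as (K & PK & HK).
exists (K * M). generalize (bsum_scal K _ _ (Rlt_le _ _ PK) H). apply bsum_mono; [|lra]. intros i.
specialize (HK (l1size i) (l1size_pos i)). unfold weight. fold (l1size i). assert (Q := Cmod_ge_0 (h i)).
replace (K * (exp (tau * l1size i) * Cmod (h i))) with (Cmod (h i) * (K * exp (tau * l1size i))) by ring.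
apply Rmult_le_compat_l; auto.
Qed.

Lemma decays_mul h (c : I2 -> C) K : (forall i, Cmod (c i) <= K * (1 + l1size i)) -> decays h -> decays (fun i => c i * h i)%C.
Proof.
intros Hc (tau & M & Ht & H). destruct (poly_exp (tau / 2) 1) as (k & Pk & Hk); [lra|].
assert (PK : 0 <= K). { specialize (Hc (0,0)%Z). assert (Q := Cmod_ge_0 (c (0,0)%Z)). unfold l1size in Hc; cbn [fst snd] in Hc.
  rewrite !Rabs_R0 in Hc. lra. }
exists (tau / 2), (K * k * M). split; [lra|].
assert (P : 0 <= K * k) by (apply Rmult_le_pos; lra).
generalize (bsum_scal _ _ _ P H). apply bsum_mono; [|lra]. intros i. unfold weight. fold (l1size i).
specialize (Hk (l1size i) (l1size_pos i)). rewrite pow_1 in Hk. specialize (Hc i).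
replace (tau * l1size i) with (tau / 2 * l1size i + tau / 2 * l1size i) by field. rewrite exp_plus, Cmod_mult.
set (e := exp (tau / 2 * l1size i)) in *. assert (Pe : 0 < e) by apply exp_pos. assert (Q := Cmod_ge_0 (h i)).
assert (B : Cmod (c i) <= K * (k * e)). { eapply Rle_trans; [exact Hc|]. apply Rmult_le_compat_l; auto. }
replace (e * (Cmod (c i) * Cmod (h i))) with (Cmod (c i) * (e * Cmod (h i))) by ring.
replace (K * k * (e * e * Cmod (h i))) with (K * (k * e) * (e * Cmod (h i))) by ring.
apply Rmult_le_compat_r; auto. apply Rmult_le_pos; lra.
Qed.

Definition half_pi : R := PI / 2.
Lemma half_pi_pos : 0 < half_pi.
Proof. unfold half_pi. assert (P := PI_RGT_0). lra. Qed.

Definition hgauss (p : nat) (x : R) : R := x ^ p * gauss half_pi x.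
(** For [p = 0] the truncated [pred p] is harmless, since its coefficient [INR p] vanishes. *)
Definition hgauss1 (p : nat) (x : R) : R := INR p * hgauss (pred p) x + - (2 * half_pi) * hgauss (S p) x.
Definition hgauss2 (p : nat) (x : R) : R := INR p * hgauss1 (pred p) x + - (2 * half_pi) * hgauss1 (S p) x.

Lemma hgauss_der p x : is_derive (hgauss p) x (hgauss1 p x).
Proof.
unfold hgauss1, hgauss, gauss. auto_derive; auto. cbn [pow]. ring.
Qed.

Lemma hgauss1_der p x : is_derive (hgauss1 p) x (hgauss2 p x).
Proof.
unfold hgauss2. apply (is_derive_plus (V := R_NormedModule) (fun x => INR p * hgauss (pred p) x) (fun x => - (2 * half_pi) * hgauss (S p) x)).
- apply (is_derive_scal (hgauss (pred p))). apply hgauss_der.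
- apply (is_derive_scal (hgauss (S p))). apply hgauss_der.
Qed.

Lemma hgauss_bound p k : exists B, forall x, (1 + Rabs x) ^ k * Rabs (hgauss p x) <= B.
Proof.
destruct (gauss_dom half_pi (k + p) half_pi_pos) as (M & PM & HM). exists M. intros x. specialize (HM x).
unfold hgauss. rewrite Rabs_mult, (Rabs_pos_eq (gauss half_pi x)), <- RPow_abs by (left; apply gauss_pos).
assert (Q := Rabs_pos x). assert (G := gauss_pos half_pi x). fold (gauss half_pi x) in HM.
apply Rle_trans with ((1 + Rabs x) ^ (k + p) * gauss half_pi x).
- rewrite pow_add, Rmult_assoc. apply Rmult_le_compat_l. apply pow_le; lra. apply Rmult_le_compat_r; [lra|].
  apply pow_incr; lra.
- eapply Rle_trans; [exact HM|]. assert (exp (- Rabs x) <= 1). { rewrite <- exp_0. apply exp_le; lra. } nra.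
Qed.

Lemma hgauss_bound0 p : exists B, forall x, Rabs (hgauss p x) <= B.
Proof. destruct (hgauss_bound p 0) as (B & H). exists B. intros x. specialize (H x). rewrite pow_O, Rmult_1_l in H. auto. Qed.

Lemma hgauss1_bound p : exists B, forall x, Rabs (hgauss1 p x) <= B.
Proof.
destruct (hgauss_bound0 (pred p)) as (B1 & H1), (hgauss_bound0 (S p)) as (B2 & H2).
exists (INR p * B1 + 2 * half_pi * B2). intros x. unfold hgauss1. eapply Rle_trans; [apply Rabs_triang|].
assert (P := half_pi_pos). assert (Q := pos_INR p).
rewrite (Rabs_mult (INR p)), (Rabs_mult (- _)), Rabs_Ropp, (Rabs_pos_eq (INR p)), (Rabs_pos_eq (2 * half_pi)) by lra.
apply Rplus_le_compat; apply Rmult_le_compat_l; auto; lra.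
Qed.

Lemma hgauss2_bound p : exists B, forall x, Rabs (hgauss2 p x) <= B.
Proof.
destruct (hgauss1_bound (pred p)) as (B1 & H1), (hgauss1_bound (S p)) as (B2 & H2).
exists (INR p * B1 + 2 * half_pi * B2). intros x. unfold hgauss2. eapply Rle_trans; [apply Rabs_triang|].
assert (P := half_pi_pos). assert (Q := pos_INR p).
rewrite (Rabs_mult (INR p)), (Rabs_mult (- _)), Rabs_Ropp, (Rabs_pos_eq (INR p)), (Rabs_pos_eq (2 * half_pi)) by lra.
apply Rplus_le_compat; apply Rmult_le_compat_l; auto; lra.
Qed.

(** Derivatives of a lattice series of Gaussians are again such series with polynomial prefactors;
    [p] is the degree of the prefactor. *)
Definition gauss_series (p : nat) (h : I2 -> C) (t : R) : C :=
  usum (fun i => h i * (RtoC (hgauss p (t - IZR (fst i))) * expi (PI * IZR (snd i) * t)))%C.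

Lemma gauss_series_abs_bsum p h k : decays h -> exists M, forall t,
  abs_bsum (fun i => RtoC (Rabs t ^ k) * (h i * (RtoC (hgauss p (t - IZR (fst i))) * expi (PI * IZR (snd i) * t))))%C M.
Proof.
intros Hh. destruct (hgauss_bound p k) as (B & HB). destruct (decays_poly h k Hh) as (M & HM).
assert (PB : 0 <= B). { specialize (HB 0). assert (X := Rabs_pos (hgauss p 0)). assert (0 <= (1 + Rabs 0) ^ k) by (apply pow_le; assert (Y := Rabs_pos 0); lra). nra. }
exists (B * M). intros t. generalize (bsum_scal B _ _ PB HM). apply bsum_mono; [|lra]. intros i.
rewrite !Cmod_mult, Cmod_expi, !Cmod_R, Rmult_1_r, (Rabs_pos_eq (Rabs t ^ k)) by (apply pow_le, Rabs_pos).
set (x := t - IZR (fst i)). specialize (HB x).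
assert (T : Rabs t ^ k <= (1 + Rabs x) ^ k * (1 + l1size i) ^ k).
{ rewrite <- Rpow_mult_distr. apply pow_incr. split; [apply Rabs_pos|].
  assert (A : Rabs t <= Rabs x + Rabs (IZR (fst i))). { replace t with (x + IZR (fst i)) at 1 by (unfold x; ring). apply Rabs_triang. }
  unfold l1size. assert (X1 := Rabs_pos x). assert (X2 := Rabs_pos (IZR (fst i))). assert (X3 := Rabs_pos (IZR (snd i))). nra. }
assert (Q := Cmod_ge_0 (h i)). assert (Q2 := Rabs_pos (hgauss p x)).
assert (P1 : 0 <= (1 + l1size i) ^ k) by (apply pow_le; assert (Y := l1size_pos i); lra).
apply Rle_trans with ((1 + Rabs x) ^ k * (1 + l1size i) ^ k * (Cmod (h i) * Rabs (hgauss p x))).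
- apply Rmult_le_compat_r; auto. apply Rmult_le_pos; auto.
- replace ((1 + Rabs x) ^ k * (1 + l1size i) ^ k * (Cmod (h i) * Rabs (hgauss p x))) with ((1 + Rabs x) ^ k * Rabs (hgauss p x) * (Cmod (h i) * (1 + l1size i) ^ k)) by ring.
  apply Rmult_le_compat_r; auto. apply Rmult_le_pos; auto.
Qed.

Lemma gauss_series_abs_bsum0 p h : decays h -> exists M, forall t,
  abs_bsum (fun i => h i * (RtoC (hgauss p (t - IZR (fst i))) * expi (PI * IZR (snd i) * t)))%C M.
Proof.
intros Hh. destruct (gauss_series_abs_bsum p h 0 Hh) as (M & HM). exists M. intros t. generalize (HM t).
apply bsum_mono; [|lra]. intros i. rewrite (Cmod_mult (RtoC (Rabs t ^ 0))). simpl. rewrite Cmod_1. lra.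
Qed.

Lemma gauss_series_bound p h k : decays h -> exists M, forall t, Rabs t ^ k * Cmod (gauss_series p h t) <= M.
Proof.
intros Hh. destruct (gauss_series_abs_bsum p h k Hh) as (M & HM). destruct (gauss_series_abs_bsum0 p h Hh) as (M0 & HM0). exists M. intros t.
assert (K := usum_Cmod _ _ (HM t)). rewrite (usum_scal _ _ _ (HM0 t)) in K. fold (gauss_series p h t) in K.
rewrite Cmod_mult, Cmod_R, Rabs_pos_eq in K by (apply pow_le, Rabs_pos). exact K.
Qed.

Definition nmul (h : I2 -> C) (i : I2) : C := (Ci * RtoC (PI * IZR (snd i)) * h i)%C.

Lemma decays_nmul h : decays h -> decays (nmul h).
Proof.
apply (decays_mul h (fun i => Ci * RtoC (PI * IZR (snd i)))%C PI). intros i.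
assert (P := PI_RGT_0). rewrite Cmod_mult, Cmod_Ci, Cmod_R, Rabs_mult, (Rabs_pos_eq PI), Rmult_1_l by lra.
apply Rmult_le_compat_l; [lra|]. unfold l1size. assert (X := Rabs_pos (IZR (fst i))). lra.
Qed.

Lemma decays_scal c h : decays h -> decays (fun i => c * h i)%C.
Proof.
apply (decays_mul h (fun _ => c) (Cmod c)). intros i. assert (X := l1size_pos i). assert (Y := Cmod_ge_0 c). nra.
Qed.

Lemma gauss_series_scal c p h t : decays h -> gauss_series p (fun i => c * h i)%C t = (c * gauss_series p h t)%C.
Proof.
intros Hh. destruct (gauss_series_abs_bsum0 p h Hh) as (M & HM). unfold gauss_series. rewrite <- (usum_scal _ _ _ (HM t)).
apply usum_ext; intros; ring.
Qed.

Lemma gauss_series_taylor1 p h t : decays h -> exists M,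
  taylor1 (gauss_series p h) t (RtoC (INR p) * gauss_series (pred p) h t + (RtoC (- (2 * half_pi)) * gauss_series (S p) h t + gauss_series p (nmul h) t))%C M.
Proof.
intros Hh.
destruct (hgauss_bound0 p) as (B0 & HB0), (hgauss1_bound p) as (B1 & HB1), (hgauss2_bound p) as (B2 & HB2).
set (B := Rmax B0 (Rmax B1 B2)).
assert (PP := PI_RGT_0).
destruct (decays_poly h 2 Hh) as (M & HM).
set (K := 2 * (B * (1 + PI) ^ 2)).
assert (PB : 0 <= B). { unfold B. eapply Rle_trans; [|apply Rmax_l]. specialize (HB0 0). assert (X := Rabs_pos (hgauss p 0)). lra. }
assert (PK : 0 <= K). { unfold K. assert (X := pow2_ge_0 (1 + PI)). apply Rmult_le_pos; [lra|]. apply Rmult_le_pos; auto. }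
destruct (gauss_series_abs_bsum0 (pred p) h Hh) as (M1 & HM1), (gauss_series_abs_bsum0 (S p) h Hh) as (M2 & HM2), (gauss_series_abs_bsum0 p (nmul h) (decays_nmul h Hh)) as (M3 & HM3).
exists (K * M).
apply (taylor1_ext (fun x => usum (fun i => h i * (RtoC (hgauss p (x - IZR (fst i))) * expi (PI * IZR (snd i) * x))))%C _ t
  (usum (fun i => h i * ((RtoC (hgauss1 p (t - IZR (fst i))) + Ci * RtoC (PI * IZR (snd i) * hgauss p (t - IZR (fst i)))) * expi (PI * IZR (snd i) * t)))%C)).
- auto.
- unfold gauss_series. rewrite <- (usum_scal _ _ _ (HM1 t)), <- (usum_scal _ _ _ (HM2 t)).
  rewrite <- (usum_plus _ _ _ _ (abs_bsum_scal _ _ _ (HM2 t)) (HM3 t)).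
  rewrite <- (usum_plus _ _ _ _ (abs_bsum_scal _ _ _ (HM1 t)) (abs_bsum_plus _ _ _ _ (abs_bsum_scal _ _ _ (HM2 t)) (HM3 t))).
  apply usum_ext. intros i. unfold nmul, hgauss1. rewrite !RtoC_plus, !RtoC_mult. ring.
- apply (usum_taylor1 (fun i x => h i * (RtoC (hgauss p (x - IZR (fst i))) * expi (PI * IZR (snd i) * x)))%C t _
    (fun i => Cmod (h i) * (2 * (B * (1 + Rabs (PI * IZR (snd i))) ^ 2)))).
  + intros i. apply taylor1_scal.
    apply (taylor1_ext (fun x => RtoC (hgauss p (x - IZR (fst i))) * expi (PI * IZR (snd i) * x + 0))%C _ t
      ((RtoC (hgauss1 p (t - IZR (fst i))) + Ci * RtoC (PI * IZR (snd i) * hgauss p (t - IZR (fst i)))) * expi (PI * IZR (snd i) * t + 0))%C).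
    * intros x. rewrite Rplus_0_r. auto.
    * rewrite Rplus_0_r. auto.
    * apply (term_taylor1 (fun x => hgauss p (x - IZR (fst i))) (fun x => hgauss1 p (x - IZR (fst i))) (fun x => hgauss2 p (x - IZR (fst i)))).
      intros x; apply is_derive_shift; apply hgauss_der. intros x; apply is_derive_shift; apply hgauss1_der.
      intros x _. unfold B. assert (A1 := Rmax_l B0 (Rmax B1 B2)). assert (A2 := Rmax_r B0 (Rmax B1 B2)).
      assert (A3 := Rmax_l B1 B2). assert (A4 := Rmax_r B1 B2).
      specialize (HB0 (x - IZR (fst i))). specialize (HB1 (x - IZR (fst i))). specialize (HB2 (x - IZR (fst i))). repeat split; lra.
  + generalize (bsum_scal K _ _ PK HM). apply bsum_mono; [|lra]. intros i.
    rewrite Rabs_mult, (Rabs_pos_eq PI) by lra.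
    assert (X : (1 + PI * Rabs (IZR (snd i))) ^ 2 <= (1 + PI) ^ 2 * (1 + l1size i) ^ 2).
    { rewrite <- Rpow_mult_distr. apply pow_incr. unfold l1size.
      assert (X1 := Rabs_pos (IZR (fst i))). assert (X2 := Rabs_pos (IZR (snd i))). split; nra. }
    assert (Q := Cmod_ge_0 (h i)). unfold K.
    replace (2 * (B * (1 + PI) ^ 2) * (Cmod (h i) * (1 + l1size i) ^ 2)) with (Cmod (h i) * (2 * (B * ((1 + PI) ^ 2 * (1 + l1size i) ^ 2)))) by ring.
    apply Rmult_le_compat_l; auto. apply Rmult_le_compat_l; [lra|]. apply Rmult_le_compat_l; auto.
  + intros x. destruct (gauss_series_abs_bsum0 p h Hh) as (M0 & HM0). exists M0. apply HM0.
  + eexists. eapply bsum_mono; [|apply Rle_refl|apply (abs_bsum_plus _ _ _ _ (abs_bsum_scal (RtoC (INR p)) _ _ (HM1 t)) (abs_bsum_plus _ _ _ _ (abs_bsum_scal (RtoC (- (2 * half_pi))) _ _ (HM2 t)) (HM3 t)))].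
    intros i. simpl. right. f_equal. unfold nmul, hgauss1. rewrite !RtoC_plus, !RtoC_mult. ring.
Qed.

(** Formal finite sums of [gauss_series], a class closed under differentiation: derivatives of all
    orders come from iterating a syntactic operation. *)
Definition gseries := list (nat * (I2 -> C)).
Definition gseries_val (s : gseries) (t : R) : C := lsum (fun ph => gauss_series (fst ph) (snd ph) t) s.
Fixpoint gseries_deriv (s : gseries) : gseries :=
  match s with
  | nil => nil
  | (p, h) :: s => (pred p, fun i => RtoC (INR p) * h i)%C :: (S p, fun i => RtoC (- (2 * half_pi)) * h i)%C :: (p, nmul h) :: gseries_deriv s
  end.
Definition gseries_ok (s : gseries) : Prop := forall ph, In ph s -> decays (snd ph).

Lemma gseries_ok_deriv s : gseries_ok s -> gseries_ok (gseries_deriv s).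
Proof.
induction s as [|[p h] s IH]; intros H; simpl; auto.
assert (Hh : decays h) by (apply (H (p, h)); left; auto).
assert (Hs : gseries_ok (gseries_deriv s)) by (apply IH; intros ph Hph; apply H; right; auto).
intros ph [<-|[<-|[<-|Hp]]]; simpl.
- apply decays_scal; auto.
- apply decays_scal; auto.
- apply decays_nmul; auto.
- apply Hs; auto.
Qed.

Lemma gseries_taylor1 s t : gseries_ok s -> exists M, taylor1 (gseries_val s) t (gseries_val (gseries_deriv s) t) M.
Proof.
induction s as [|[p h] s IH]; intros H.
- exists 0. intros x _. simpl. replace (0 - 0 - RtoC x * 0)%C with (RtoC 0) by ring. rewrite Cmod_0. lra.
- assert (Hh : decays h) by (apply (H (p, h)); left; auto).
  destruct IH as (M1 & H1). { intros ph Hph; apply H; right; auto. }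
  destruct (gauss_series_taylor1 p h t Hh) as (M2 & H2). exists (M2 + M1). intros x Hx.
  specialize (H1 x Hx). specialize (H2 x Hx).
  unfold gseries_val in *. cbn [gseries_deriv lsum fold_right fst snd]. rewrite !gauss_series_scal by auto.
  fold (lsum (fun ph => gauss_series (fst ph) (snd ph) t) s). fold (lsum (fun ph => gauss_series (fst ph) (snd ph) (t + x)) s). fold (lsum (fun ph => gauss_series (fst ph) (snd ph) t) (gseries_deriv s)).
  match type of H1 with Cmod ?a <= _ => match type of H2 with Cmod ?b <= _ => 
    match goal with |- Cmod ?c <= _ => replace c with (b + a)%C by ring end end end.
  eapply Rle_trans; [apply Cmod_triangle|]. lra.
Qed.

Lemma gseries_bound s k : gseries_ok s -> exists M, forall t, Rabs t ^ k * Cmod (gseries_val s t) <= M.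
Proof.
induction s as [|[p h] s IH]; intros H.
- exists 0. intros t. simpl. rewrite Cmod_0. lra.
- destruct IH as (M1 & H1). { intros ph Hph; apply H; right; auto. }
  destruct (gauss_series_bound p h k) as (M2 & H2). { apply (H (p, h)); left; auto. }
  exists (M2 + M1). intros t. specialize (H1 t). specialize (H2 t).
  unfold gseries_val in *. cbn [lsum fold_right fst snd]. fold (lsum (fun ph => gauss_series (fst ph) (snd ph) t) s).
  eapply Rle_trans; [apply Rmult_le_compat_l; [apply pow_le, Rabs_pos|apply Cmod_triangle]|]. lra.
Qed.

Lemma schwartz_actA (a : l1) tau M : 0 < tau -> wnorm tau a M -> schwartz (actA a gaussian).
Proof.
intros Ht Ha. set (s0 := ((O, co a) :: nil) : gseries).
assert (G0 : gseries_ok s0). { intros ph [<-|[]]. simpl. exists tau, M; auto. }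
set (it := fix it n := match n with O => s0 | S n => gseries_deriv (it n) end).
assert (G : forall n, gseries_ok (it n)). { induction n; simpl; auto. apply gseries_ok_deriv; auto. }
exists (fun n => gseries_val (it n)). split; [|split].
- intros t. unfold gseries_val. simpl. rewrite Cplus_0_r. unfold gauss_series, act. apply usum_ext. intros i.
  unfold hgauss, gaussian, eA, sA. rewrite pow_O, Rmult_1_l. fold half_pi. ring.
- intros n t. destruct (gseries_taylor1 (it n) t (G n)) as (M' & H). eapply taylor1_is_derive. exact H.
- intros k n. apply gseries_bound; auto.
Qed.

(** * Small shifts and small divisors *)

(** Uses only [PI >= 3] and [exp (1/2) >= 3/2], with [(3/2)^5 > 7]. *)
Lemma exp_bound_7 : exp (/ 2 - PI) <= / 7.
Proof.
assert (P : 3 <= PI) by (assert (X := PI2_3_2); lra).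
apply Rle_trans with (exp (- (5 / 2))); [apply exp_le; lra|].
rewrite exp_Ropp. apply Rinv_le_contravar; [lra|].
replace (5 / 2) with (INR 5 * (/ 2)) by (simpl; lra). rewrite <- exp_pow.
apply Rle_trans with ((3 / 2) ^ 5); [lra|]. apply pow_incr. split; [lra|].
assert (X := exp_ineq1_le (/ 2)). lra.
Qed.

(** By [|k| <= k^2] and [exp_bound_7], each coordinate contributes a geometric series with ratio 1/7
    and total 4/3; dropping the central coefficient 1 from the product leaves [(4/3)^2 - 1 = 7/9].
    As this is below 1, [theta(1)] is invertible in weight 1/2. *)
Lemma beta0_wnorm : wnorm (/ 2) (l1_sub (beta 0 0) l1_1) (7 / 9).
Proof.
assert (G : bsum (fun k : Z => exp (/ 2 * Rabs (IZR k)) * gauss PI (IZR k)) (4 / 3)).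
{ assert (X := bsum_geom (/ 7) ltac:(lra)). revert X. apply bsum_mono; [|lra].
  intros k. apply Rle_trans with (exp (/ 2 - PI) ^ Z.abs_nat k).
  - rewrite exp_pow, INR_abs_nat. unfold gauss. rewrite <- exp_plus. apply exp_le.
    assert (Q : Rabs (IZR k) <= IZR k ^ 2).
    { rewrite <- abs_IZR. replace (IZR k ^ 2) with (IZR (k * k)) by (rewrite mult_IZR; ring). apply IZR_le. nia. }
    assert (P := PI_RGT_0). nra.
  - apply pow_incr. split; [left; apply exp_pos|apply exp_bound_7]. }
assert (P : forall k : Z, 0 <= exp (/ 2 * Rabs (IZR k)) * gauss PI (IZR k)).
{ intros k. apply Rmult_le_pos; left; [apply exp_pos|apply gauss_pos]. }
assert (GG := bsum_prod _ _ _ _ P P G G).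
set (m := fun p : I2 => exp (/ 2 * Rabs (IZR (fst p))) * gauss PI (IZR (fst p)) * (exp (/ 2 * Rabs (IZR (snd p))) * gauss PI (IZR (snd p)))) in GG.
assert (E : forall p, p <> (0,0)%Z -> weight (/ 2) p * Cmod (l1_sub (beta 0 0) l1_1 p) = m p).
{ intros p Np. simpl. unfold delta. destruct (eqdec p (0,0)%Z); [contradiction|].
  rewrite Cmult_0_r, Cplus_0_r. unfold beta_co.
  rewrite Cmod_mult, Cmod_expi, Cmod_gauss_mul. replace (0 / 2) with 0 by field. rewrite !Rminus_0_r.
  unfold m, weight. rewrite Rmult_plus_distr_l, exp_plus. ring. }
assert (E0 : weight (/ 2) (0,0)%Z * Cmod (l1_sub (beta 0 0) l1_1 (0,0)%Z) = 0).
{ simpl. unfold delta. destruct (eqdec (0,0)%Z (0,0)%Z); [|congruence]. unfold beta_co; cbn [fst snd].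
  replace (0 / 2) with 0 by field. rewrite Rminus_0_r. replace (2 * PI * (0 + 0) * 0) with 0 by ring.
  rewrite expi_0. unfold gauss. replace (- PI * 0 ^ 2) with 0 by ring. rewrite exp_0.
  replace (RtoC (1 * 1) * 1 + -1 * 1)%C with (RtoC 0). rewrite Cmod_0; ring. apply injective_projections; simpl; ring. }
assert (Em : m (0,0)%Z = 1).
{ unfold m; cbn [fst snd]. rewrite Rabs_R0, Rmult_0_r, exp_0. unfold gauss. replace (- PI * 0 ^ 2) with 0 by ring. rewrite exp_0. ring. }
intros l Nl.
set (l' := filter (fun p => if eqdec p (0,0)%Z then false else true) l).
assert (Nl' : NoDup ((0,0)%Z :: l')).
{ constructor; [|apply NoDup_filter; auto]. intros Hi. apply filter_In in Hi. destruct Hi as [_ Hi].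
  destruct (eqdec (0,0)%Z (0,0)%Z); [discriminate|congruence]. }
specialize (GG _ Nl'). cbn [rsum fold_right] in GG. fold (rsum m l') in GG. rewrite Em in GG.
assert (X : rsum (fun i => weight (/ 2) i * Cmod (l1_sub (beta 0 0) l1_1 i)) l = rsum m l'); [|lra].
unfold l'. clear - E E0. induction l as [|p l IH]; [reflexivity|]. cbn [rsum fold_right filter].
fold (rsum (fun i => weight (/ 2) i * Cmod (l1_sub (beta 0 0) l1_1 i)) l). rewrite IH.
destruct (eqdec p (0,0)%Z) as [->|Np]; [rewrite E0; apply Rplus_0_l|]. rewrite (E p Np). reflexivity.
Qed.

(** The offset 2 keeps the value at most 1/2 for every [N], including 0. *)
Definition inv_nat (N : nat) : R := / (INR N + 2).

Lemma inv_nat_pos N : 0 < inv_nat N.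
Proof. unfold inv_nat. apply Rinv_0_lt_compat. assert (X := pos_INR N). lra. Qed.

Lemma inv_nat_lim (u : R -> R) : continuous u 0 -> forall eps, 0 < eps ->
  exists N0, forall N, (N0 <= N)%nat -> Rabs (u (inv_nat N) - u 0) <= eps.
Proof.
intros Hu eps He. destruct (proj1 (filterlim_locally u (u 0)) Hu (mkposreal _ He)) as (e & H). simpl in H.
destruct (nfloor_ex (/ e)) as (N0 & HN0). { left; apply Rinv_0_lt_compat, cond_pos. }
exists (S N0). intros N HN.
assert (Pe : 0 < e) by apply cond_pos.
assert (B : inv_nat N < e).
{ unfold inv_nat. rewrite <- (Rinv_inv e). apply Rinv_lt_contravar.
  - apply Rmult_lt_0_compat. apply Rinv_0_lt_compat; auto. assert (X := pos_INR N); lra.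
  - assert (INR (S N0) <= INR N) by (apply le_INR; auto). rewrite S_INR in H0. lra. }
assert (P := inv_nat_pos N).
left. apply (H (inv_nat N)). unfold ball; simpl; unfold AbsRing_ball, abs, minus, plus, opp; simpl.
replace (inv_nat N + - 0) with (inv_nat N) by ring. rewrite Rabs_pos_eq; lra.
Qed.

Lemma inv_nat_limC (u : R -> C) : continuous (fun s : R => Re (u s)) 0 -> continuous (fun s : R => Im (u s)) 0 ->
  forall eps, 0 < eps -> exists N0, forall N, (N0 <= N)%nat -> Cmod (u (inv_nat N) - u 0)%C <= eps.
Proof.
intros H1 H2 eps He.
destruct (inv_nat_lim _ H1 (eps / 2)) as (N1 & K1); [lra|]. destruct (inv_nat_lim _ H2 (eps / 2)) as (N2 & K2); [lra|].
exists (N1 + N2)%nat. intros N HN. specialize (K1 N ltac:(lia)). specialize (K2 N ltac:(lia)).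
replace eps with (2 * (eps / 2)) by field. apply Cmod_le_2; auto.
Qed.

Lemma inv_nat_le N : inv_nat N <= / 2.
Proof. unfold inv_nat. apply Rinv_le_contravar; [lra|]. assert (X := pos_INR N). lra. Qed.

(** Since [(k - 2 y)^2 >= 0], one has [(k - y)^2 >= k^2 / 2 - y^2]. This gives a majorant
    independent of the shift [y]. *)
Lemma gauss_shift_dom c k y : 0 < c -> Rabs y <= 1 -> gauss c (k - y) <= exp c * gauss (c / 2) k.
Proof.
intros Pc Hy. unfold gauss. rewrite <- exp_plus. apply exp_le.
assert (Y : y ^ 2 <= 1). { rewrite <- (pow2_abs y). assert (X := Rabs_pos y). replace 1 with (1 ^ 2) by ring. apply pow_incr; lra. }
assert (Q := pow2_ge_0 (k - 2 * y)).
replace (c + - (c / 2) * k ^ 2) with (- c * (k - y) ^ 2 + (c / 2 * (k - 2 * y) ^ 2 + c * (1 - y ^ 2))) by field.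
assert (0 <= c / 2 * (k - 2 * y) ^ 2) by (apply Rmult_le_pos; lra).
assert (0 <= c * (1 - y ^ 2)) by (apply Rmult_le_pos; lra). lra.
Qed.

(** Dominated convergence; the bounds 2 on [c1] and [c2] with [inv_nat N <= 1/2] keep the centres in
    the range of [gauss_shift_dom]. *)
Lemma beta_cont T c1 c2 : 0 <= T -> Rabs c1 <= 2 -> Rabs c2 <= 2 -> forall eps, 0 < eps ->
  exists N0, forall N, (N0 <= N)%nat -> wnorm T (l1_sub (beta (c1 * inv_nat N) (c2 * inv_nat N)) (beta 0 0)) eps.
Proof.
intros HT H1 H2. assert (PP := PI_RGT_0).
destruct (gauss_weighted_sum (PI / 2) T ltac:(lra) HT) as (A & PA & HA). specialize (HA 0).
rewrite Rabs_R0, Rmult_0_r, exp_0, Rmult_1_r in HA.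
set (m0 := fun k : Z => exp PI * gauss (PI / 2) (IZR k)).
set (m := fun p : I2 => 2 * (m0 (fst p) * m0 (snd p))).
assert (P0 : forall k, 0 < m0 k) by (intros; apply Rmult_lt_0_compat; [apply exp_pos|apply gauss_pos]).
assert (HB : forall s, 0 <= s <= / 2 -> forall p, Cmod (beta (c1 * s) (c2 * s) p) <= m0 (fst p) * m0 (snd p)).
{ intros s Hs p. simpl. unfold beta_co. rewrite Cmod_mult, Cmod_expi, Cmod_gauss_mul, Rmult_1_r.
  apply Rmult_le_compat; try (left; apply gauss_pos); apply gauss_shift_dom; auto.
  - replace (c1 * s / 2) with (c1 * (s / 2)) by field. rewrite Rabs_mult, (Rabs_pos_eq (s / 2)) by lra. assert (X := Rabs_pos c1). nra.
  - rewrite Rabs_mult, (Rabs_pos_eq s) by lra. assert (X := Rabs_pos c2). nra. }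
apply (wnorm_dominated T _ m (2 * ((exp PI * A) * (exp PI * A)))).
- assert (PE : 0 <= exp PI) by (left; apply exp_pos).
  assert (Q := bsum_scal _ _ _ PE HA).
  assert (Pq : forall k : Z, 0 <= exp PI * (exp (T * Rabs (IZR k)) * gauss (PI / 2) (IZR k - 0))).
  { intros k. apply Rmult_le_pos; auto. apply Rmult_le_pos; left; [apply exp_pos|apply gauss_pos]. }
  generalize (bsum_scal 2 _ _ ltac:(lra) (bsum_prod _ _ _ _ Pq Pq Q Q)). apply bsum_mono; [|lra]. intros [k l].
  unfold m, m0, weight; cbn [fst snd]. rewrite !Rminus_0_r, Rmult_plus_distr_l, exp_plus. right; ring.
- intros p. unfold m. apply Rmult_le_pos; [lra|]. apply Rmult_le_pos; left; apply P0.
- intros N p. assert (S1 := inv_nat_pos N). assert (S2 := inv_nat_le N).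
  assert (X := HB (inv_nat N) ltac:(lra) p). assert (Y := HB 0 ltac:(lra) p).
  replace (c1 * 0) with 0 in Y by ring. replace (c2 * 0) with 0 in Y by ring.
  change (Cmod (beta (c1 * inv_nat N) (c2 * inv_nat N) p + -1 * beta 0 0 p)%C <= m p).
  eapply Rle_trans; [apply Cmod_triangle|]. rewrite Cmod_mult, Cmod_R. replace (Rabs (-1)) with 1 by (unfold Rabs; destruct Rcase_abs; lra).
  unfold m. lra.
- intros p eps He.
  destruct (inv_nat_limC (fun s => beta_co (c1 * s) (c2 * s) p)) with (eps := eps) as (N0 & HN0); auto.
  + unfold beta_co, gauss, expi, Cmult, RtoC, Re; simpl.
    match goal with |- continuous ?f _ => apply (ex_derive_continuous f) end. auto_derive; auto.
  + unfold beta_co, gauss, expi, Cmult, RtoC, Im; simpl.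
    match goal with |- continuous ?f _ => apply (ex_derive_continuous f) end. auto_derive; auto.
  + exists N0. intros N HN. specialize (HN0 N HN). cbv beta in HN0.
    replace (c1 * 0) with 0 in HN0 by ring. replace (c2 * 0) with 0 in HN0 by ring.
    simpl. replace (beta_co (c1 * inv_nat N) (c2 * inv_nat N) p + -1 * beta_co 0 0 p)%C with (beta_co (c1 * inv_nat N) (c2 * inv_nat N) p - beta_co 0 0 p)%C by ring. auto.
Qed.

(** The characters tend to 1 pointwise, with twice the coefficients as a majorant; no rate is
    available uniformly in the index. *)
Lemma modulate_cont tau (a : l1) M c1 c2 : wnorm tau a M -> forall eps, 0 < eps ->
  exists N0, forall N, (N0 <= N)%nat -> wnorm tau (l1_sub (modulate (chA (c1 * inv_nat N) (c2 * inv_nat N)) a) a) eps.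
Proof.
intros Ha. apply (wnorm_dominated tau _ (fun i => 2 * Cmod (a i)) (2 * M)).
- generalize (bsum_scal 2 _ _ ltac:(lra) Ha). apply bsum_mono; [|lra]. intros i. right; ring.
- intros i. apply Rmult_le_pos; [lra|apply Cmod_ge_0].
- intros N i. simpl. eapply Rle_trans; [apply Cmod_triangle|]. rewrite !Cmod_mult, Cmod_expi, Cmod_R.
  replace (Rabs (-1)) with 1 by (unfold Rabs; destruct Rcase_abs; lra). lra.
- intros i eps He. assert (Q := Cmod_ge_0 (a i)).
  destruct (inv_nat_limC (fun s => expi (chA (c1 * s) (c2 * s) i))) with (eps := eps / (Cmod (a i) + 1)) as (N0 & HN0).
  + unfold chA, expi, Re; simpl. match goal with |- continuous ?f _ => apply (ex_derive_continuous f) end. auto_derive; auto.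
  + unfold chA, expi, Im; simpl. match goal with |- continuous ?f _ => apply (ex_derive_continuous f) end. auto_derive; auto.
  + apply Rdiv_lt_0_compat; lra.
  + exists N0. intros N HN. specialize (HN0 N HN). cbv beta in HN0.
    replace (chA (c1 * 0) (c2 * 0) i) with 0 in HN0 by (unfold chA; ring). rewrite expi_0 in HN0.
    simpl. replace (a i * expi (chA (c1 * inv_nat N) (c2 * inv_nat N) i) + -1 * a i)%C with (a i * (expi (chA (c1 * inv_nat N) (c2 * inv_nat N) i) - 1))%C by ring.
    rewrite Cmod_mult. apply Rle_trans with ((Cmod (a i) + 1) * (eps / (Cmod (a i) + 1))); [|right; field; lra].
    apply Rmult_le_compat; auto; try lra. apply Cmod_ge_0.
Qed.

Lemma sqrt_le_2 u : 0 <= u <= 4 -> 0 <= sqrt u <= 2.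
Proof.
intros H. split; [apply sqrt_pos|]. assert (X := sqrt_pos u). assert (Y := sqrt_sqrt u (proj1 H)). nra.
Qed.

(** The hypothesis says that [X^2] is twice the square of [2ab], so irrationality of sqrt 2 gives
    [ab = 0]. What is left is [2 b^2 = 3 c^2] or [a^2 = 3 c^2], settled by the irrationality of sqrt
    6 and sqrt 3. *)
Lemma norm_form_nonzero (a b c : Z) :
  ((a * a + 2 * (b * b) - 3 * (c * c)) * (a * a + 2 * (b * b) - 3 * (c * c)) = 8 * (a * a * (b * b)))%Z ->
  b = 0%Z /\ c = 0%Z.
Proof.
intros E. set (X := (a * a + 2 * (b * b) - 3 * (c * c))%Z) in *.
assert (AB : (2 * (a * b) = 0)%Z).
{ apply (nonsquare_descent 2 1 ltac:(lia) ltac:(lia) ltac:(lia) X). rewrite E. ring. }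
assert (X0 : X = 0%Z). { assert (X * X = 0)%Z; [rewrite E; replace (8 * (a * a * (b * b)))%Z with (2 * (2 * (a * b)) * (2 * (a * b)))%Z by ring; rewrite AB; ring|]. nia. }
unfold X in X0.
destruct (Z.eq_dec a 0) as [->|Na].
- assert (C0 : c = 0%Z). { apply (nonsquare_descent 6 2 ltac:(lia) ltac:(lia) ltac:(lia) (2 * b)). nia. }
  subst c. split; auto. nia.
- assert (B0 : b = 0%Z) by nia. subst b. split; auto.
  apply (nonsquare_descent 3 1 ltac:(lia) ltac:(lia) ltac:(lia) a). nia.
Qed.

(* The product of the four conjugates of [a + b sqrt 2 + c sqrt 3] is a nonzero integer. *)
Lemma liouville a b c B : (b, c) <> (0, 0)%Z ->
  Rabs (IZR a) + 2 * Rabs (IZR b) + 2 * Rabs (IZR c) <= B -> 0 < B -> / B ^ 3 <= Rabs (IZR a + IZR b * sqrt 2 + IZR c * sqrt 3).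
Proof.
intros N HB PB.
assert (S2 : sqrt 2 * sqrt 2 = 2) by (apply sqrt_sqrt; lra).
assert (S3 : sqrt 3 * sqrt 3 = 3) by (apply sqrt_sqrt; lra).
assert (P2 : 0 <= sqrt 2 <= 2) by (apply sqrt_le_2; lra).
assert (P3 : 0 <= sqrt 3 <= 2) by (apply sqrt_le_2; lra).
set (x := IZR a) in *. set (y := IZR b) in *. set (z := IZR c) in *.
set (n := ((a * a + 2 * (b * b) - 3 * (c * c)) * (a * a + 2 * (b * b) - 3 * (c * c)) - 8 * (a * a * (b * b)))%Z).
assert (Nn : n <> 0%Z).
{ intros E. apply N. unfold n in E. destruct (norm_form_nonzero a b c) as [-> ->]; [lia|auto]. }
assert (E : (x + y * sqrt 2 + z * sqrt 3) * ((x + y * sqrt 2 - z * sqrt 3) * ((x - y * sqrt 2 + z * sqrt 3) * (x - y * sqrt 2 - z * sqrt 3))) = IZR n).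
{ unfold n. rewrite minus_IZR, !mult_IZR, !minus_IZR, !plus_IZR, !mult_IZR. fold x y z.
  replace ((x + y * sqrt 2 + z * sqrt 3) * ((x + y * sqrt 2 - z * sqrt 3) * ((x - y * sqrt 2 + z * sqrt 3) * (x - y * sqrt 2 - z * sqrt 3))))
   with ((x * x + (sqrt 2 * sqrt 2) * (y * y) - (sqrt 3 * sqrt 3) * (z * z)) * (x * x + (sqrt 2 * sqrt 2) * (y * y) - (sqrt 3 * sqrt 3) * (z * z)) - 4 * (sqrt 2 * sqrt 2) * (x * x * (y * y))) by ring.
  rewrite S2, S3. ring. }
assert (In : 1 <= Rabs (IZR n)). { rewrite <- abs_IZR. apply IZR_le. lia. }
assert (Bd : forall e e', Rabs e <= 2 -> Rabs e' <= 2 -> Rabs (x + y * e + z * e') <= B).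
{ intros e e' He He'. eapply Rle_trans; [apply Rabs_triang|]. eapply Rle_trans; [apply Rplus_le_compat_r, Rabs_triang|].
  rewrite !Rabs_mult. assert (Q1 := Rabs_pos y). assert (Q2 := Rabs_pos z).
  assert (Rabs y * Rabs e <= Rabs y * 2) by (apply Rmult_le_compat_l; auto).
  assert (Rabs z * Rabs e' <= Rabs z * 2) by (apply Rmult_le_compat_l; auto). lra. }
assert (A2 : Rabs (sqrt 2) <= 2) by (rewrite Rabs_pos_eq; lra).
assert (A3 : Rabs (sqrt 3) <= 2) by (rewrite Rabs_pos_eq; lra).
assert (A2' : Rabs (- sqrt 2) <= 2) by (rewrite Rabs_Ropp; auto).
assert (A3' : Rabs (- sqrt 3) <= 2) by (rewrite Rabs_Ropp; auto).
assert (C1 : Rabs (x + y * sqrt 2 - z * sqrt 3) <= B) by (replace (x + y * sqrt 2 - z * sqrt 3) with (x + y * sqrt 2 + z * - sqrt 3) by ring; auto).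
assert (C2 : Rabs (x - y * sqrt 2 + z * sqrt 3) <= B) by (replace (x - y * sqrt 2 + z * sqrt 3) with (x + y * - sqrt 2 + z * sqrt 3) by ring; auto).
assert (C3 : Rabs (x - y * sqrt 2 - z * sqrt 3) <= B) by (replace (x - y * sqrt 2 - z * sqrt 3) with (x + y * - sqrt 2 + z * - sqrt 3) by ring; auto).
rewrite <- E, !Rabs_mult in In.
set (al := Rabs (x + y * sqrt 2 + z * sqrt 3)) in *.
assert (Q0 : 0 <= al) by apply Rabs_pos.
apply Rmult_le_reg_l with (B ^ 3); [apply pow_lt; auto|]. rewrite Rinv_r by (apply pow_nonzero; lra).
eapply Rle_trans; [exact In|]. rewrite (Rmult_comm (B ^ 3)). apply Rmult_le_compat_l; auto.
replace (B ^ 3) with (B * (B * B)) by ring.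
assert (Y := Rabs_pos). repeat apply Rmult_le_compat; auto; apply Rmult_le_pos; auto.
Qed.

(** The modulus is [2 |sin (t / 2)|], and on [[0, 2]] the cubic Taylor bound gives
    [sin u >= u - u^3 / 6 >= u / 3]. *)
Lemma expi_lower t : Rabs t <= PI -> Rabs t / 3 <= Cmod (1 - expi t)%C.
Proof.
intros Ht. assert (P4 := PI_4). assert (PP := PI_RGT_0).
assert (E : Cmod (1 - expi t)%C = 2 * Rabs (sin (t / 2))).
{ transitivity (sqrt (Rsqr (2 * sin (t / 2)))).
  2:{ rewrite sqrt_Rsqr_abs, Rabs_mult, (Rabs_pos_eq 2) by lra. auto. }
  unfold Cmod. f_equal. set (h := t / 2). replace t with (2 * h) by (unfold h; field).
  unfold expi, Rsqr; simpl. rewrite cos_2a, sin_2a.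
  assert (S := sin2_cos2 h). unfold Rsqr in S. set (s := sin h) in *. set (c := cos h) in *.
  assert (C : c * c = 1 - s * s) by lra. clearbody s c.
  transitivity ((1 - (c * c - s * s)) * (1 - (c * c - s * s)) + 4 * (s * s) * (c * c)); [ring|].
  rewrite C. ring. }
assert (L : forall u, 0 <= u <= 2 -> u / 3 <= sin u).
{ intros u Hu. destruct (pre_sin_bound u 0) as [K _]; try lra.
  unfold sin_approx, sin_term in K. simpl in K. nra. }
rewrite E. destruct (Rle_dec 0 t).
- rewrite (Rabs_pos_eq t) in * by auto. assert (X := L (t / 2) ltac:(lra)). rewrite Rabs_pos_eq; lra.
- rewrite (Rabs_left t) in * by lra. assert (X := L (- t / 2) ltac:(lra)).
  replace (- t / 2) with (- (t / 2)) in X by field. rewrite sin_neg in X. rewrite Rabs_left1; lra.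
Qed.

(** The divisor is comparable to the distance of [v] to the integers, bounded below by an inverse
    cube through [liouville]; [poly_exp] exchanges the cube for the exponential loss [1/2 - 1/4]
    between the two weights. *)
Lemma small_divisors M : 1 <= M -> (exists q : Z, M = IZR q) -> exists cd, 0 < cd /\
  forall p, p <> (0,0)%Z -> cd * exp (- ((/ 2 - / 4) * (Rabs (IZR (fst p)) + Rabs (IZR (snd p))))) <=
     Cmod (1 - expi (chB (- (sqrt 2 / M)) (- (sqrt 3 / M)) p))%C.
Proof.
intros HM (q & Hq). destruct (poly_exp (/ 4) 3) as (K & PK & HK); [lra|].
assert (PP := PI_RGT_0).
exists (/ (1000 * M ^ 4 * K)).
assert (PM4 : 0 < M ^ 4) by (apply pow_lt; lra).
split. { apply Rinv_0_lt_compat. apply Rmult_lt_0_compat; auto. lra. }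
intros [k l] Np. cbn [fst snd]. set (y := Rabs (IZR k) + Rabs (IZR l)).
assert (Py : 0 <= y) by (unfold y; assert (A := Rabs_pos (IZR k)); assert (B := Rabs_pos (IZR l)); lra).
set (v := (IZR l * sqrt 2 - 2 * IZR k * sqrt 3) / M).
(* The integer nearest to [v], so that the angle [2 PI (v - j)] lies in the range of
   [expi_lower]. *)
set (j := Int_part (v + / 2)). assert (Hj := base_Int_part (v + / 2)). fold j in Hj.
assert (Hv : Rabs (v - IZR j) <= / 2) by (apply Rabs_le; lra).
assert (E : expi (chB (- (sqrt 2 / M)) (- (sqrt 3 / M)) (k, l)) = expi (2 * PI * (v - IZR j))).
{ unfold chB; cbn [fst snd]. replace (4 * PI * IZR k * - (sqrt 3 / M) - 2 * PI * IZR l * - (sqrt 2 / M)) with (2 * PI * (v - IZR j) + 2 * PI * IZR j) by (unfold v; field; lra).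
  rewrite expi_plus, expi_2PI. ring. }
rewrite E. eapply Rle_trans; [|apply expi_lower].
2:{ rewrite !Rabs_mult, (Rabs_pos_eq 2), (Rabs_pos_eq PI) by lra.
    assert (PI * Rabs (v - IZR j) <= PI * / 2) by (apply Rmult_le_compat_l; lra). lra. }
rewrite !Rabs_mult, (Rabs_pos_eq 2), (Rabs_pos_eq PI) by lra.
assert (S2 : 0 <= sqrt 2 <= 2) by (apply sqrt_le_2; lra).
assert (S3 : 0 <= sqrt 3 <= 2) by (apply sqrt_le_2; lra).
assert (Vb : Rabs (v * M) <= 4 * y).
{ unfold v. replace ((IZR l * sqrt 2 - 2 * IZR k * sqrt 3) / M * M) with (IZR l * sqrt 2 + - (2 * (IZR k * sqrt 3))) by (field; lra).
  eapply Rle_trans; [apply Rabs_triang|]. rewrite Rabs_Ropp, !Rabs_mult, (Rabs_pos_eq 2), (Rabs_pos_eq (sqrt 2)), (Rabs_pos_eq (sqrt 3)) by lra.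
  unfold y. assert (A := Rabs_pos (IZR k)). assert (B := Rabs_pos (IZR l)). nra. }
(* Multiplying [v - j] by the integer [M = q] gives an integer combination of 1, sqrt 2 and sqrt 3;
   its coefficients have size at most [10 M (1 + y)]. *)
assert (Lv : / (10 * M * (1 + y)) ^ 3 <= Rabs (IZR (- (j * q)) + IZR l * sqrt 2 + IZR (- (2 * k)) * sqrt 3)).
{ apply liouville.
  - intros E'. apply Np. assert (E1 := f_equal fst E'). assert (E2 := f_equal snd E'). cbn [fst snd] in E1, E2. f_equal; lia.
  - rewrite !opp_IZR, !mult_IZR, !Rabs_Ropp, <- Hq.
    assert (J : Rabs (IZR j * M) <= 4 * y + M).
    { replace (IZR j * M) with (v * M + - ((v - IZR j) * M)) by ring. eapply Rle_trans; [apply Rabs_triang|].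
      rewrite Rabs_Ropp, (Rabs_mult (v - IZR j)), (Rabs_pos_eq M) by lra.
      assert (Rabs (v - IZR j) * M <= / 2 * M) by (apply Rmult_le_compat_r; lra). lra. }
    rewrite (Rabs_mult 2), (Rabs_pos_eq 2) by lra.
    assert (A := Rabs_pos (IZR k)). assert (B := Rabs_pos (IZR l)). unfold y in *. nra.
  - nra. }
replace (IZR (- (j * q)) + IZR l * sqrt 2 + IZR (- (2 * k)) * sqrt 3) with (M * (v - IZR j)) in Lv.
2:{ rewrite !opp_IZR, !mult_IZR, <- Hq. unfold v. field; lra. }
rewrite Rabs_mult, (Rabs_pos_eq M) in Lv by lra.
specialize (HK y Py).
assert (Ky : 0 < (1 + y) ^ 3) by (apply pow_lt; lra).
replace (- ((/ 2 - / 4) * y)) with (- (/ 4 * y)) by field. rewrite exp_Ropp.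
assert (Pe := exp_pos (/ 4 * y)).
assert (F : / (1000 * M ^ 4 * K) * / exp (/ 4 * y) <= / M * / (10 * M * (1 + y)) ^ 3).
{ rewrite <- !Rinv_mult. apply Rinv_le_contravar.
  - apply Rmult_lt_0_compat; [lra|]. apply pow_lt. apply Rmult_lt_0_compat; lra.
  - replace (M * (10 * M * (1 + y)) ^ 3) with (1000 * M ^ 4 * (1 + y) ^ 3) by ring.
    rewrite (Rmult_assoc (1000 * M ^ 4)). apply Rmult_le_compat_l; lra. }
eapply Rle_trans; [exact F|].
assert (Lv' : / M * / (10 * M * (1 + y)) ^ 3 <= Rabs (v - IZR j)).
{ apply Rmult_le_reg_l with M; [lra|]. rewrite <- Rmult_assoc, Rinv_r, Rmult_1_l by lra. auto. }
assert (P3 : 3 <= PI) by (assert (X := PI2_3_2); lra). assert (Q := Rabs_pos (v - IZR j)). nra.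
Qed.

Lemma irrational_sqrt n s M : (0 < s)%Z -> (s * s < n)%Z -> (n < (s + 1) * (s + 1))%Z -> 0 < M -> (exists q : Z, M = IZR q) ->
  irrational (sqrt (IZR n) / M).
Proof.
intros Ps H1 H2 HM (m & Hm) (q & Hq). destruct q as [a d]. unfold Q2R in Hq; cbn [QArith_base.Qnum QArith_base.Qden] in Hq.
assert (Pd : 0 < IZR (Z.pos d)) by (apply IZR_lt; lia).
destruct (sqrt_lin_indep n s Ps H1 H2 (- (m * a)) (Z.pos d)) as [_ K]; [|lia].
rewrite opp_IZR, mult_IZR, <- Hm.
assert (E : sqrt (IZR n) = M * (IZR a * / IZR (Z.pos d))) by (rewrite <- Hq; field; lra).
rewrite E. field. lra.
Qed.

(** * The counterexample *)

Definition bounded (f : R -> C) : Prop := exists M, bdd f M.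

Lemma bounded_actA (a : l1) f : bounded f -> bounded (actA a f).
Proof. apply act_bdd_ex. apply eA_mod. Qed.
Lemma bounded_actB (a : l1) f : bounded f -> bounded (actB a f).
Proof. apply act_bdd_ex. apply eB_mod. Qed.
Lemma bounded_shift z f : bounded f -> bounded (tf_shift z f).
Proof. intros [M H]. exists M. apply shift_bdd; auto. Qed.
Lemma bounded_gaussian : bounded gaussian.
Proof. apply gaussian_bdd_ex. Qed.
#[local] Hint Resolve bounded_actA bounded_actB bounded_shift bounded_gaussian : core.

Lemma actA_add (a b : l1) f t : bounded f -> actA (l1_add a b) f t = (actA a f t + actA b f t)%C.
Proof. intros H. apply act_add; auto. apply eA_mod. Qed.
Lemma actA_sub (a b : l1) f t : bounded f -> actA (l1_sub a b) f t = (actA a f t - actA b f t)%C.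
Proof. intros H. apply act_sub; auto. apply eA_mod. Qed.
Lemma actB_scal c (a : l1) f t : bounded f -> actB (l1_scal c a) f t = (c * actB a f t)%C.
Proof. intros H. apply act_scal; auto. apply eB_mod. Qed.
Lemma actA_mulE a b f : bounded f -> actA (tmul a b) f = actA a (actA b f).
Proof. intros H. extensionality t. apply actA_tmul; auto. Qed.
Lemma actB_mulE a b f : bounded f -> actB (cmul a b) f = actB a (actB b f).
Proof. intros H. extensionality t. apply actB_cmul; auto. Qed.
Lemma actA_iotaE (b : l1) f : bounded f -> actA (iota b) f = actB b f.
Proof. intros H. extensionality t. apply actA_iota; auto. Qed.
Lemma actAB_commE (a b : l1) f : bounded f -> actA a (actB b f) = actB b (actA a f).
Proof. intros H. extensionality t. apply actAB_comm; auto. Qed.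
Lemma actB_1E f : actB l1_1 f = f.
Proof.
extensionality t. apply act_1.
- unfold eB; simpl. rewrite Rmult_0_r, Rmult_0_l. apply expi_0.
- unfold sB; simpl. ring.
Qed.
Lemma actA_1E f : actA l1_1 f = f.
Proof.
extensionality t. apply act_1.
- unfold eA; simpl. rewrite Rmult_0_r, Rmult_0_l. apply expi_0.
- reflexivity.
Qed.
Lemma shift_actAE x w (a : l1) f : bounded f -> tf_shift (x, w) (actA a f) = actA (modulate (chA x w) a) (tf_shift (x, w) f).
Proof. intros H. extensionality t. apply shift_actA; auto. Qed.
Lemma shift_actBE x w (a : l1) f : bounded f -> tf_shift (x, w) (actB a f) = actB (modulate (chB x w) a) (tf_shift (x, w) f).
Proof. intros H. extensionality t. apply shift_actB; auto. Qed.

Lemma shift_0 f : tf_shift (0, 0) f = f.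
Proof.
extensionality t. unfold tf_shift; simpl. rewrite Rmult_0_r, expi_0, Rminus_0_r. ring.
Qed.

Lemma tmul_sub_l a b c : tmul (l1_sub a b) c = l1_sub (tmul a c) (tmul b c).
Proof. unfold l1_sub, l1_opp, tmul. rewrite gmul_add_l, gmul_scal_l. auto. Qed.
Lemma tmul_sub_r a b c : tmul a (l1_sub b c) = l1_sub (tmul a b) (tmul a c).
Proof. unfold l1_sub, l1_opp, tmul. rewrite gmul_add_r, gmul_scal_r. auto. Qed.
Lemma iota_sub a b : iota (l1_sub a b) = l1_sub (iota a) (iota b).
Proof.
apply l1_eq; intros i; simpl. unfold iota_co. destruct (Z.even (fst i)); [|ring].
destruct (Z.even (snd i)); ring.
Qed.
Lemma modulate_sub th a b : modulate th (l1_sub a b) = l1_sub (modulate th a) (modulate th b).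
Proof. apply l1_eq; intros i; simpl; ring. Qed.

Lemma tmul_wnorm tau (a b : l1) A B : 0 <= tau -> wnorm tau a A -> wnorm tau b B -> wnorm tau (tmul a b) (A * B).
Proof. apply gmul_wnorm. Qed.

Lemma modulate_1 x w : modulate (chA x w) l1_1 = l1_1.
Proof.
apply l1_eq; intros i; simpl. unfold delta. destruct (eqdec i (0,0)%Z) as [->|]; [|ring].
unfold chA; cbn [fst snd]. replace (2 * PI * 0 * w - PI * 0 * x) with 0 by ring. rewrite expi_0. ring.
Qed.

Lemma modulate_inv x w (a : l1) : modulate (chA (- x) (- w)) (modulate (chA x w) a) = a.
Proof.
apply l1_eq; intros i; simpl. replace (chA (- x) (- w) i) with (- chA x w i) by (unfold chA; ring).
rewrite <- Cmult_assoc, expi_opp. ring.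
Qed.

(* Writing [S' = tf_shift (-x, -w)], [K] maps [S' g] back to [g] although it is
   close to 1: it is [1 + y_- E - S' (y_0 E) S'^-1], where [y_- E S' g = g] and
   [y_0 E g = g]. Closeness to 1 is what makes [theta (S'^-1 K S')] invertible. *)
Lemma near_identity_intertwiner kap : (forall x w t, actA (E_l1 kap) (tf_shift (x, w) gaussian) t = actB (beta x w) gaussian t) ->
  exists N (K y : l1) MK, let x := sqrt 2 * inv_nat N in let w := sqrt 3 * inv_nat N in
    wnorm (/ 4) K MK /\ actA K (tf_shift (- x, - w) gaussian) = gaussian /\
    cmul y (theta (modulate (chA x w) K)) = l1_1 /\ wnorm (/ 2) y 9.
Proof.
intros FG.
assert (FE : forall x w, actA (E_l1 kap) (tf_shift (x, w) gaussian) = actB (beta x w) gaussian) by (intros; extensionality t; auto).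
assert (FE0 : actA (E_l1 kap) gaussian = actB (beta 0 0) gaussian) by (rewrite <- FE, shift_0; auto).
destruct (neumann (/ 2) _ (7 / 9) ltac:(lra) ltac:(lra) beta0_wnorm) as (y0 & Ey0 & Ny0).
replace (l1_add l1_1 (l1_sub (beta 0 0) l1_1)) with (beta 0 0) in Ey0 by ring.
destruct (theta_wnorm (/ 4)) as (A & PA & HA); [lra|].
destruct (E_wnorm kap (/ 4)) as (ME & HE); [lra|].
assert (NE : wnorm (/ 4) (E_l1 kap) ME) by exact HE. assert (PE := wnorm_ge0 _ _ _ NE).
set (a0 := tmul (iota y0) (E_l1 kap)).
assert (Na0 : wnorm (/ 4) a0 (/ (1 - 7 / 9) * ME)).
{ apply tmul_wnorm; [lra| |exact NE]. apply iota_wnorm. replace (2 * / 4) with (/ 2) by field. exact Ny0. }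
assert (PMA : 0 <= ME * A) by (apply Rmult_le_pos; lra).
(* The budget: [theta(1) - 1] has norm at most 7/9, and [e1], [e2] make both perturbations of it at
   most 1/9, so that the Neumann series runs with ratio 8/9. *)
set (e1 := / (900 * (ME * A + 1))). set (e2 := / (18 * A)).
assert (P1 : 0 < e1) by (apply Rinv_0_lt_compat; lra). assert (P2 : 0 < e2) by (apply Rinv_0_lt_compat; lra).
assert (E1 : e1 * (ME * A) <= / 900 /\ e1 <= / 9).
{ assert (X : e1 * (ME * A + 1) = / 900) by (unfold e1; field; lra). nra. }
assert (E2 : e2 * A = / 18) by (unfold e2; field; lra).
assert (S2 : 0 <= sqrt 2 <= 2) by (apply sqrt_le_2; lra).
assert (S3 : 0 <= sqrt 3 <= 2) by (apply sqrt_le_2; lra).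
destruct (beta_cont (/ 2) (- sqrt 2) (- sqrt 3)) with (eps := e1) as (N1 & H1); auto; try lra.
{ rewrite Rabs_Ropp, Rabs_pos_eq; lra. } { rewrite Rabs_Ropp, Rabs_pos_eq; lra. }
destruct (modulate_cont (/ 4) a0 _ (- sqrt 2) (- sqrt 3) Na0 e2 P2) as (N2 & H2).
set (N := (N1 + N2)%nat). specialize (H1 N ltac:(lia)). specialize (H2 N ltac:(lia)).
set (x := sqrt 2 * inv_nat N). set (w := sqrt 3 * inv_nat N).
replace (- sqrt 2 * inv_nat N) with (- x) in * by (unfold x; ring). replace (- sqrt 3 * inv_nat N) with (- w) in * by (unfold w; ring).
set (bm := beta (- x) (- w)) in *.
assert (Nbm : wnorm (/ 2) (l1_sub bm l1_1) (8 / 9)).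
{ replace (l1_sub bm l1_1) with (l1_add (l1_sub bm (beta 0 0)) (l1_sub (beta 0 0) l1_1)) by ring.
  eapply wnorm_mono; [apply Rle_refl| |apply wnorm_add; [exact H1|exact beta0_wnorm]]. lra. }
destruct (neumann (/ 2) _ (8 / 9) ltac:(lra) ltac:(lra) Nbm) as (ym & Eym & Nym).
replace (l1_add l1_1 (l1_sub bm l1_1)) with bm in Eym by ring.
set (K := l1_sub (l1_add l1_1 (tmul (iota ym) (E_l1 kap))) (modulate (chA (- x) (- w)) a0)).
assert (NK1 : wnorm (/ 4) (l1_sub K l1_1) (/ (1 - 8 / 9) * (/ (1 - 7 / 9) * e1) * ME + e2)).
(* The difference of the two inverses is [ym - y0 = ym y0 (beta 0 0 - bm)]. Hence [K - 1] has one
   term small by continuity of [beta] and another small by continuity of [modulate]. *)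
{ replace (l1_sub K l1_1) with (l1_sub (tmul (iota (cmul ym (cmul y0 (l1_sub (beta 0 0) bm)))) (E_l1 kap)) (l1_sub (modulate (chA (- x) (- w)) a0) a0)).
  2:{ replace (cmul ym (cmul y0 (l1_sub (beta 0 0) bm))) with (l1_sub (cmul (cmul (beta 0 0) y0) ym) (cmul (cmul bm ym) y0)) by ring.
      rewrite Ey0, Eym. replace (l1_sub (cmul l1_1 ym) (cmul l1_1 y0)) with (l1_sub ym y0) by ring.
      rewrite iota_sub, tmul_sub_l. unfold K. fold a0. ring. }
  apply wnorm_sub; [|exact H2]. apply tmul_wnorm; [lra| |exact NE]. apply iota_wnorm. replace (2 * / 4) with (/ 2) by field.
  apply cmul_wnorm; [lra|exact Nym|]. apply cmul_wnorm; [lra|exact Ny0|].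
  replace (l1_sub (beta 0 0) bm) with (l1_opp (l1_sub bm (beta 0 0))) by ring. apply wnorm_opp. exact H1. }
assert (NH : wnorm (/ 2) (l1_sub (theta (modulate (chA x w) K)) l1_1) (8 / 9)).
{ replace (theta (modulate (chA x w) K)) with (l1_add (beta 0 0) (theta (modulate (chA x w) (l1_sub K l1_1)))).
  2:{ rewrite modulate_sub, modulate_1, theta_sub, theta_1. ring. }
  replace (l1_sub (l1_add (beta 0 0) (theta (modulate (chA x w) (l1_sub K l1_1)))) l1_1) with
    (l1_add (l1_sub (beta 0 0) l1_1) (theta (modulate (chA x w) (l1_sub K l1_1)))) by ring.
  eapply wnorm_mono; [apply Rle_refl| |apply wnorm_add; [exact beta0_wnorm|]].
  2:{ replace (/ 2) with (2 * / 4) by field. apply HA. apply modulate_wnorm. exact NK1. }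
  nra. }
destruct (neumann (/ 2) _ (8 / 9) ltac:(lra) ltac:(lra) NH) as (y & Ey & Ny).
exists N, K, y. eexists. split; [|split; [|split]].
- replace K with (l1_add (l1_sub K l1_1) l1_1) by ring. apply wnorm_add; [exact NK1|apply wnorm_1].
(* Applied to [S' g], the three terms of [K] give [S' g], then g, then [- S' g]. *)
- fold x w. extensionality t. unfold K.
  assert (B : bounded (tf_shift (- x, - w) gaussian)) by auto.
  rewrite actA_sub, actA_add by auto.
  rewrite actA_1E, actA_mulE, actA_iotaE, FE, <- actB_mulE by auto. fold bm.
  replace (cmul ym bm) with (cmul bm ym) by ring. rewrite Eym, actB_1E.
  rewrite <- shift_actAE by auto. unfold a0.
  rewrite actA_mulE, actA_iotaE, FE0, <- actB_mulE by auto.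
  replace (cmul y0 (beta 0 0)) with (cmul (beta 0 0) y0) by ring. rewrite Ey0, actB_1E. ring.
- fold x w. rewrite <- Ey. ring.
- eapply wnorm_mono; [apply Rle_refl| |exact Ny]. right; field.
Qed.

(** The finite list [l] is what finally becomes the finite set of points Lambda. *)
Lemma truncate tau (a : l1) M eps : 0 <= tau -> wnorm tau a M -> 0 < eps ->
  exists (P : l1) (l : list I2), NoDup l /\ (forall i, ~ In i l -> P i = RtoC 0) /\ wnorm tau (l1_sub P a) eps.
Proof.
intros Ht Ha He.
destruct (bsum_tail (fun i => weight tau i * Cmod (a i)) M eps) as (l & Nl & H); auto.
{ intros i. apply Rmult_le_pos; [left; apply weight_pos|apply Cmod_ge_0]. }
set (P := fun i => if in_dec eqdec i l then a i else RtoC 0).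
assert (PO : exists M, abs_bsum P M).
{ exists M. apply (wnorm_abs_bsum tau) in Ha; auto. revert Ha. apply bsum_mono; [|lra]. intros i. unfold P.
  destruct (in_dec eqdec i l); [lra|rewrite Cmod_0; apply Cmod_ge_0]. }
exists (mkl1 P PO), l. split; [auto|split].
- intros i Hi. simpl. unfold P. destruct (in_dec eqdec i l); [contradiction|auto].
- revert H. apply bsum_mono; [|lra]. intros i. simpl. unfold P. destruct (in_dec eqdec i l).
  + replace (a i + -1 * a i)%C with (RtoC 0) by (apply injective_projections; simpl; ring). rewrite Cmod_0; lra.
  + apply Rmult_le_compat_l; [left; apply weight_pos|]. rewrite Cplus_0_l, Cmod_mult, Cmod_R.
    unfold Rabs; destruct Rcase_abs; lra.
Qed.

(** The scalar relation in finite form. Nonvanishing is asserted for [c2], which becomes the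
    coefficient at the origin and makes the dependence nontrivial. *)
Lemma functional_equation : exists (N : nat) (P : l1) (l : list I2) (f : R -> C) (c1 c2 : C),
  let x := sqrt 2 * inv_nat N in let w := sqrt 3 * inv_nat N in
  NoDup l /\ (forall i, ~ In i l -> P i = RtoC 0) /\ schwartz f /\ bounded f /\ (exists t, f t <> RtoC 0) /\
  c2 <> RtoC 0 /\ (forall t, (c1 * actA P f t)%C = (c2 * tf_shift (- x, - w)%R f t)%C).
Proof.
destruct figa as (kap & FG).
destruct (near_identity_intertwiner kap FG) as (N & K & y & MK & NK & EK & Ey & Ny).
set (x := sqrt 2 * inv_nat N) in *. set (w := sqrt 3 * inv_nat N) in *.
(* Conjugation by the inverse shift: [S' H0 g = K S' g = g]. *)
set (H0 := modulate (chA x w) K) in *.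
assert (PMK := wnorm_ge0 _ _ _ NK).
assert (NH0 : wnorm (/ 4) H0 MK) by (apply modulate_wnorm; auto).
destruct (E_wnorm kap (/ 4)) as (ME & HE); [lra|].
assert (NE : wnorm (/ 4) (E_l1 kap) ME) by exact HE.
(* Normalized by [y = theta(H0)^-1], so that [Eh H0 g = g]. *)
set (Eh := tmul (iota y) (E_l1 kap)).
assert (NEh : wnorm (/ 4) Eh (9 * ME)).
{ apply tmul_wnorm; [lra| |exact NE]. apply iota_wnorm. replace (2 * / 4) with (/ 2) by field. auto. }
destruct (theta_wnorm (/ 4)) as (A & PA & HA); [lra|]. replace (2 * / 4) with (/ 2) in HA by field.
set (th := fun a => cmul y (theta a)).
set (A' := 9 * A + 1).
assert (PA' : 1 <= A') by (unfold A'; lra).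
assert (th_sub : forall a b, th (l1_sub a b) = l1_sub (th a) (th b)).
{ intros a b. unfold th. rewrite theta_sub. ring. }
assert (th_wnorm : forall (a : l1) M, wnorm (/ 4) a M -> wnorm (/ 2) (th a) (A' * M)).
{ intros a M Ha. assert (PM := wnorm_ge0 _ _ _ Ha). eapply wnorm_mono; [apply Rle_refl| |apply cmul_wnorm; [lra|exact Ny|apply HA; exact Ha]].
  unfold A'. nra. }
set (MM := INR N + 2).
assert (PMM : 1 <= MM) by (unfold MM; assert (X := pos_INR N); lra).
assert (MMZ : exists q : Z, MM = IZR q).
{ exists (Z.of_nat N + 2)%Z. unfold MM. rewrite plus_IZR, INR_IZR_INZ. auto. }
destruct (small_divisors MM PMM MMZ) as (cd & Pcd & SD).
assert (Ex : sqrt 2 / MM = x) by (unfold x, inv_nat, MM; auto). assert (Ew : sqrt 3 / MM = w) by (unfold w, inv_nat, MM; auto).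
rewrite Ex, Ew in SD.
destruct (cohomological (chB (- x) (- w)) (/ 2) (/ 4) cd ltac:(lra) Pcd) as (kc0 & Pkc & COH).
{ intros i j. unfold chB, zadd; cbn [fst snd]. rewrite !plus_IZR. ring. }
{ exact SD. }
(* Two constraints: [4 A' kp <= 1] for the contraction, and [2 A' kp <= kc0], which puts [th k] in
   the range of the cohomological equation. *)
set (kp := / (4 * A') * Rmin 1 kc0).
assert (Pmin : 0 < Rmin 1 kc0) by (apply Rmin_pos; lra). assert (Mk1 := Rmin_l 1 kc0). assert (Mk2 := Rmin_r 1 kc0).
assert (PiA : 0 < / (4 * A')) by (apply Rinv_0_lt_compat; lra).
assert (Pkp : 0 < kp) by (apply Rmult_lt_0_compat; auto).
assert (Ekp : 4 * A' * kp = Rmin 1 kc0) by (unfold kp; field; lra).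
assert (kp1 : kp <= 1) by nra.
(* The first two bounds serve the invariance and the contraction in [fixed_point]; the third gives
   [e <= 1/8] and makes [S' F] nonzero at 0. *)
set (e := Rmin (kp / (2 * (MK + 1))) (Rmin (/ (16 * A') / (MK + 1)) (/ (16 * (MK + 3))))).
assert (Pe : 0 < e).
{ repeat apply Rmin_pos.
  - apply Rdiv_lt_0_compat; lra.
  - apply Rdiv_lt_0_compat; [apply Rinv_0_lt_compat|]; lra.
  - apply Rinv_0_lt_compat; lra. }
assert (B1 : e * (2 * (MK + 1)) <= kp).
{ apply Rle_trans with (kp / (2 * (MK + 1)) * (2 * (MK + 1))); [|right; field; lra]. apply Rmult_le_compat_r; [lra|apply Rmin_l]. }
assert (B2 : e * (MK + 1) <= / (16 * A')).
{ apply Rle_trans with (/ (16 * A') / (MK + 1) * (MK + 1)); [|right; field; lra].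
  apply Rmult_le_compat_r; [lra|]. eapply Rle_trans; [apply Rmin_r|apply Rmin_l]. }
assert (B3 : e * (16 * (MK + 3)) <= 1).
{ apply Rle_trans with (/ (16 * (MK + 3)) * (16 * (MK + 3))); [|right; field; lra].
  apply Rmult_le_compat_r; [lra|]. eapply Rle_trans; [apply Rmin_r|apply Rmin_r]. }
assert (B4 : e <= / 8) by nra.
(* The right factor [K] in [Q] costs a factor [MK], which is compensated here. *)
set (ep := e / (MK + 1)).
assert (Pep : 0 < ep) by (apply Rdiv_lt_0_compat; lra).
assert (epMK : ep * MK <= e). { assert (X : ep * (MK + 1) = e) by (unfold ep; field; lra). nra. }
assert (epe : ep <= e). { assert (X : ep * (MK + 1) = e) by (unfold ep; field; lra). nra. }
destruct (truncate (/ 4) Eh _ ep ltac:(lra) NEh Pep) as (P & l & Nl & Psup & NP).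
set (dl := l1_sub P Eh) in *.
(* The right factor [K] turns [S' g] into g: with [k = Q z H], the term [S' (k g)] equals
   [z dl H g], the correction required in [S' F]. *)
set (Q := fun z v => modulate (chA x w) (tmul (iota z) (tmul dl (tmul v K)))).
destruct (fixed_point (/ 4) (/ 2) A' MK th H0 ltac:(lra) ltac:(lra) PA' NH0 th_sub th_wnorm Q e kp) as (k & z & Nk & Nz & Ez & Ek); auto; try lra.
{ intros a b v. unfold Q. rewrite iota_sub, tmul_sub_l, modulate_sub. auto. }
{ intros a v v'. unfold Q. rewrite tmul_sub_l, !tmul_sub_r, modulate_sub. auto. }
{ intros a v Z V Ha Hv. unfold Q. apply modulate_wnorm.
  assert (PZ := wnorm_ge0 _ _ _ Ha). assert (PV := wnorm_ge0 _ _ _ Hv).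
  eapply wnorm_mono; [apply Rle_refl| |apply tmul_wnorm; [lra|apply iota_wnorm; replace (2 * / 4) with (/ 2) by field; exact Ha|apply tmul_wnorm; [lra|exact NP|apply tmul_wnorm; [lra|exact Hv|exact NK]]]].
  replace (Z * (ep * (V * MK))) with (ep * MK * (Z * V)) by ring. apply Rmult_le_compat_r; auto. apply Rmult_le_pos; auto. }
set (H := l1_add H0 k) in *.
set (F := actA H gaussian). set (S := tf_shift (- x, - w)).
assert (BF : bounded F) by (unfold F; auto).
assert (ESF : forall t, S F t = (gaussian t + actB z (actA dl F) t)%C).
{ intros t. unfold S, F. rewrite shift_actAE by auto.
  replace (modulate (chA (- x) (- w)) H) with (l1_add K (tmul (iota z) (tmul dl (tmul H K)))).
  - rewrite actA_add by auto. rewrite EK.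
    rewrite !actA_mulE, actA_iotaE, EK by auto. auto.
  - unfold H at 2. replace (modulate (chA (- x) (- w)) (l1_add H0 k)) with (l1_add (modulate (chA (- x) (- w)) H0) (modulate (chA (- x) (- w)) k)).
    2:{ apply l1_eq; intros i; simpl; ring. }
    rewrite Ek. fold H. unfold Q, H0. rewrite !modulate_inv. auto. }
set (eta := th k).
assert (Nphi : th H = l1_add l1_1 eta).
{ unfold H, eta, th. rewrite theta_add. rewrite <- Ey. ring. }
assert (Eh_act : actA Eh F = actB (l1_add l1_1 eta) gaussian).
{ rewrite <- Nphi. unfold Eh, th, F. rewrite actA_mulE, actA_iotaE by auto. rewrite actB_mulE by auto. f_equal.
  extensionality t. apply theta_act. auto. }
assert (zphi : cmul (l1_add l1_1 eta) z = l1_1).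
{ fold eta in Ez. transitivity (l1_add z (cmul eta z)); [ring|]. rewrite Ez at 1. ring. }
(* [P = Eh + dl] and [z] inverts [phi = 1 + eta], so [P F = phi g + dl F = phi (g + z dl F) = phi S'
   F]. *)
assert (PF : forall t, actA P F t = actB (l1_add l1_1 eta) (S F) t).
{ intros t. replace (S F) with (fun t => gaussian t + actB z (actA dl F) t)%C by (extensionality u; auto).
  replace P with (l1_add Eh dl) by (unfold dl; ring). rewrite actA_add by auto. rewrite Eh_act.
  set (G := actB z (actA dl F)). assert (BG : bounded G) by (unfold G; auto).
  assert (AD : forall (b : l1) u v, bounded u -> bounded v -> actB b (fun t => u t + v t)%C t = (actB b u t + actB b v t)%C).
  { intros b u v [Mu Hu] [Mv Hv]. destruct (l1_ok b) as (Mb & Hb). unfold act.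
    rewrite <- (usum_plus _ _ _ _ (act_abs_bsum eB sB eB_mod b u Mu Mb t Hu Hb) (act_abs_bsum eB sB eB_mod b v Mv Mb t Hv Hb)).
    apply usum_ext; intros; ring. }
  rewrite AD by auto. f_equal. unfold G. rewrite <- actB_mulE by auto. rewrite zphi, actB_1E. auto. }
(* At 0 the Gaussian equals 1, while the correction is at most [3 (MK + 3) e <= 3/16] in sup
   norm. *)
assert (SF0 : S F 0 <> RtoC 0).
{ rewrite ESF. intros E.
  assert (X : Cmod (actB z (actA dl F) 0) <= 1 * (MK + 2 * kp) * ep * 3).
  { apply (act_bdd eB sB eB_mod z _ (1 * (MK + 2 * kp) * ep) 3).
    - apply (act_bdd eA sA eA_mod). 
      + apply (act_bdd eA sA eA_mod). apply gaussian_bdd. apply (wnorm_abs_bsum (/ 4)); [lra|]. apply wnorm_add; auto.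
      + apply (wnorm_abs_bsum (/ 4)); [lra|]. exact NP.
    - apply (wnorm_abs_bsum (/ 2)); [lra|]. exact Nz. }
  assert (G0 : gaussian 0 = RtoC 1). { unfold gaussian, gauss. replace (- (PI / 2) * 0 ^ 2) with 0 by ring. rewrite exp_0. auto. }
  rewrite G0 in E. replace (actB z (actA dl F) 0) with (- RtoC 1)%C in X.
  2:{ replace (actB z (actA dl F) 0) with ((1 + actB z (actA dl F) 0) - 1)%C by ring. rewrite E. ring. }
  rewrite Cmod_opp, Cmod_1 in X.
  assert ((MK + 2 * kp) * ep * 3 <= (MK + 3) * e * 3).
  { apply Rmult_le_compat_r; [lra|]. apply Rmult_le_compat; lra. }
  lra. }
destruct (COH eta) as (psi & psi' & d1 & d2 & d3 & (Mpsi & Npsi) & D1 & D2 & D3 & Epsi & Ecoh).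
{ unfold eta. eapply wnorm_mono; [apply Rle_refl| |apply th_wnorm; exact Nk]. nra. }
set (f := actB psi F).
assert (Bf : bounded f) by (unfold f; auto).
exists N, P, l, f, d1, d2. fold x w. cbv zeta.
split; [auto|split; [auto|split; [|split; [auto|split; [|split; [auto|]]]]]].
- assert (Ef : f = actA (tmul (iota psi) H) gaussian).
  { unfold f, F. rewrite actA_mulE, actA_iotaE by auto. auto. }
  rewrite Ef. eapply (schwartz_actA _ (/ 8)); [lra|]. apply tmul_wnorm; [lra| |].
  + apply iota_wnorm. replace (2 * / 8) with (/ 4) by field. exact Npsi.
  + eapply wnorm_mono; [|apply Rle_refl|apply wnorm_add; [exact NH0|exact Nk]]. lra.
(* [psi' psi] is a nonzero constant, so [f = psi F] can vanish only if [F] does. *)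
- apply NNPP. intros Nf. apply SF0.
  assert (F0 : forall t, F t = RtoC 0).
  { intros t. assert (E : actB psi' f t = (d3 * F t)%C).
    { unfold f. rewrite <- actB_mulE, Epsi by auto. unfold l1_cst. rewrite actB_scal by auto. rewrite actB_1E. auto. }
    assert (Z : actB psi' f t = RtoC 0).
    { unfold act. transitivity (lsum (fun _ : I2 => RtoC 0) nil); [|reflexivity]. apply usum_unique.
      apply (is_usum_ext (fun _ => RtoC 0)).
      - intros i. assert (E' : f (t - sB i)%R = RtoC 0) by (apply NNPP; intros X; apply Nf; exists (t - sB i)%R; auto). rewrite E'. ring.
      - apply is_usum_support; [constructor|auto]. }
    rewrite Z in E. transitivity (/ d3 * (d3 * F t))%C; [field; auto|]. rewrite <- E. ring. }
  unfold S, tf_shift. rewrite F0. ring.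
(* [psi] commutes with [P], so [c1 P f = c1 psi phi S' F = c2 (psi rotated) S' F = c2 S' (psi
   F)]. *)
- intros t. fold S. unfold f.
  rewrite actAB_commE by auto.
  replace (actA P F) with (actB (l1_add l1_1 eta) (S F)) by (extensionality u; auto).
  assert (BS : bounded (S F)) by (unfold S; auto).
  rewrite <- actB_mulE by auto. rewrite <- actB_scal by auto. rewrite Ecoh.
  rewrite actB_scal by auto. f_equal. unfold S. rewrite shift_actBE by auto. auto.
Qed.

Lemma lsum_Csum {I} (a : I -> C) l : Csum (map a l) = lsum a l.
Proof. induction l as [|i l IH]; simpl; auto. unfold Csum in *. simpl. rewrite IH. auto. Qed.

Theorem theorem1p2 :
  exists (zeta : R * R) (Lambda : R * R -> Prop) (f : R -> C),
    (irrational (fst zeta) /\ irrational (snd zeta)) /\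
    finite_pred Lambda /\
    (forall z, Lambda z -> shifted_lattice zeta z) /\
    schwartz f /\
    (exists t, f t <> RtoC 0) /\
    linearly_dependent (fun z => Lambda z \/ z = (0, 0))
                       (fun z => tf_shift z f).
Proof.
destruct functional_equation as (N & P & l & f & c1 & c2 & Nl & Psup & Sf & Bf & Nf & Nc & Ef).
set (x := sqrt 2 * inv_nat N) in *. set (w := sqrt 3 * inv_nat N) in *.
assert (PM : 0 < INR N + 2) by (assert (X := pos_INR N); lra).
assert (MZ : exists q : Z, INR N + 2 = IZR q).
{ exists (Z.of_nat N + 2)%Z. rewrite plus_IZR, INR_IZR_INZ. auto. }
assert (Ix : irrational x).
{ apply (irrational_sqrt 2 1 (INR N + 2)); auto; lia. }
assert (Iw : irrational w).
{ apply (irrational_sqrt 3 1 (INR N + 2)); auto; lia. }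
set (pt := fun i : I2 => (IZR (fst i) + x, IZR (snd i) / 2 + w)).
assert (pt_inj : forall i j, pt i = pt j -> i = j).
{ intros [a b] [a' b'] E. unfold pt in E; cbn [fst snd] in E. injection E as E1 E2. f_equal; apply eq_IZR; lra. }
(* The origin is not a translated lattice point, since [x] is not an integer; so its coefficient
   cannot be merged with another one. *)
assert (pt_0 : forall i, pt i <> (0, 0)).
{ intros [a b] E. unfold pt in E; cbn [fst snd] in E. injection E as E1 E2. apply Ix.
  exists (QArith_base.Qmake (- a) 1). unfold Q2R; simpl. rewrite opp_IZR. lra. }
exists (x, w), (fun z => In z (map pt l)), f.
split; [auto|split; [|split; [|split; [auto|split; [auto|]]]]].
- exists (map pt l). auto.
- intros z Hz. apply in_map_iff in Hz. destruct Hz as ([a b] & <- & _). exists a, b. reflexivity.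
(* The relation is moved by [tf_shift (x, w)]: [S' f] goes back to a multiple of [f], and the
   lattice point [i] goes to [pt i]. The phases in [d] and [c] come from reordering the shifts. *)
- set (d := fun i : I2 => (c1 * P i * expi (- (PI * IZR (snd i) * x)))%C).
  (* Coefficients must be a function of the point itself; as [pt] is injective, the sum selects the
     one index lying over [z]. *)
  set (c := fun z : R * R => if eqdec z (0, 0) then (- (c2 * expi (2 * PI * x * w)))%C
     else lsum (fun i => if eqdec (pt i) z then d i else RtoC 0) l).
  exists ((0, 0) :: map pt l), c.
  assert (NDm : NoDup (map pt l)) by (apply Injective_map_NoDup; auto).
  split; [|split; [|split]].
  + constructor; auto. intros Hi. apply in_map_iff in Hi. destruct Hi as (i & E & _). apply (pt_0 i); auto.
  + intros i [<-|Hi]; auto.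
  + exists (0, 0). split; [left; auto|]. unfold c. destruct (eqdec (0, 0) (0, 0)) as [_|]; [|congruence].
    intros E. assert (E' : Cmod (c2 * expi (2 * PI * x * w))%C = 0) by (rewrite <- Cmod_opp, E; apply Cmod_0).
    rewrite Cmod_mult, Cmod_expi, Rmult_1_r in E'. apply Cmod_eq_0 in E'. contradiction.
  + intros t. rewrite lsum_Csum. cbn [lsum fold_right]. fold (lsum (fun i => c i * tf_shift i f t)%C (map pt l)).
    rewrite lsum_map.
    rewrite (lsum_ext _ (fun i => d i * tf_shift (pt i) f t)%C).
    2:{ intros i Hi. f_equal. unfold c. destruct (eqdec (pt i) (0, 0)) as [E|_]; [elim (pt_0 i E)|].
        rewrite (lsum_ext _ (fun j => if eqdec j i then d j else RtoC 0)); [apply lsum_single; auto|].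
        intros j _. destruct (eqdec (pt j) (pt i)) as [E|E], (eqdec j i) as [E'|E']; auto.
        elim E'; auto. subst; congruence. }
    unfold c at 1. destruct (eqdec (0, 0) (0, 0)) as [_|]; [|congruence]. rewrite shift_0.
    (* Evaluation at [t - x], followed by multiplication with the phase of frequency [w], is the
       application of [tf_shift (x, w)]. *)
    assert (E := Ef (t - x)).
    assert (EA : actA P f (t - x) = lsum (fun i => P i * (eA i (t - x) * f (t - x - sA i)%R))%C l).
    { apply usum_unique, is_usum_support; auto. intros i Hi. rewrite Psup by auto. ring. }
    rewrite EA in E. unfold tf_shift at 1 in E; cbn [fst snd] in E. replace (t - x - - x) with t in E by ring.
    assert (E2 : (lsum (fun i => d i * tf_shift (pt i) f t)%C l = expi (2 * PI * t * w) * (c1 * lsum (fun i => P i * (eA i (t - x) * f (t - x - sA i)%R)) l))%C).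
    { rewrite <- !lsum_scal. apply lsum_ext. intros i _. unfold d, tf_shift, pt, eA, sA; cbn [fst snd].
      replace (t - (IZR (fst i) + x)) with (t - x - IZR (fst i)) by ring.
      replace (2 * PI * t * (IZR (snd i) / 2 + w)) with (2 * PI * t * w + PI * IZR (snd i) * t) by field.
      replace (PI * IZR (snd i) * (t - x)) with (PI * IZR (snd i) * t + - (PI * IZR (snd i) * x)) by ring.
      rewrite !expi_plus. ring. }
    rewrite E2, E.
    transitivity (c2 * f t * (expi (2 * PI * t * w) * expi (2 * PI * (t - x) * - w) - expi (2 * PI * x * w)))%C; [ring|].
    rewrite <- expi_plus. replace (2 * PI * t * w + 2 * PI * (t - x) * - w) with (2 * PI * x * w) by ring. ring.
Qed.
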